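(* Fix $p \geq 2$ and consider the $p$-spin Curie–Weiss model, i.e. the $p$-tensor Ising model $\mathbb{P}_\beta$ with interaction tensor $J_{i_1 \ldots i_p} = \frac{1}{N^{p-1}}$ for all $1 \leq i_1, \ldots, i_p \leq N$. Suppose $\beta = \beta_{\mathrm{CW}}^*(p)$, let $\boldsymbol X\sim\mathbb{P}_\beta$, and let $\hat\beta_N=\hat\beta_N(\boldsymbol X)$ be the maximum pseudo-likelihood (MPL) estimate. For $p\ge 3$, denote by $m_*=m_*(\beta, p) \in (0, 1)$ the unique positive global maximizer of $g(t):= \beta t^p - I(t)$, $t \in [-1, 1]$, and define $$\alpha := \begin{cases} \dfrac{1}{1+2[(m_*^2-1)g''(m_* )]^{-1/2}} & \text{if } p \text{ is even},\\[2mm] \dfrac{1}{1+[(m_*^2-1)g''(m_* )]^{-1/2}} & \text{if } p \text{ is odd}. \end{cases}$$ Then the following hold as $N \rightarrow \infty$. (1) If $p = 2$ (in which case $\beta_{\mathrm{CW}}^*(2)=\frac{1}{2}$), then for every $t\in \mathbb{R}$, $$\lim_{N\rightarrow \infty} \mathbb{P}_\beta\left (N^{1/2}\left(\hat{\beta}_N - \tfrac{1}{2}\right) \leq t\right) = \begin{cases} F(\sqrt{6t}) - F(-\sqrt{6t}) & \text{if } t\geq 0,\\ 0 & \text{if } t < 0, \end{cases}$$ where $F$ is the probability distribution function with density given by $dF(t) \propto \exp\left(-\frac{t^4}{12}\right) dt$. (2) If $p \geq 3$, then $$\sqrt{N}(\hat{\beta}_N -\beta) \xrightarrow{D} (1-\alpha)\,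 N\left(0, -\frac{g''(m_* )}{p^2m_*^{2p-2}}\right) + \alpha\, \delta_\infty,$$ where $\delta_\infty$ denotes the point mass at $\infty$. (3) Moreover, with $Z\sim N(0,1)$: (a) if $p \geq 4$ is even, then $$N^{1-\frac{p}{2}} \hat{\beta}_N \xrightarrow{D} \alpha \left(\frac{1}{pZ^{p-2}}\right) + (1-\alpha)\delta_0;$$ (b) if $p \geq 3$ is odd, then $$N^{1-\frac{p}{2}} \hat{\beta}_N \xrightarrow{D} \frac{\alpha}{2} \left(\frac{1}{p |Z|^{p-2}}\right) +\frac{\alpha}{2}\delta_\infty + (1-\alpha)\delta_0.$$
   Context: $I(t)=\frac12\{(1+t)\log(1+t)+(1-t)\log(1-t)\}$ for $t\in[-1,1]$ ($0\log 0=0$). The Curie–Weiss threshold is $\beta_{\mathrm{CW}}^*(p)=\sup\{\beta\geq0:\sup_{t\in[0,1]}\{\beta t^p-I(t)\}=0\}$. The $p$-tensor Ising model with interaction tensor $\boldsymbol J_N$ and parameter $\beta\ge0$ is the distribution on $\{-1,1\}^N$ given by $\mathbb{P}_{\beta}(\boldsymbol x)=\frac{1}{2^NZ_N(\beta)}e^{\beta H_N(\boldsymbol x)}$, with $H_N(\boldsymbol x)=\sum_{1\leq i_1,\ldots,i_p\leq N}J_{i_1\ldots i_p}x_{i_1}\cdots x_{i_p}$ and $Z_N(\beta)=2^{-N}\sum_{\boldsymbol x}e^{\beta H_N(\boldsymbol x)}$. In the Curie–Weiss model (diagonal entries included) $H_N(\boldsymbol x)=N\bar x_N^{\,p}$ with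 $\bar x_N=\frac1N\sum_i x_i$. With $m_i(\boldsymbol x)=\sum_{1\leq i_2,\ldots,i_p\leq N}J_{ii_2\ldots i_p}x_{i_2}\cdots x_{i_p}$ (here $m_i(\boldsymbol x)=\bar x_N^{\,p-1}$), the MPL estimate is $\hat\beta_N(\boldsymbol X)=\inf\{b\geq0:H_N(\boldsymbol X)=\sum_{i=1}^Nm_i(\boldsymbol X)\tanh(p\,b\,m_i(\boldsymbol X))\}$, with $\inf\emptyset=+\infty$. Linear combinations such as $\alpha\,\mu+(1-\alpha)\,\nu$ on the right-hand sides denote mixtures of probability distributions (a random variable standing for its law, $\delta_a$ for the point mass at $a$). $\xrightarrow{D}$ denotes convergence in distribution under $\mathbb{P}_\beta$, on the extended real line $[-\infty,\infty]$. *)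

(* Defs.v *)
From HB Require Import structures.
From mathcomp Require Import all_boot all_order all_algebra.
From mathcomp Require Import all_classical all_reals all_analysis.
From mathcomp Require Import measurable_realfun.

Set Implicit Arguments.
Unset Strict Implicit.
Unset Printing Implicit Defensive.

Import Order.TTheory GRing.Theory Num.Theory.
Import numFieldNormedType.Exports.

Local Open Scope classical_set_scope.
Local Open Scope ring_scope.

Section tensor_ising.
Context (R : realType) (N : nat).
Implicit Types (J : seq 'I_N -> R) (p : nat) (beta : R) (x : N.-tuple bool).

(* A configuration in {-1,1}^N is coded by a tuple of booleans. *)
Definition spin x (i : 'I_N) : R := if tnth x i then 1 else -1.

(* The tensor entry J_{i_1 ... i_p} is [J [:: i_1; ...; i_p]]; only the values
   of [J] on sequences of length [p] are ever used. *)
Definition hamiltonian J p x : R :=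
  \sum_(s : p.-tuple 'I_N) J s * \prod_(j <- s) spin x j.

Definition local_field J p x (i : 'I_N) : R :=
  \sum_(s : p.-1.-tuple 'I_N) J (i :: s) * \prod_(j <- s) spin x j.

Definition partition_function J p beta : R :=
  (2 ^+ N)^-1 * \sum_(x : N.-tuple bool) expR (beta * hamiltonian J p x).

Definition ising_pmf J p beta x : R :=
  expR (beta * hamiltonian J p x) / (2 ^+ N * partition_function J p beta).

Definition ising_prob J p beta (A : set (N.-tuple bool)) : \bar R :=
  (\sum_(x : N.-tuple bool) (ising_pmf J p beta x)%:E * \d_x A)%E.

Lemma sum_expR_gt0 J p beta :
  0 < \sum_(x : N.-tuple bool) expR (beta * hamiltonian J p x).
Proof.
rewrite (bigD1 [tuple false | i < N])//= ltr_wpDr ?expR_gt0//.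
by apply: sumr_ge0 => x _; exact: expR_ge0.
Qed.

Lemma ising_pmfE J p beta x : ising_pmf J p beta x =
  expR (beta * hamiltonian J p x) /
    \sum_(y : N.-tuple bool) expR (beta * hamiltonian J p y).
Proof.
by rewrite /ising_pmf /partition_function mulrA divff ?mul1r// expf_neq0.
Qed.

Lemma ising_pmf_ge0 J p beta x : 0 <= ising_pmf J p beta x.
Proof. by rewrite ising_pmfE divr_ge0 ?expR_ge0// ltW ?sum_expR_gt0. Qed.

Lemma ising_pmf_sum1 J p beta :
  \sum_(x : N.-tuple bool) ising_pmf J p beta x = 1.
Proof.
under eq_bigr do rewrite ising_pmfE.
by rewrite -mulr_suml divff// gt_eqF ?sum_expR_gt0.
Qed.

Section ising_probability.
Variables (J : seq 'I_N -> R) (p : nat) (beta : R).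
Local Open Scope ereal_scope.

Let P := ising_prob J p beta.

Let P0 : P set0 = 0.
Proof. by rewrite /P /ising_prob big1// => x _; rewrite measure0 mule0. Qed.

Let P_ge0 A : 0 <= P A.
Proof.
by apply: sume_ge0 => x _; rewrite mule_ge0// lee_fin ising_pmf_ge0.
Qed.

Let P_sigma_additive : semi_sigma_additive P.
Proof.
pose m (k : nat) : {measure set (N.-tuple bool) -> \bar R} :=
  let x := nth [tuple false | i < N] (enum {: N.-tuple bool}) k in
  mscale (NngNum (ising_pmf_ge0 J p beta x)) \d_x.
have -> : P = msum m #|{: N.-tuple bool}|.
  apply/funext => A; rewrite /P /ising_prob /msum -big_enum/=.
  rewrite (big_nth [tuple false | i < N]) -cardE big_mkord.
  by apply: eq_bigr.
exact: measure_semi_sigma_additive.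
Qed.

HB.instance Definition _ := isMeasure.Build _ _ _ (ising_prob J p beta)
  P0 P_ge0 P_sigma_additive.

Let P_setT : P setT = 1.
Proof.
rewrite /P /ising_prob -(ising_pmf_sum1 J p beta) -sumEFin.
by apply: eq_bigr => x _; rewrite diracT mule1.
Qed.

HB.instance Definition _ :=
  Measure_isProbability.Build _ _ _ (ising_prob J p beta) P_setT.

End ising_probability.

Definition tanh (u : R) : R := (expR u - expR (- u)) / (expR u + expR (- u)).

(* [ereal_inf] of the empty set is [+oo]. *)
Definition mpl_estimate J p x : \bar R :=
  ereal_inf (EFin @` [set b : R | 0 <= b /\ hamiltonian J p x =
    \sum_(i < N) local_field J p x i * tanh (p%:R * b * local_field J p x i)]).

End tensor_ising.

Section curie_weiss.
Context (R : realType).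
Implicit Types (p N : nat) (beta t m : R).

Definition curie_weiss_tensor N p : seq 'I_N -> R := fun=> (N%:R ^+ p.-1)^-1.

Definition curie_weiss_prob N p beta : probability (N.-tuple bool) R :=
  ising_prob (@curie_weiss_tensor N p) p beta.

Definition curie_weiss_mpl N p : N.-tuple bool -> \bar R :=
  mpl_estimate (@curie_weiss_tensor N p) p.

(* 0 log 0 = 0 holds since [0 * _ = 0]; used only on [-1, 1]. *)
Definition entropyI t : R :=
  2^-1 * ((1 + t) * ln (1 + t) + (1 - t) * ln (1 - t)).

Definition cw_free_energy beta p t : R := beta * t ^+ p - entropyI t.

Definition cw_threshold p : R :=
  sup [set b : R | 0 <= b /\ sup (cw_free_energy b p @` `[0, 1]) = 0].

Definition is_global_maximizer beta p m : Prop :=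
  -1 <= m <= 1 /\
  forall t, -1 <= t <= 1 -> cw_free_energy beta p t <= cw_free_energy beta p m.

Definition cw_alpha beta p m : R :=
  let c := (m ^+ 2 - 1) * derive1n 2 (cw_free_energy beta p) m in
  if odd p then 1 / (1 + c `^ (- 2^-1)) else 1 / (1 + 2 * c `^ (- 2^-1)).

Lemma cw_alpha_ge0 beta p m : 0 <= cw_alpha beta p m.
Proof.
by rewrite /cw_alpha; case: ifP => _; rewrite divr_ge0// addr_ge0// ?mulr_ge0//;
  exact: powR_ge0.
Qed.

Lemma cw_alpha_le1 beta p m : cw_alpha beta p m <= 1.
Proof.
rewrite /cw_alpha; case: ifP => _; rewrite ler_pdivrMr ?mul1r ?lerDl;
  by rewrite ?ltr_pwDl// ?mulr_ge0// powR_ge0.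
Qed.

Definition cw_alpha01 beta p m : {i01 R} :=
  Itv01 (cw_alpha_ge0 beta p m) (cw_alpha_le1 beta p m).

Definition quartic_density (s : R) : R := expR (- (s ^+ 4 / 12)).

Definition quartic_cdf t : R :=
  (\int[lebesgue_measure]_(s in `]-oo, t]) quartic_density s) /
  (\int[lebesgue_measure]_s quartic_density s).

End curie_weiss.

(* Weak convergence on the two-point compactification [\bar R], a compact
   space, so that continuous test functions are automatically bounded. *)
Definition cvg_in_distribution (R : realType) (d : measure_display)
    (T : nat -> measurableType d) (P : forall N, probability (T N) R)
    (X : forall N, T N -> \bar R) (mu : {measure set (\bar R) -> \bar R}) :=
  forall f : \bar R -> R, continuous f ->
    (\int[P N]_x (f (X N x))%:E)%E @[N --> \oo] --> (\int[mu]_y (f y)%:E)%E.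

Section limit_laws.
Context (R : realType).
Local Notation mR := (measurableTypeR R).

Definition to_ereal (z : mR) : \bar R := z%:E.

HB.instance Definition _ := isMeasurableFun.Build _ _ mR (\bar R)
  to_ereal (@EFin_measurable R setT).

(* [normal_prob] takes the standard deviation as its second parameter. *)
Definition normal_bar (mean var : R) : probability (\bar R) R :=
  distribution (normal_prob mean (Num.sqrt var)) to_ereal.

Definition inv_pow (p : nat) (z : mR) : \bar R :=
  (1 / (p%:R * z ^+ (p - 2)))%:E.
Definition inv_abs_pow (p : nat) (z : mR) : \bar R :=
  (1 / (p%:R * `|z| ^+ (p - 2)))%:E.

Lemma measurable_invr : measurable_fun [set: R] (@GRing.inv R).
Proof.
have mD : measurable (~` [set (0 : R)]) by exact: measurableC.
have -> : [set: R] = [set 0] `|` ~` [set 0] by rewrite setUv.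
apply/measurable_funU => //; split; first exact: measurable_fun_set1.
apply: open_continuous_measurable_fun.
  by rewrite openC; exact: closed_eq.
by move=> z; rewrite inE /= => /eqP z0; exact: inv_continuous.
Qed.

Lemma measurable_inv_pow p : measurable_fun setT (inv_pow p).
Proof.
apply/measurable_EFinP; apply: measurable_funM => //.
apply: (measurableT_comp measurable_invr).
by apply: measurable_funM => //; exact: measurable_funX.
Qed.

Lemma measurable_inv_abs_pow p : measurable_fun setT (inv_abs_pow p).
Proof.
apply/measurable_EFinP; apply: measurable_funM => //.
apply: (measurableT_comp measurable_invr).
apply: measurable_funM => //; apply: measurable_funX.
exact: normr_measurable.
Qed.

HB.instance Definition _ p := isMeasurableFun.Build _ _ mR (\bar R)
  (inv_pow p) (measurable_inv_pow p).
HB.instance Definition _ p := isMeasurableFun.Build _ _ mR (\bar R)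
  (inv_abs_pow p) (measurable_inv_abs_pow p).

(* The laws of 1 / (p Z^(p-2)) and 1 / (p |Z|^(p-2)) for Z standard normal. At
   the null event Z = 0 the totalized real inverse returns an irrelevant
   value. *)
Definition inv_pow_normal p : probability (\bar R) R :=
  distribution (normal_prob 0 1) (inv_pow p).

Definition inv_abs_pow_normal p : probability (\bar R) R :=
  distribution (normal_prob 0 1) (inv_abs_pow p).

End limit_laws.

(* Main.v *)
From HB Require Import structures.
Require Import Defs.
From mathcomp Require Import all_boot all_order all_algebra.
From mathcomp Require Import all_classical all_reals all_analysis.
From mathcomp Require Import measurable_realfun.
From mathcomp Require Import ring lra.
Import Order.TTheory GRing.Theory Num.Theory.
Import numFieldNormedType.Exports.
Local Open Scope classical_set_scope.
Local Open Scope ring_scope.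
Set Implicit Arguments.
Unset Strict Implicit.
Unset Printing Implicit Defensive.

(** Gibbs probabilities concentrate where the free energy
[g t = beta * t ^+ p - I t] of the magnetization [t] is maximal; at the
threshold every global maximizer has the value 0. The estimate is an explicit
function of the magnetization, so every limit law is that of this function
around each maximizer, the laws being mixed with the limiting probabilities of
the maximizers.

The magnetization is a sufficient statistic ([sum_curie_weiss_pmf]) and the
estimate at magnetization [t] is [artanh t / (p * t ^+ p.-1)] when this is
meaningful and nonnegative ([mple_of_mean], [curie_weiss_mplE]). What has to be
computed is thus the limit of quotients of sums over the N + 1 levels of the
magnetization, each level carrying a binomial weight times an exponential.

Around a maximizer [c] where the free energy vanishes to order [q] with leading
coefficient [- kappa], the levels at distance [z * h] of [c], with
[N * h ^+ q = 1], have weights proportional to [expR (- (kappa * z ^+ q))], by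
the formula of Stirling. Seen as the integral of a step function in [z], the sum
over these levels converges by dominated convergence ([laplace_window]). Other
levels are exponentially negligible ([laplace_sum_tail]).

For pairs, [beta] is 1/2 and 0 is the only maximizer, with [q = 4] and
[kappa = 1/12] since [artanh y - y] is of order [y ^+ 3 / 3]. As
[artanh x / (2 * x)] is [1/2 + x ^+ 2 / 6] to second order, the rescaled error
of the estimate converges to [z ^+ 2 / 6], where [z] has the quartic density
([cvg_mple_fluctuation_quartic]).

For [p] at least 3 the maximizers are 0, a point [m] in (0, 1), and [- m] if [p]
is even. The point [m] is the minimizer of [I t / t ^+ p], that is, the point at
which [t * artanh t / I t] takes the value [p]. Its uniqueness and [g'' m < 0]
follow from the strict monotonicity of that function, proved by the monotone
rule of l'Hopital
([id_artanh_div_entropyI_increasing], [exists_critical_ratio],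
[entropyI_gt_critical], [critical_curvature_lt0]). All maximizers are quadratic,
so their masses are of the same order and the constant of Stirling cancels from
the quotient; the window at 0 receives the mass [cw_alpha]
([two_well_expectation]). Around [m] the estimate is differentiable with nonzero
slope, and the delta method gives the normal component
([cvg_mple_scaled]). Around 0 the magnetization is [z / sqrt N] with [z] standard
normal and the estimate is close to [N ^ (p / 2 - 1) / (p * z ^+ (p - 2))],
which diverges; divided by its order, it gives the inverse powers of a normal
variable ([cvg_mple_pow_even]). For odd [p] and negative [z] no nonnegative
parameter solves the estimating equation, and half of the mass at 0 is sent to
infinity ([cvg_mple_pow_odd]). *)

(** * Spin configurations and magnetization levels *)

Section configurations.
Context (R : realType).
Implicit Types (N p j : nat) (t : R).

(** Expanding the power of a sum. Because the diagonal entries of the tensor are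
present, this turns the local fields and the Hamiltonian into exact powers of
the magnetization. *)
Lemma sum_prod_tuple N n (a : 'I_N -> R) :
  \sum_(s : n.-tuple 'I_N) \prod_(j <- s) a j = (\sum_i a i) ^+ n.
Proof.
transitivity (\prod_(i < n) \sum_j a j); last by rewrite prodr_const card_ord.
rewrite (bigA_distr_bigA (fun _ => a)).
rewrite (reindex (fun t : n.-tuple 'I_N => [ffun i => tnth t i])) /=.
  by apply: eq_bigr => t _; rewrite big_tuple; apply: eq_bigr => i _; rewrite ffunE.
exists (fun f : {ffun 'I_n -> 'I_N} => [tuple f i | i < n]) => [t _|f _].
  by apply: eq_from_tnth => i; rewrite tnth_mktuple ffunE.
by apply/ffunP => i; rewrite ffunE tnth_mktuple.
Qed.

Definition magnetization N (x : N.-tuple bool) : R :=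
  (\sum_(i < N) spin R x i) / N%:R.

Lemma curie_weiss_local_field N p (x : N.-tuple bool) i :
  local_field (@curie_weiss_tensor R N p) p x i = magnetization x ^+ p.-1.
Proof.
rewrite /local_field /curie_weiss_tensor -mulr_sumr sum_prod_tuple.
by rewrite /magnetization expr_div_n mulrC.
Qed.

Lemma curie_weiss_hamiltonian N p (x : N.-tuple bool) : (0 < p)%N -> (0 < N)%N ->
  hamiltonian (@curie_weiss_tensor R N p) p x = N%:R * magnetization x ^+ p.
Proof.
case: p => // p _ N0; rewrite /hamiltonian /curie_weiss_tensor -mulr_sumr.
have N0' : N%:R != 0 :> R by rewrite pnatr_eq0 -lt0n.
rewrite sum_prod_tuple /magnetization expr_div_n /= mulrCA mulrC.
by rewrite [N%:R ^+ p.+1]exprS invfM mulVKf.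
Qed.

(** The magnetization of a configuration with [j] spins equal to 1. *)
Definition level_mean N j : R := 2 * j%:R / N%:R - 1.

Definition plus_spins N (x : N.-tuple bool) : {set 'I_N} := [set i | tnth x i]%SET.

Lemma magnetizationE N (x : N.-tuple bool) : (0 < N)%N ->
  magnetization x = level_mean N #|plus_spins x|.
Proof.
move=> N0; have N0' : N%:R != 0 :> R by rewrite pnatr_eq0 -lt0n.
rewrite /magnetization /level_mean.
have -> : \sum_(i < N) spin R x i = 2 * #|plus_spins x|%:R - N%:R.
  transitivity (\sum_(i < N) (2 * (tnth x i)%:R - 1 : R)).
    by apply: eq_bigr => i _; rewrite /spin; case: ifP => _ /=; ring.
  rewrite sumrB -mulr_sumr sumr_const card_ord; congr (2 * _ - _).
  rewrite -natr_sum -sum1_card [in RHS]big_mkcond/=; congr (_%:R).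
  by apply: eq_bigr => i _; rewrite inE; case: (tnth x i).
by rewrite mulrBl divff.
Qed.

(** A configuration is the set of its plus spins, and there are binomially many
sets of each size. *)
Lemma sum_over_levels N (G : nat -> R) :
  \sum_(x : N.-tuple bool) G #|plus_spins x| = \sum_(j < N.+1) 'C(N, j)%:R * G j.
Proof.
transitivity (\sum_(A : {set 'I_N}) G #|A|).
  rewrite [in RHS](reindex (@plus_spins N)) /=; first by [].
  exists (fun A : {set 'I_N} => [tuple i \in A | i < N]) => [x _|A _].
    by apply: eq_from_tnth => i; rewrite tnth_mktuple inE.
  by apply/setP => i; rewrite inE tnth_mktuple.
rewrite (partition_big (fun A : {set 'I_N} => inord #|A| : 'I_N.+1) predT)//=.
apply: eq_bigr => j _.
have jE (A : {set 'I_N}) : (inord #|A| == j :> 'I_N.+1) = (#|A| == j).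
  by rewrite -val_eqE/= inordK// ltnS -[X in (_ <= X)%N]card_ord max_card.
under eq_bigl do rewrite jE.
rewrite (eq_bigr (fun=> G j)) => [|A /eqP -> //].
rewrite sumr_const -[LHS]mulr_natl.
have := card_draws 'I_N j; rewrite card_ord => <-; congr (_%:R * _).
by apply: eq_card => A; rewrite !inE.
Qed.

Lemma measurable_tuple_bool N (A : set (N.-tuple bool)) : measurable A.
Proof.
have m1 x : measurable [set x : N.-tuple bool].
  rewrite (_ : [set x] = \bigcap_(i in [set: 'I_N])
      ((fun y : N.-tuple bool => tnth y i) @^-1` [set tnth x i])).
    apply: fin_bigcap_measurable => // i _.
    by rewrite -[X in measurable X]setTI; exact: measurable_tnth.
  apply/seteqP; split=> [y -> //|y xy].
  by apply: eq_from_tnth => i; exact: xy.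
rewrite (_ : A = \bigcup_(x in A) [set x]); last by rewrite (bigcup_imset1 A id) image_id.
by apply: fin_bigcup_measurable => //; exact: finite_finset.
Qed.

Lemma measurable_fun_tuple_bool N d (T : measurableType d) (f : N.-tuple bool -> T) :
  measurable_fun setT f.
Proof. by move=> _ Y _; exact: measurable_tuple_bool. Qed.

(** The Gibbs measure is a finite sum of scaled Dirac masses, so that its
integrals are finite sums; positive and negative parts are treated separately. *)
Lemma integral_ising_prob N J p (beta : R) (g : N.-tuple bool -> R) :
  (\int[ising_prob J p beta]_x (g x)%:E)%E =
  (\sum_(x : N.-tuple bool) ising_pmf J p beta x * g x)%:E.
Proof.
pose e k := nth [tuple false | i < N] (enum {: N.-tuple bool}) k.
pose m (k : nat) : {measure set (N.-tuple bool) -> \bar R} :=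
  mscale (NngNum (ising_pmf_ge0 J p beta (e k))) \d_(e k).
have PE (A : set (N.-tuple bool)) : measurable A -> A `<=` setT ->
    ising_prob J p beta A = msum m #|{: N.-tuple bool}| A.
  move=> _ _; rewrite /ising_prob /msum -big_enum/=.
  by rewrite (big_nth [tuple false | i < N]) -cardE big_mkord; apply: eq_bigr.
have ge0 (f : N.-tuple bool -> \bar R) : (forall x, 0 <= f x)%E ->
    (\int[ising_prob J p beta]_x f x =
     \sum_(x : N.-tuple bool) (ising_pmf J p beta x)%:E * f x)%E.
  move=> f0; have mf : measurable_fun setT f := measurable_fun_tuple_bool f.
  rewrite (eq_measure_integral (msum m #|{: N.-tuple bool}|))//.
  rewrite ge0_integral_measure_sum// -[in RHS]big_enum/=.
  rewrite [in RHS](big_nth [tuple false | i < N]) -cardE big_mkord.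
  apply: eq_bigr => k _; rewrite ge0_integral_mscale//= integral_dirac//.
  by rewrite diracT mul1e.
rewrite integralE !ge0 ?funeposE//.
rewrite -sumeN; last first.
  by move=> x y _ _; rewrite fin_num_adde_defl// funenegE -EFinN -EFin_max.
rewrite -big_split/= -sumEFin; apply: eq_bigr => x _.
rewrite funeposE funenegE -!EFin_max -!EFinM -EFinN -EFinD; congr (_%:E).
by rewrite -mulrBr; congr (_ * _); rewrite /Num.max; do 2 case: ifPn; lra.
Qed.

(** Up to normalization, the probability that [j] spins are equal to 1; the
factor [2 ^+ N] keeps the weights of exponential size given by the free energy
alone. *)
Definition level_weight (Phi : R -> R) N j : R :=
  'C(N, j)%:R / 2 ^+ N * expR (N%:R * Phi (level_mean N j)).

(** The magnetization is a sufficient statistic: the Gibbs weight depends only on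
the number of plus spins. *)
Lemma sum_curie_weiss_pmf N p (beta : R) (f : R -> R) : (0 < p)%N -> (0 < N)%N ->
  \sum_(x : N.-tuple bool) ising_pmf (@curie_weiss_tensor R N p) p beta x *
     f (magnetization x) =
  (\sum_(j < N.+1) level_weight (fun t => beta * t ^+ p) N j * f (level_mean N j)) /
  (\sum_(j < N.+1) level_weight (fun t => beta * t ^+ p) N j).
Proof.
move=> p0 N0.
pose W j := expR (N%:R * (beta * level_mean N j ^+ p)).
have HW (x : N.-tuple bool) :
    expR (beta * hamiltonian (@curie_weiss_tensor R N p) p x) = W #|plus_spins x|.
  by rewrite curie_weiss_hamiltonian// magnetizationE// /W mulrCA.
have sumE (F : R -> R) : \sum_(j < N.+1) level_weight (fun t => beta * t ^+ p) N j *
    F (level_mean N j) =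
  (2 ^+ N)^-1 * \sum_(x : N.-tuple bool) W #|plus_spins x| * F (magnetization x).
  under [in RHS]eq_bigr do rewrite magnetizationE//.
  rewrite (sum_over_levels _ (fun j => W j * F (level_mean N j))) mulr_sumr.
  by apply: eq_bigr => j _; rewrite /level_weight -/(W j); ring.
under [X in _ = _ / X]eq_bigr do rewrite -[level_weight _ _ _]mulr1.
rewrite sumE (sumE (fun=> 1)).
rewrite -mulf_div divff ?mul1r; last by rewrite invr_eq0 expf_neq0.
rewrite mulr_suml; apply: eq_bigr => x _.
rewrite ising_pmfE HW mulrAC; congr (_ / _).
by apply: eq_bigr => y _; rewrite HW mulr1.
Qed.

End configurations.

(** * The inverse hyperbolic tangent and the entropy *)

Section artanh_and_entropy.
Context (R : realType).
Implicit Types (t u x : R) (f df : R -> R).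

Lemma MVT_is_derive f df a b : a < b ->
  (forall x, a <= x <= b -> is_derive x 1 f (df x)) ->
  exists2 c, a < c < b & f b - f a = df c * (b - a).
Proof.
move=> ab fdf.
have dfo x : x \in `]a, b[ -> is_derive x 1 f (df x).
  by rewrite in_itv/= => /andP[ax xb]; apply: fdf; rewrite !ltW.
have cf : {within `[a, b], continuous f}.
  by apply: derivable_within_continuous => x; rewrite in_itv/= => /fdf [].
have [c] := MVT ab dfo cf.
by rewrite in_itv/=; exists c.
Qed.

Definition artanh t : R := 2^-1 * (ln (1 + t) - ln (1 - t)).

Lemma artanh0 : artanh 0 = 0. Proof. by rewrite /artanh subr0 addr0 subrr mulr0. Qed.

Lemma artanhN t : artanh (- t) = - artanh t.
Proof. by rewrite /artanh opprK; ring. Qed.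

Lemma is_derive_ln1D t : -1 < t -> is_derive t 1 (fun x => ln (1 + x)) (1 + t)^-1.
Proof.
move=> t1; have t1' : 0 < 1 + t by lra.
have d : is_derive t 1 (fun x => 1 + x) 1.
  by have := is_deriveD (is_derive_cst (1 : R) t 1) (is_derive_id t 1); rewrite add0r.
by have := @is_derive1_comp _ (@ln R) (fun x => 1 + x) t _ _ (is_derive1_ln t1') d; rewrite mulr1.
Qed.

Lemma is_derive_ln1B t : t < 1 -> is_derive t 1 (fun x => ln (1 - x)) (- (1 - t)^-1).
Proof.
move=> t1; have t1' : 0 < 1 - t by lra.
have d : is_derive t 1 (fun x => 1 - x) (- 1).
  by have := is_deriveB (is_derive_cst (1 : R) t 1) (is_derive_id t 1); rewrite sub0r.
by have := @is_derive1_comp _ (@ln R) (fun x => 1 - x) t _ _ (is_derive1_ln t1') d; rewrite mulrN1.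
Qed.

Lemma is_derive_artanh t : -1 < t < 1 -> is_derive t 1 artanh (1 - t ^+ 2)^-1.
Proof.
move=> /andP[t0 t1].
have d := is_deriveZ 2^-1 (is_deriveB (is_derive_ln1D t0) (is_derive_ln1B t1)).
apply: (is_derive_eq d); rewrite opprK /GRing.scale/=.
have ? : 1 - t != 0 by rewrite gt_eqF// subr_gt0.
have ? : 1 + t != 0 by rewrite gt_eqF//; lra.
have -> : 1 - t ^+ 2 = (1 - t) * (1 + t) by ring.
by field; apply/andP.
Qed.

Lemma is_derive_entropyI t : -1 < t < 1 -> is_derive t 1 (@entropyI R) (artanh t).
Proof.
move=> /andP[t0 t1].
have d1 := is_deriveD (is_derive_cst (1 : R) t 1) (is_derive_id t 1).
have d2 := is_deriveB (is_derive_cst (1 : R) t 1) (is_derive_id t 1).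
have d := is_deriveZ 2^-1 (is_deriveD (is_deriveM d1 (is_derive_ln1D t0))
  (is_deriveM d2 (is_derive_ln1B t1))).
apply: (is_derive_eq d); rewrite /artanh /GRing.scale/= /cst !fctE.
have ? : 1 - t != 0 by rewrite gt_eqF// subr_gt0.
have ? : 1 + t != 0 by rewrite gt_eqF//; lra.
by field; apply/andP.
Qed.

Lemma entropyIN t : entropyI (- t) = entropyI t.
Proof. by rewrite /entropyI opprK; congr (_ * _); rewrite addrC. Qed.

Lemma entropyI0 : entropyI (0 : R) = 0.
Proof. by rewrite /entropyI subr0 addr0 ln1; ring. Qed.

(** By the mean value theorem the slope of [artanh] between 0 and [t] lies
strictly between 1 and its value at [t]; the upper bound is [t / (1 - t ^+ 2)]
in a form that exhibits the cubic correction. *)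
Lemma artanh_bounds t : 0 < t < 1 ->
  t < artanh t < t + t ^+ 3 / (1 - t ^+ 2).
Proof.
move=> /andP[t0 t1].
have [x /andP[x0 xt]|c /andP[c0 ct]] := @MVT_is_derive artanh (fun x => (1 - x ^+ 2)^-1) _ _ t0.
  by apply: is_derive_artanh; lra.
rewrite artanh0 !subr0 => ->.
have c2 : 0 < c ^+ 2 < t ^+ 2 by nra.
have t2 : t ^+ 2 < 1 by nra.
rewrite -[X in X < _ < _]mul1r ltr_pM2r// invf_gt1; last lra.
apply/andP; split; first lra.
have -> : t + t ^+ 3 / (1 - t ^+ 2) = (1 - t ^+ 2)^-1 * t by field; lra.
by rewrite ltr_pM2r// ltf_pV2 ?posrE; lra.
Qed.

Lemma artanh_gt0 t : 0 < t < 1 -> 0 < artanh t.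
Proof. by move=> t01; have := artanh_bounds t01; lra. Qed.

Lemma entropyI_gt0 t : 0 < t < 1 -> 0 < entropyI t.
Proof.
move=> /andP[t0 t1].
have [x /andP[x0 xt]|c /andP[c0 ct]] := @MVT_is_derive (@entropyI R) artanh _ _ t0.
  by apply: is_derive_entropyI; lra.
rewrite entropyI0 !subr0 => ->; rewrite mulr_gt0// artanh_gt0//; lra.
Qed.

Lemma tanh_artanh t : -1 < t < 1 -> tanh (artanh t) = t.
Proof.
move=> /andP[t0 t1]; rewrite /tanh.
set a := artanh t.
have a2 : expR a * expR a = (1 + t) / (1 - t).
  rewrite -expRD; have -> : a + a = ln ((1 + t) / (1 - t)).
    by rewrite ln_div ?posrE; [rewrite /a /artanh; field|lra|lra].
  by rewrite lnK// posrE divr_gt0; lra.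
have ap := expR_gt0 a; rewrite expRN.
have e0 : expR a != 0 by rewrite gt_eqF.
have -> : (expR a - (expR a)^-1) / (expR a + (expR a)^-1) =
  (expR a * expR a - 1) / (expR a * expR a + 1).
  by field; rewrite e0 gt_eqF// ltr_wpDl// ?ltr01// sqr_ge0.
by rewrite a2; field; apply/andP; split; lra.
Qed.

Lemma tanh_lt1 u : -1 < tanh u < 1.
Proof.
rewrite /tanh; have := expR_gt0 u; have := expR_gt0 (- u) => *.
by rewrite ltr_pdivrMr ?ltr_pdivlMr; lra.
Qed.

Lemma artanh_tanh u : artanh (tanh u) = u.
Proof.
have [ep em] := (expR_gt0 u, expR_gt0 (- u)).
rewrite /artanh /tanh; set a := expR u in ep *; set b := expR (- u) in em *.
have ab : a + b != 0 by rewrite gt_eqF// addr_gt0.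
have -> : 1 + (a - b) / (a + b) = a * (2 / (a + b)) by field.
have -> : 1 - (a - b) / (a + b) = b * (2 / (a + b)) by field.
have c0 : 0 < 2 / (a + b) by rewrite divr_gt0// addr_gt0.
move: (2 / (a + b)) c0 => k k0.
by rewrite !lnM ?posrE// /a /b !expRK; field.
Qed.

(** At 0 this is the convention 0 log 0 = 0; the estimate writes [ln y] as twice
the logarithm of the square root, which is at most the inverse square root in
absolute value. *)
Lemma continuous_mul_ln : continuous (fun x : R => x * ln x).
Proof.
move=> x; have [x0|x0|->] := ltgtP x 0.
- apply/cvgrPdist_le => e e0; near=> y.
  have y0 : y < 0 by near: y; exact: lt_nbhsl.
  rewrite (ln0 (ltW x0)) (ln0 (ltW y0)) !mulr0 subrr normr0.
  exact: ltW.
- by apply: cvgM; [exact: cvg_id|exact: continuous_ln].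
- rewrite /continuous_at mul0r; apply/cvgr0Pnorm_le => e e0.
  near=> y.
  have y1 : `|y| < Num.min 1 ((e / 2) ^+ 2).
    by near: y; apply: (@pseudometric_normed_Zmodule.nbhs0_lt R R);
      rewrite lt_min ltr01 exprn_gt0// divr_gt0.
  have [y0|y0] := leP y 0; first by rewrite ln0// mulr0 normr0 ltW.
  move: y1; rewrite gtr0_norm// lt_min => /andP[y1 ye].
  have s0 : 0 < Num.sqrt y by rewrite sqrtr_gt0.
  have ys : Num.sqrt y * Num.sqrt y = y by rewrite -expr2 sqr_sqrtr// ltW.
  have se : Num.sqrt y < e / 2.
    by rewrite -(@ltr_pXn2r _ 2) ?nnegrE ?sqr_sqrtr ?ltW// divr_gt0.
  have l2 : - ln (Num.sqrt y) < (Num.sqrt y)^-1.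
    by rewrite -lnV ?posrE//; apply: ln_sublinear; rewrite invr_gt0.
  have iv : y * (Num.sqrt y)^-1 = Num.sqrt y by rewrite -[X in X * _^-1]ys mulfK// gt_eqF.
  have lny : ln y < 0 by apply: ln_lt0; rewrite y0.
  have lns : ln y = 2 * ln (Num.sqrt y).
    by rewrite -[in LHS]ys lnM ?posrE//; ring.
  rewrite normrM gtr0_norm// ltr0_norm//.
  have : y * - ln (Num.sqrt y) <= Num.sqrt y by rewrite -[leRHS]iv ler_pM2l// ltW.
  rewrite lns; lra.
Unshelve. all: by end_near. Qed.

Lemma continuous_entropyI : continuous (@entropyI R).
Proof.
have c1 t : (fun x : R => (1 + x) * ln (1 + x)) x @[x --> t] --> (1 + t) * ln (1 + t).
  apply: (@cvg_comp _ _ _ (fun x : R => 1 + x) (fun x => x * ln x)).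
    by apply: cvgD; [exact: cvg_cst|exact: cvg_id].
  exact: continuous_mul_ln.
have c2 t : (fun x : R => (1 - x) * ln (1 - x)) x @[x --> t] --> (1 - t) * ln (1 - t).
  apply: (@cvg_comp _ _ _ (fun x : R => 1 - x) (fun x => x * ln x)).
    by apply: cvgB; [exact: cvg_cst|exact: cvg_id].
  exact: continuous_mul_ln.
by move=> t; apply: cvgM; [exact: cvg_cst|apply: cvgD; [exact: c1|exact: c2]].
Qed.

End artanh_and_entropy.

(** * Stirling asymptotics up to the value of the constant *)

Section stirling.
Context (R : realType).
Implicit Types n : nat.

(** The logarithm of n! divided by n^(n + 1/2) exp(-n). *)
Definition ln_stirling n : R := ln n`!%:R - (n%:R + 2^-1) * ln n%:R + n%:R.

(** With t = 1 / (2 n + 1) the increment is artanh t / t - 1, so [artanh_bounds]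
gives a nonnegative increment below a telescoping term. *)
Lemma ln_stirling_step n : (0 < n)%N ->
  0 <= ln_stirling n - ln_stirling n.+1 <= (4 * n%:R)^-1 - (4 * n.+1%:R)^-1.
Proof.
move=> n0; set x : R := n%:R; have x0 : 0 < x by rewrite /x ltr0n.
have xS : n.+1%:R = x + 1 :> R by rewrite -natr1.
pose t : R := (2 * x + 1)^-1.
have t01 : 0 < t < 1.
  by rewrite invr_gt0 invf_lt1; lra.
have tE : t * (2 * x + 1) = 1 by rewrite mulVf// gt_eqF//; lra.
have x10 : x + 1 != 0 by rewrite gt_eqF//; lra.
have x00 : x != 0 by rewrite gt_eqF.
have x20 : 2 * x + 1 != 0 by rewrite gt_eqF//; lra.
have aE : artanh t = 2^-1 * (ln (x + 1) - ln x).
  have e1 : 1 + t = (x + 1) * (2 / (2 * x + 1)) by rewrite /t; field.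
  have e2 : 1 - t = x * (2 / (2 * x + 1)) by rewrite /t; field.
  have k0 : 0 < 2 / (2 * x + 1) by rewrite divr_gt0//; lra.
  rewrite /artanh e1 e2; move: (2 / (2 * x + 1)) k0 => k k0.
  by rewrite !lnM ?posrE//; [ring|lra].
have dE : ln_stirling n - ln_stirling n.+1 = (2 * x + 1) * artanh t - 1.
  rewrite /ln_stirling factS natrM lnM ?posrE ?ltr0n// ?fact_gt0// xS -/x aE.
  by field.
rewrite dE xS.
have /andP[b1 b2] := artanh_bounds t01.
have y0 : 0 < 2 * x + 1 by lra.
apply/andP; split.
  have : (2 * x + 1) * t <= (2 * x + 1) * artanh t by rewrite ler_pM2l// ltW.
  by rewrite [_ * t]mulrC tE; lra.
have : (2 * x + 1) * artanh t <= (2 * x + 1) * (t + t ^+ 3 / (1 - t ^+ 2)).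
  by rewrite ler_pM2l// ltW.
have -> : (2 * x + 1) * (t + t ^+ 3 / (1 - t ^+ 2)) =
    1 + ((4 * x)^-1 - (4 * (x + 1))^-1).
  rewrite /t; field; rewrite x00 x10 x20/=.
  have -> : (2 * x + 1) ^+ 2 - 1 = 4 * (x * (x + 1)) by ring.
  by rewrite !mulf_neq0// pnatr_eq0.
by lra.
Qed.

Lemma ln_stirling1 : ln_stirling 1 = 1.
Proof. by rewrite /ln_stirling ln1; ring. Qed.

Lemma ln_stirling_bounds n : (0 < n)%N -> 3 / 4 <= ln_stirling n <= 1.
Proof.
case: n => // n _.
suff: ln_stirling n.+1 <= 1 /\ 3 / 4 + (4 * n.+1%:R)^-1 <= ln_stirling n.+1.
  move=> [-> h]; rewrite andbT (le_trans _ h)// lerDl invr_ge0 mulr_ge0//.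
elim: n => [|n [ih1 ih2]]; first by rewrite ln_stirling1 mulr1; split; lra.
have /andP[s1 s2] := @ln_stirling_step n.+1 isT.
move: ih1 ih2 s1 s2; set a := (4 * n.+1%:R)^-1; set b := (4 * n.+2%:R)^-1.
by move: (ln_stirling n.+1) (ln_stirling n.+2) a b => u v a b *; split; lra.
Qed.

(** Its value, the square root of 2 pi, is immaterial here: Gibbs expectations are
quotients in which it cancels. *)
Definition stirling_constant : R := expR (lim (ln_stirling n.+1 @[n --> \oo])).

Lemma cvg_ln_stirling :
  ln_stirling n @[n --> \oo] --> ln stirling_constant.
Proof.
rewrite /stirling_constant expRK -(cvg_shiftS ln_stirling).
apply: nonincreasing_is_cvgn.
  apply/nonincreasing_seqP => n.
  by have /andP[+ _] := @ln_stirling_step n.+1 isT; rewrite subr_ge0.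
exists (3 / 4) => _ [n _ <-].
by have /andP[] := @ln_stirling_bounds n.+1 isT.
Qed.

Lemma stirling_constant_gt0 : 0 < stirling_constant.
Proof. exact: expR_gt0. Qed.

Lemma factE_stirling n : (0 < n)%N ->
  n`!%:R = expR (ln_stirling n + (n%:R + 2^-1) * ln n%:R - n%:R).
Proof.
move=> n0; have -> : ln_stirling n + (n%:R + 2^-1) * ln n%:R - n%:R = ln n`!%:R.
  by rewrite /ln_stirling; ring.
by rewrite lnK// posrE ltr0n fact_gt0.
Qed.

End stirling.

(** * Binomial weights *)

Section binomial_weights.
Context (R : realType).
Implicit Types (N j n : nat) (Phi : R -> R) (x u : R).

Lemma expR_natM_ln n u : 0 < u \/ n = 0%N -> expR (n%:R * ln u) = u ^+ n.
Proof.
case=> [u0|->]; last by rewrite mul0r expR0.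
by rewrite -[in RHS](lnK (u0 : u \in Num.pos)) -expRM_natl.
Qed.

Lemma sqrtr_expR u : 0 < u -> Num.sqrt u = expR (2^-1 * ln u).
Proof.
by move=> u0; rewrite -powR12_sqrt ?ltW// /powR gt_eqF.
Qed.

(** This is why [entropyI] is the rate function: its exponential is the product of
powers that appears in the binomial theorem and in Stirling's formula. *)
Lemma level_mean_entropy N j : (0 < N)%N -> (j <= N)%N ->
  N%:R * entropyI (level_mean R N j) =
  j%:R * ln (2 * j%:R / N%:R) + (N - j)%:R * ln (2 * (N - j)%:R / N%:R).
Proof.
move=> N0 jN; have N0' : N%:R != 0 :> R by rewrite pnatr_eq0 -lt0n.
have e1 : 1 + level_mean R N j = 2 * j%:R / N%:R by rewrite /level_mean; ring.
have e2 : 1 - level_mean R N j = 2 * (N - j)%:R / N%:R.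
  by rewrite /level_mean natrB//; field.
by rewrite /entropyI e1 e2; field.
Qed.

(** With a = 2 j / N and b = 2 (N - j) / N one has a + b = 2, and the weight is one
term of the binomial expansion of (a + b)^N, divided by 2^N a^j b^(N - j). The
bound holds at every level, including those to which Stirling's formula does
not apply. *)
Lemma level_weight_le Phi N j : (0 < N)%N -> (j <= N)%N ->
  level_weight Phi N j <=
  expR (N%:R * (Phi (level_mean R N j) - entropyI (level_mean R N j))).
Proof.
move=> N0 jN; rewrite /level_weight mulrBr expRD mulrC ler_pM2l ?expR_gt0//.
rewrite level_mean_entropy// expRN -[leRHS]mul1r ler_pdivlMr ?expR_gt0//.
rewrite expRD !expR_natM_ln; last 2 first.
- have [->|nj] := eqVneq (N - j)%N 0%N; [by right|left].
  by rewrite divr_gt0 ?ltr0n// mulr_gt0 ?ltr0n// lt0n.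
- have [->|nj] := eqVneq j 0%N; [by right|left].
  by rewrite divr_gt0 ?ltr0n// mulr_gt0 ?ltr0n// lt0n.
have N0' : N%:R != 0 :> R by rewrite pnatr_eq0 -lt0n.
set a := 2 * j%:R / N%:R; set b := 2 * (N - j)%:R / N%:R.
have a0 : 0 <= a by rewrite divr_ge0// mulr_ge0.
have b0 : 0 <= b by rewrite divr_ge0// mulr_ge0.
have ab : b + a = 2 by rewrite /a /b natrB//; field.
rewrite mulrAC ler_pdivrMr ?exprn_gt0// mul1r -ab exprDn.
rewrite (bigD1 (Ordinal (jN : (j < N.+1)%N)))//=.
rewrite [leLHS](_ : _ = (b ^+ (N - j) * a ^+ j) *+ 'C(N, j)).
  rewrite lerDl.
  by apply: sumr_ge0 => i _; rewrite mulrn_wge0// mulr_ge0 ?exprn_ge0.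
by rewrite -mulr_natl; ring.
Qed.

(** An identity rather than an asymptotic statement: the error of Stirling's
formula is kept in the first factor, which is bounded and converges to a
constant. *)
Lemma level_weight_stirling Phi N j : (0 < j < N)%N ->
  let x := level_mean R N j in
  level_weight Phi N j =
  expR (ln_stirling R N - ln_stirling R j - ln_stirling R (N - j)) *
  (2 / (Num.sqrt N%:R * Num.sqrt (1 - x ^+ 2))) *
  expR (N%:R * (Phi x - entropyI x)).
Proof.
move=> /andP[j0 jN] x; have N0 : (0 < N)%N by exact: leq_ltn_trans jN.
rewrite /level_weight -/x.
have Nj : (0 < N - j)%N by rewrite subn_gt0.
have -> : expR (N%:R * (Phi x - entropyI x)) =
    expR (N%:R * Phi x) * expR (- (N%:R * entropyI x)) by rewrite mulrBr expRD.
rewrite [RHS]mulrA [RHS]mulrAC; congr (_ * _).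
rewrite /x level_mean_entropy ?(ltnW jN)// -/x.
have a0 : 0 < j%:R :> R by rewrite ltr0n.
have b0 : 0 < (N - j)%:R :> R by rewrite ltr0n.
have n0 : 0 < N%:R :> R by rewrite ltr0n.
have nE : N%:R = j%:R + (N - j)%:R :> R by rewrite -natrD subnKC// ltnW.
have xE : 1 - x ^+ 2 = (2 * j%:R / N%:R) * (2 * (N - j)%:R / N%:R).
  by rewrite /x /level_mean natrB ?(ltnW jN)//; field; rewrite gt_eqF.
have x0 : 0 < 1 - x ^+ 2 by rewrite xE !mulr_gt0 ?invr_gt0.
have p2 : (0 : R) < 2 by [].
have lnq u : 0 < u -> ln (2 * u / N%:R) = ln 2 + ln u - ln N%:R.
  by move=> u0; rewrite ln_div ?lnM ?posrE ?mulr_gt0.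
have CE : 'C(N, j)%:R = N`!%:R / (j`!%:R * (N - j)`!%:R) :> R.
  by rewrite -(bin_fact (ltnW jN)) 2!natrM mulfK// mulf_neq0// pnatr_eq0 -lt0n fact_gt0.
rewrite CE !factE_stirling// -[2 ^+ N](expR_natM_ln (or_introl p2)).
rewrite -expRD -!expRB.
have -> : 2 / (Num.sqrt N%:R * Num.sqrt (1 - x ^+ 2)) =
    expR (ln 2 - (2^-1 * ln N%:R + 2^-1 * ln (1 - x ^+ 2))).
  by rewrite expRB expRD lnK// !sqrtr_expR.
rewrite -!expRD.
congr expR; rewrite xE lnM ?posrE ?divr_gt0 ?mulr_gt0// !lnq//.
by rewrite nE; field.
Qed.

End binomial_weights.

(** * Sums over levels as integrals of step functions *)

Section step_functions.
Context (R : realType).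
Notation mu := (@lebesgue_measure R).
Implicit Types (N j : nat) (a : nat -> R).

(** In the coordinate [z] with magnetization [c + s * z], the interval from one
level to the next. The cells are disjoint and of equal length, so that sums over
levels are integrals of step functions, to which dominated convergence applies. *)
Definition cell (c s : R) N j : set R :=
  `[(level_mean R N j - c) / s, (level_mean R N j - c) / s + 2 / (s * N%:R)[.

Definition step_function (c s : R) N a (z : R) : R :=
  \sum_(j < N.+1) a j * \1_(cell c s N j) z.

(** The cell that contains [z] is found by rounding down, which gives its index
explicitly. *)
Lemma cellP c s N j z : (0 < N)%N -> 0 < s ->
  cell c s N j z <-> j%:R <= N%:R * (1 + c + s * z) / 2 < j%:R + 1.
Proof.
move=> N0 s0; have n0 : 0 < N%:R :> R by rewrite ltr0n.
have n0' : N%:R != 0 :> R by rewrite gt_eqF.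
have s0' : s != 0 by rewrite gt_eqF.
rewrite /cell /= in_itv/= -ltrBlDl ler_pdivrMr//.
have -> : z - (level_mean R N j - c) / s =
    (N%:R * (1 + c + s * z) / 2 - j%:R) * (2 / (s * N%:R)).
  by rewrite /level_mean; field; rewrite n0' s0'.
rewrite gtr_pMl ?divr_gt0 ?mulr_gt0// ltrBlDl [z * s]mulrC.
rewrite /level_mean lerBlDr lerBlDr ler_pdivrMr// ler_pdivlMr//.
have -> : s * z + c + 1 = 1 + c + s * z by ring.
by rewrite [2 * _]mulrC [_ * N%:R]mulrC.
Qed.

Lemma cell_inj c s N i j z : (0 < N)%N -> 0 < s ->
  cell c s N i z -> cell c s N j z -> i = j.
Proof.
move=> N0 s0 /(cellP _ _ _ N0 s0)/andP[i1 i2] /(cellP _ _ _ N0 s0)/andP[j1 j2].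
have ij : i%:R < j%:R + 1 :> R by exact: le_lt_trans j2.
have ji : j%:R < i%:R + 1 :> R by exact: le_lt_trans i2.
by move: ij ji; rewrite !natr1 !ltr_nat !ltnS => ij ji; apply/eqP; rewrite eqn_leq ij.
Qed.

Lemma step_function_cell c s N a j z : (0 < N)%N -> 0 < s -> (j <= N)%N ->
  cell c s N j z -> step_function c s N a z = a j.
Proof.
move=> N0 s0 jN jz; rewrite /step_function.
rewrite (bigD1 (Ordinal (jN : (j < N.+1)%N)))//= indicE mem_set// mulr1.
rewrite big1 ?addr0// => i ij; rewrite indicE memNset ?mulr0// => iz.
by move/eqP: ij; apply; apply/val_inj; exact: cell_inj iz jz.
Qed.

Lemma step_function_cases c s N a z : (0 < N)%N -> 0 < s ->
  step_function c s N a z = 0 \/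
  exists2 j, (j <= N)%N /\ cell c s N j z & step_function c s N a z = a j.
Proof.
move=> N0 s0; have [[j [jN jz]]|nex] := pselect (exists j, (j <= N)%N /\ cell c s N j z).
  by right; exists j => //; exact: step_function_cell.
left; rewrite /step_function big1// => j _.
rewrite indicE memNset ?mulr0// => jz; apply: nex; exists j; split=> //.
by rewrite -ltnS.
Qed.

Lemma measurable_step_function c s N a : measurable_fun setT (step_function c s N a).
Proof.
apply: measurable_sum => j; apply: measurable_funM => //.
by apply: measurable_indic; exact: measurable_itv.
Qed.

Lemma integral_step_function c s N a : (0 < N)%N -> 0 < s ->
  (\int[mu]_z (step_function c s N a z)%:E)%E =
  (2 / (s * N%:R) * \sum_(j < N.+1) a j)%:E.
Proof.
move=> N0 s0.
have w0 : 0 < 2 / (s * N%:R) :> R by rewrite divr_gt0// mulr_gt0// ltr0n.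
have muc j : mu (cell c s N j) = (2 / (s * N%:R))%:E.
  rewrite /cell lebesgue_measure_itv/= lte_fin ltrDl w0 -EFinD; congr _%:E; ring.
have mc j : measurable (cell c s N j) by exact: measurable_itv.
have ic j : mu.-integrable setT (EFin \o \1_(cell c s N j)).
  exact: integrable_indic_itv.
transitivity (\int[mu]_z \sum_(j < N.+1) (a j * \1_(cell c s N j) z)%:E)%E.
  by apply: eq_integral => z _; rewrite sumEFin.
rewrite integral_sum//; last by move=> j; exact: (integrableZl _ (a j) (ic j)).
rewrite mulr_sumr -sumEFin; apply: eq_bigr => j _.
under eq_integral do rewrite EFinM.
rewrite integralZl//; last exact: ic.
rewrite integral_indic//; last exact: mc.
rewrite setIT mulrC EFinM; congr (_ * _)%E; exact: muc.
Qed.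

End step_functions.

(** * Gaussian integrals *)

Section gaussian.
Context (R : realType).
Notation mu := (@lebesgue_measure R).
Implicit Types (b z : R).

Lemma expR_sqr_normal_pdf b z : 0 < b ->
  expR (- (b * z ^+ 2)) =
  Num.sqrt (pi / b) * normal_pdf 0 (Num.sqrt (2 * b)^-1) z.
Proof.
move=> b0; have s0 : Num.sqrt (2 * b)^-1 != 0.
  by rewrite gt_eqF// sqrtr_gt0 invr_gt0 mulr_gt0.
have s2 : (Num.sqrt (2 * b)^-1) ^+ 2 = (2 * b)^-1.
  by rewrite sqr_sqrtr// invr_ge0 mulr_ge0// ltW.
have b0' : b != 0 by rewrite gt_eqF.
rewrite normal_pdfE// /normal_peak /normal_fun s2 subr0.
have -> : (2 * b)^-1 * pi *+ 2 = pi / b by rewrite -mulr_natr; field.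
rewrite mulVKf; last by rewrite gt_eqF// sqrtr_gt0 divr_gt0// pi_gt0.
by congr expR; rewrite -mulr_natr; field.
Qed.

Lemma integrable_expR_sqr b : 0 < b ->
  mu.-integrable setT (EFin \o (fun z => expR (- (b * z ^+ 2)))).
Proof.
move=> b0.
rewrite (_ : _ \o _ = fun z => ((Num.sqrt (pi / b))%:E *
    (normal_pdf 0 (Num.sqrt (2 * b)^-1) z)%:E)%E).
  by apply: integrableZl => //; exact: integrable_normal_pdf.
by apply/funext => z /=; rewrite expR_sqr_normal_pdf.
Qed.

Lemma Rintegral_expR_sqr b : 0 < b ->
  \int[mu]_z expR (- (b * z ^+ 2)) = Num.sqrt (pi / b).
Proof.
move=> b0; under eq_Rintegral do rewrite expR_sqr_normal_pdf//.
rewrite RintegralZl//; last exact: integrable_normal_pdf.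
by rewrite /Rintegral integral_normal_pdf mulr1.
Qed.

End gaussian.

(** * The method of Laplace around one maximizer *)

Section laplace.
Context (R : realType).
Notation mu := (@lebesgue_measure R).

(** The normalization by [Num.sqrt N%:R * h] is the size of the contribution of a
maximizer around which the free energy is spread at scale [h]: weights are of
order N^(-1/2) there, and about N h levels contribute. *)
Definition laplace_sum (Phi : R -> R) (h : R) (A : pred R) (F : R -> R) N : R :=
  (Num.sqrt N%:R * h)^-1 *
  \sum_(j < N.+1 | A (level_mean R N j)) level_weight Phi N j * F (level_mean R N j).

(** The point [c] is a maximizer at which the free energy vanishes to the even
order [q], with leading coefficient [- kappa]; the scale [h] makes
[N * (h z)^q] equal to [z^q]. The parameter [lam] rescales the limiting
coordinate. The observables [F N] are assumed to converge along every sequence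
of magnetizations [c + lam * h N * zs N] with [zs] convergent, because levels
only approach a prescribed point; almost every limit point suffices, which
allows limits with jumps. *)
Variables (Phi Q : R -> R) (c kappa lam d K : R) (q : nat) (h : nat -> R).
Variables (F : nat -> R -> R) (phi : R -> R).
Hypotheses (kappa0 : 0 < kappa) (lam0 : 0 < lam) (d0 : 0 < d) (cd1 : `|c| + d < 1).
Hypotheses (q_even : ~~ odd q) (q_gt1 : (1 < q)%N).
Hypotheses (h_gt0 : forall N, (0 < N)%N -> 0 < h N) (h_cvg0 : h N @[N --> \oo] --> 0)
  (hq : forall N, (0 < N)%N -> N%:R * h N ^+ q = 1).
Hypothesis PhiQ : forall y, Phi (c + y) - entropyI (c + y) = - (Q y * y ^+ q).
Hypotheses (Q_cvg : Q y @[y --> 0] --> kappa)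
  (Q_ge : forall y, `|y| < d -> kappa / 2 <= Q y).
Hypothesis (F_le : forall N x, `|F N x| <= K).

Let a N j : R := if `|level_mean R N j - c| < d then
  Num.sqrt N%:R * lam / 2 * (level_weight Phi N j * F N (level_mean R N j)) else 0.
Let node N j : R := (level_mean R N j - c) / (lam * h N).
Let f N : R -> R := step_function c (lam * h N) N (a N).

Let cd2 : (`|c| + d) ^+ 2 < 1.
Proof. by have := normr_ge0 c; move: d0 cd1; nra. Qed.

Let lh_gt0 N : (0 < N)%N -> 0 < lam * h N.
Proof. by move=> N0; rewrite mulr_gt0// h_gt0. Qed.

Let h_le1 N : (0 < N)%N -> h N <= 1.
Proof.
move=> N0; rewrite leNgt; apply/negP => h1.
have : 1 < N%:R * h N ^+ q.
  rewrite (@lt_le_trans _ _ (h N ^+ q))//.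
    by rewrite exprn_egt1//; case: q q_gt1.
  by rewrite ler_peMl ?ler1n// exprn_ge0// ltW// h_gt0.
by rewrite hq// ltxx.
Qed.

Let Nh_ge1 N : (0 < N)%N -> 1 <= N%:R * h N.
Proof.
move=> N0; rewrite -[leLHS](hq N0) ler_pM2l ?ltr0n//.
by rewrite -[leRHS]expr1 ler_wiXn2l ?h_le1 ?(ltW (h_gt0 N0)) ?(ltnW q_gt1).
Qed.

Let integral_f N : (0 < N)%N -> (\int[mu]_z (f N z)%:E)%E =
  (laplace_sum Phi (h N) (fun x => `|x - c| < d) (F N) N)%:E.
Proof.
move=> N0; rewrite integral_step_function ?lh_gt0//; congr _%:E.
rewrite /a -big_mkcond/= -mulr_sumr /laplace_sum mulrA; congr (_ * _).
have n0 : 0 < Num.sqrt N%:R :> R by rewrite sqrtr_gt0 ltr0n.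
have nn : N%:R = Num.sqrt N%:R * Num.sqrt N%:R :> R.
  by rewrite -expr2 sqr_sqrtr.
have hN := h_gt0 N0.
by rewrite [X in lam * _ * X]nn; field; rewrite !gt_eqF.
Qed.

Let window_lt N j : (0 < N)%N -> (j <= N)%N -> `|level_mean R N j - c| < d ->
  (0 < j < N)%N /\ (level_mean R N j) ^+ 2 <= (`|c| + d) ^+ 2.
Proof.
move=> N0 jN jd; have n0 : 0 < N%:R :> R by rewrite ltr0n.
have x1 : `|level_mean R N j| <= `|c| + d.
  rewrite -[level_mean R N j](subrK c) (le_trans (ler_normD _ _))// addrC lerD2l.
  exact: ltW.
have := le_lt_trans x1 cd1; rewrite ltr_norml => /andP[xl xr]; split.
  apply/andP; split.
    rewrite lt0n; apply/eqP => j0; move: xl.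
    by rewrite j0 /level_mean mulr0 mul0r sub0r ltxx.
  rewrite ltn_neqAle jN andbT; apply/eqP => jE; move: xr.
  by rewrite jE /level_mean mulfK ?gt_eqF//; lra.
by rewrite -real_normK ?num_real// lerXn2r ?nnegrE// (le_trans _ x1).
Qed.

(** The choice of [h] removes [N] from the exponent, which becomes a function of
the rescaled coordinate [node N j]. *)
Let a_window N j : (0 < N)%N -> (j <= N)%N -> `|level_mean R N j - c| < d ->
  a N j = lam * expR (ln_stirling R N - ln_stirling R j - ln_stirling R (N - j)) /
    Num.sqrt (1 - level_mean R N j ^+ 2) *
    expR (- (Q (level_mean R N j - c) * (lam * node N j) ^+ q)) *
    F N (level_mean R N j).
Proof.
move=> N0 jN jd; have [j0N x1] := window_lt N0 jN jd.
rewrite /a jd level_weight_stirling//.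
have -> : N%:R * (Phi (level_mean R N j) - entropyI (level_mean R N j)) =
    - (Q (level_mean R N j - c) * (lam * node N j) ^+ q).
  have xc : c + (level_mean R N j - c) = level_mean R N j by ring.
  have := PhiQ (level_mean R N j - c); rewrite xc => ->.
  rewrite mulrN; congr (- _); rewrite mulrCA; congr (_ * _).
  have -> : level_mean R N j - c = lam * node N j * h N.
    by rewrite /node; field; rewrite !gt_eqF// h_gt0.
  by rewrite exprMn mulrCA hq// mulr1.
have n0 : Num.sqrt N%:R != 0 :> R by rewrite gt_eqF// sqrtr_gt0 ltr0n.
have s0 : Num.sqrt (1 - level_mean R N j ^+ 2) != 0.
  by rewrite gt_eqF// sqrtr_gt0 subr_gt0 (le_lt_trans x1).
by field; apply/andP.
Qed.

(** A Gaussian majorant serves for every order [q], since v^q is at least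
v^2 - 1 for even [q]. *)
Let M := lam * K / Num.sqrt (1 - (`|c| + d) ^+ 2) * expR (5 / 2 * kappa).
Let g z := M * expR (- (kappa * lam ^+ 2 / 4 * z ^+ 2)).

Let f_le N z : (0 < N)%N -> `|f N z| <= g z.
Proof.
move=> N0.
have K0 : 0 <= K := le_trans (normr_ge0 _) (F_le 0 0).
have s1 : 0 < 1 - (`|c| + d) ^+ 2 by rewrite subr_gt0.
have g0 : 0 <= g z.
  by rewrite /g /M !mulr_ge0 ?expR_ge0 ?invr_ge0// ltW.
rewrite /f; have [->|[j [jN jz] ->]] := step_function_cases c (a N) z N0 (lh_gt0 N0).
  by rewrite normr0.
have [jd|jd] := boolP (`|level_mean R N j - c| < d); last first.
  by rewrite /a (negbTE jd) normr0.
have [/andP[j0 jltN] x1] := window_lt N0 jN jd.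
rewrite a_window//.
set x := level_mean R N j in jd x1 *; set w := node N j.
(* The bounds 3/4 and 1 on the Stirling errors give 1 - 3/4 - 3/4 < 0. *)
have e1 : expR (ln_stirling R N - ln_stirling R j - ln_stirling R (N - j)) <= 1.
  rewrite -[leRHS]expR0 ler_expR.
  have /andP[_ ?] := ln_stirling_bounds R N0.
  have /andP[? _] := ln_stirling_bounds R j0.
  have Nj : (0 < N - j)%N by rewrite subn_gt0.
  have /andP[? _] := ln_stirling_bounds R Nj.
  lra.
have sx : Num.sqrt (1 - (`|c| + d) ^+ 2) <= Num.sqrt (1 - x ^+ 2).
  by rewrite ler_sqrt; [rewrite lerD2l lerN2|rewrite subr_ge0 (le_trans x1)// ltW// -subr_gt0].
have sx0 : 0 < Num.sqrt (1 - (`|c| + d) ^+ 2) by rewrite sqrtr_gt0.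
have sx1 : 0 < Num.sqrt (1 - x ^+ 2) := lt_le_trans sx0 sx.
have e2 : expR (- (Q (x - c) * (lam * w) ^+ q)) <=
    expR (5 / 2 * kappa) * expR (- (kappa * lam ^+ 2 / 4 * z ^+ 2)).
  rewrite -expRD ler_expR.
  have vq : (lam * w) ^+ 2 - 1 <= (lam * w) ^+ q.
    set v := lam * w.
    have [q' qE] : exists q', q = q'.*2 by exists q./2; rewrite even_halfK.
    have q'0 : (0 < q')%N by move: q_gt1; rewrite qE; case: (q').
    rewrite qE -muln2 mulnC exprM.
    have [v1|v1] := leP (v ^+ 2) 1.
      by rewrite (@le_trans _ _ 0)// ?subr_le0// exprn_ge0// sqr_ge0.
    rewrite (@le_trans _ _ (v ^+ 2))// ?gerBl//.
    by rewrite -[leLHS]expr1 ler_weXn2l// ltW.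
  have vq0 : 0 <= (lam * w) ^+ q by rewrite exprn_even_ge0.
  have Qk : kappa / 2 * (lam * w) ^+ q <= Q (x - c) * (lam * w) ^+ q.
    by rewrite ler_wpM2r// Q_ge.
  have k2 : kappa / 2 * ((lam * w) ^+ 2 - 1) <= kappa / 2 * (lam * w) ^+ q.
    by rewrite ler_wpM2l// divr_ge0// ltW.
  (* A point of a cell exceeds its left end by at most 2 / lam, as N h >= 1.
     With v^q >= v^2 - 1, the loss in the exponent is the constant 5/2 kappa of [M]. *)
  have zw : (lam * z) ^+ 2 <= 2 * (lam * w) ^+ 2 + 8.
    move: jz; rewrite /cell /= in_itv/= -/x -/(node N j) -/w => /andP[wz zw].
    have l2 : 2 / (lam * h N * N%:R) <= 2 / lam.
      rewrite ler_pM2l// lef_pV2 ?posrE ?mulr_gt0 ?h_gt0 ?ltr0n//.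
      by rewrite -mulrA ler_peMr ?(ltW lam0)// [h N * _]mulrC Nh_ge1.
    have lw : lam * w <= lam * z by rewrite ler_pM2l.
    have lz : lam * z <= lam * w + 2.
      have -> : lam * w + 2 = lam * (w + 2 / lam) by field; rewrite gt_eqF.
      by rewrite ler_pM2l// (le_trans (ltW zw))// lerD2l.
    move: (lam * w) (lam * z) lw lz => A B lw lz.
    have h1 : 0 <= (B - 2 * A) ^+ 2 by exact: sqr_ge0.
    have h2 : 0 <= (B - A) * (2 - (B - A)) by apply: mulr_ge0; lra.
    lra.
  have : kappa / 4 * (lam * z) ^+ 2 <= kappa / 4 * (2 * (lam * w) ^+ 2 + 8).
    by rewrite ler_wpM2l// divr_ge0// ltW.
  by rewrite [(lam * z) ^+ 2]exprMn; lra.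
rewrite !normrM normfV (gtr0_norm lam0) (gtr0_norm sx1).
rewrite !(gtr0_norm (expR_gt0 _)).
rewrite /g /M.
set E := expR (5 / 2 * kappa) in e2 *; set G := expR (- (kappa * _ / 4 * _)) in e2 *.
rewrite [leRHS](_ : _ = lam * 1 / Num.sqrt (1 - (`|c| + d) ^+ 2) * (E * G) * K); last by ring.
rewrite !ler_pM ?mulr_ge0 ?invr_ge0 ?expR_ge0 ?(ltW lam0) ?(ltW sx1)//.
by rewrite lef_pV2 ?posrE.
Qed.

Let index z N : nat := Num.truncn (N%:R * (1 + c + lam * h N * z) / 2).

Let in_cell z N := [/\ (0 < N)%N, (index z N <= N)%N &
  cell c (lam * h N) N (index z N) z].

Let near_cell z : \forall N \near \oo, in_cell z N.
Proof.
have hz : lam * h N * z @[N --> \oo] --> 0.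
  rewrite -(mul0r z) -(mulr0 lam); apply: cvgMl; exact: cvgMr.
near=> N.
have N0 : (0 < N)%N by near: N; exists 1%N.
have n0 : 0 < N%:R :> R by rewrite ltr0n.
have : `|lam * h N * z| < d by near: N; move/cvgr0_norm_lt : hz; exact.
rewrite ltr_norml => /andP[lz1 lz2].
have /andP[c1 c2] : - `|c| <= c <= `|c| by rewrite -ler_norml.
have cd := cd1.
have i0 : 0 <= N%:R * (1 + c + lam * h N * z) / 2.
  rewrite divr_ge0// mulr_ge0//. lra.
have /andP[i1 i2] := truncn_itv i0; split=> //.
  rewrite -(ler_nat R) (le_trans i1)// ler_pdivrMr// ler_wpM2l//; lra.
by apply/(cellP _ _ _ N0 (lh_gt0 N0)); rewrite natr1 i1 i2.
Unshelve. all: by end_near. Qed.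

Let node_cvg z : node N (index z N) @[N --> \oo] --> z.
Proof.
have zh : z - 2 / lam * h N @[N --> \oo] --> z.
  rewrite -[X in _ --> X]subr0 -[X in _ --> _ - X](mulr0 (2 / lam)).
  by apply: cvgB; [exact: cvg_cst|exact: cvgMr].
apply: (squeeze_cvgr _ zh (cvg_cst z)).
near=> N; have [N0 jN]  : in_cell z N by near: N; exact: near_cell.
rewrite /cell /= in_itv/= -/(node _ _) => /andP[-> /ltW zw]; rewrite andbT.
have n0 : 0 < N%:R :> R by rewrite ltr0n.
have hN := h_gt0 N0.
rewrite lerBlDr (le_trans zw)// lerD2l.
have -> : 2 / (lam * h N * N%:R) = 2 / lam * (N%:R * h N)^-1.
  by field; rewrite !gt_eqF.
rewrite ler_pM2l ?divr_gt0// -[leLHS]mul1r ler_pdivrMr ?mulr_gt0//.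
rewrite mulrCA -expr2 -[leLHS](hq N0) ler_pM2l//.
by rewrite ler_wiXn2l ?h_le1 ?(ltW (h_gt0 N0)).
Unshelve. all: by end_near. Qed.

Let mean_cvg z : level_mean R N (index z N) @[N --> \oo] --> c.
Proof.
have : c + lam * h N * node N (index z N) @[N --> \oo] --> c + lam * 0 * z.
  apply: cvgD; first exact: cvg_cst.
  by apply: cvgM; [exact: cvgMr|exact: node_cvg].
rewrite mulr0 mul0r addr0; apply: cvg_trans; apply: near_eq_cvg.
near=> N; have N0 : (0 < N)%N by near: N; exists 1%N.
by rewrite /node mulrCA divff ?mulr1 ?gt_eqF ?lh_gt0//; ring.
Unshelve. all: by end_near. Qed.

Let near_window z : \forall N \near \oo, `|level_mean R N (index z N) - c| < d.
Proof.
by move/cvgrPdist_lt/(_ _ d0): (mean_cvg z); apply: filterS => N; rewrite distrC.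
Qed.

(** Both numbers of spins tend to infinity, so all three Stirling errors
converge. *)
Let index_cvg z : (index z N @[N --> \oo] --> \oo) /\
  ((N - index z N)%N @[N --> \oo] --> \oo).
Proof.
have cd0 : 0 < 1 - (`|c| + d) by rewrite subr_gt0.
suff H (A : nat) : \forall N \near \oo, (A <= index z N)%N /\ (A <= N - index z N)%N.
  by split; apply/cvgnyPge => A; move: (H A); apply: filterS => N [].
near=> N; have [N0 jN jz]  : in_cell z N by near: N; exact: near_cell.
have jd : `|level_mean R N (index z N) - c| < d by near: N; exact: near_window.
have x1 : `|level_mean R N (index z N)| <= `|c| + d.
  rewrite -[level_mean _ _ _](subrK c) (le_trans (ler_normD _ _))// addrC lerD2l.
  by apply: ltW; exact: jd.
have n0 : 0 < N%:R :> R by rewrite ltr0n.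
move: x1; rewrite ler_norml => /andP[xl xr].
have NA : 2 * A%:R / (1 - (`|c| + d)) <= N%:R by near: N; exact: nbhs_infty_ger.
move: NA; rewrite ler_pdivrMr// => NA.
have E1 : 2 * (index z N)%:R = N%:R * (1 + level_mean R N (index z N)).
  by rewrite /level_mean; field; rewrite gt_eqF.
have E2 : 2 * (N - index z N)%:R = N%:R * (1 - level_mean R N (index z N)).
  by rewrite natrB// /level_mean; field; rewrite gt_eqF.
have L1 : N%:R * (1 - (`|c| + d)) <= N%:R * (1 + level_mean R N (index z N)).
  by rewrite ler_pM2l//; lra.
have L2 : N%:R * (1 - (`|c| + d)) <= N%:R * (1 - level_mean R N (index z N)).
  by rewrite ler_pM2l//; lra.
by split; rewrite -(ler_nat R) -(@ler_pM2l _ 2)// ?E1 ?E2; apply: le_trans NA _.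
Unshelve. all: by end_near. Qed.

Let c2_lt1 : 0 < 1 - c ^+ 2.
Proof. by rewrite subr_gt0 -real_normK ?num_real//; have := normr_ge0 c; move: d0 cd1; nra. Qed.

Let const : R := lam / (stirling_constant R * Num.sqrt (1 - c ^+ 2)).

Let f_cvg z : (forall zs : nat -> R, zs N @[N --> \oo] --> z ->
    F N (c + lam * h N * zs N) @[N --> \oo] --> phi z) ->
  f N z @[N --> \oo] --> const * (expR (- (kappa * (lam * z) ^+ q)) * phi z).
Proof.
move=> Fz.
have [i1 i2] := index_cvg z.
have ls := @cvg_ln_stirling R.
set J := index z in i1 i2 *.
have constE : const = lam * expR (ln (stirling_constant R) - ln (stirling_constant R) -
    ln (stirling_constant R)) / Num.sqrt (1 - c ^+ 2).
  rewrite subrr sub0r expRN lnK ?posrE ?stirling_constant_gt0// /const.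
  by rewrite invfM mulrA.
have : lam * expR (ln_stirling R N - ln_stirling R (J N) - ln_stirling R (N - J N)) /
    Num.sqrt (1 - level_mean R N (J N) ^+ 2) *
    (expR (- (Q (level_mean R N (J N) - c) * (lam * node N (J N)) ^+ q)) *
    F N (c + lam * h N * node N (J N))) @[N --> \oo] -->
    const * (expR (- (kappa * (lam * z) ^+ q)) * phi z).
  rewrite constE; apply: cvgM; [apply: cvgM; [apply: cvgMr|]|apply: cvgM].
  - apply: (cvg_comp _ expR); last exact: continuous_expR.
    apply: cvgB; [apply: cvgB|] => //.
    + exact: (cvg_comp J (ln_stirling R) i1 ls).
    + exact: (cvg_comp (fun N => (N - J N)%N) (ln_stirling R) i2 ls).
  - apply: cvgV; first by rewrite gt_eqF// sqrtr_gt0.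
    apply: (cvg_comp _ (@Num.sqrt R)); last exact: sqrt_continuous.
    apply: cvgB; first exact: cvg_cst.
    apply: (cvg_comp _ (fun x : R => x ^+ 2)); [exact: mean_cvg|exact: exprn_continuous].
  - apply: (cvg_comp _ expR); last exact: continuous_expR.
    apply: cvgN; apply: cvgM.
      have yc : level_mean R N (J N) - c @[N --> \oo] --> 0.
        by rewrite -[X in _ --> X](subrr c); apply: cvgB; [exact: mean_cvg|exact: cvg_cst].
      exact: (cvg_comp _ Q yc Q_cvg).
    apply: (cvg_comp _ (fun x : R => x ^+ q)); last exact: exprn_continuous.
    by apply: cvgMr; exact: node_cvg.
  - by apply: Fz; exact: node_cvg.
apply: cvg_trans; apply: near_eq_cvg; near=> N.
have [N0 jN jz]  : in_cell z N by near: N; exact: near_cell.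
have jd : `|level_mean R N (index z N) - c| < d by near: N; exact: near_window.
rewrite /f (step_function_cell _ N0 (lh_gt0 N0) jN jz) a_window//.
rewrite [X in F N X](_ : _ = level_mean R N (J N)); first by rewrite mulrA.
by rewrite /node mulrCA divff ?mulr1 ?gt_eqF ?lh_gt0//; ring.
Unshelve. all: by end_near. Qed.

Hypothesis phi_meas : measurable_fun setT phi.
Hypothesis F_cvg : {ae mu, forall z, forall zs : nat -> R, zs N @[N --> \oo] --> z ->
    F N (c + lam * h N * zs N) @[N --> \oo] --> phi z}.

(** Dominated convergence for the step functions [f N], with pointwise limit
[f_cvg] and majorant [f_le]. Two of the three Stirling errors are in the
denominator of the binomial coefficient, hence the inverse of the constant. *)
Lemma laplace_window :
  laplace_sum Phi (h N) (fun x => `|x - c| < d) (F N) N @[N --> \oo] -->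
  lam / (stirling_constant R * Num.sqrt (1 - c ^+ 2)) *
  \int[mu]_z (expR (- (kappa * (lam * z) ^+ q)) * phi z).
Proof.
have const0 : const != 0.
  by rewrite gt_eqF// divr_gt0// mulr_gt0 ?stirling_constant_gt0 ?sqrtr_gt0.
pose G z := expR (- (kappa * (lam * z) ^+ q)) * phi z.
have mG : measurable_fun setT G.
  apply: measurable_funM => //; apply: measurableT_comp => //.
  apply: measurableT_comp => //; apply: measurable_funM => //.
  by apply: measurable_funX; exact: measurable_funM.
have [iG _ cG] : [/\ mu.-integrable setT (fun z => (const * G z)%:E),
  [sequence \int[mu]_(x in setT) `|(f n.+1 x)%:E - (const * G x)%:E|]_n @ \oo --> 0%E &
  [sequence \int[mu]_(x in setT) (f n.+1 x)%:E]_n @ \oo -->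
    \int[mu]_(x in setT) (const * G x)%:E]%E.
  apply: (@dominated_convergence _ _ _ mu setT measurableT
    (fun n x => (f n.+1 x)%:E) (fun x => (const * G x)%:E) (fun x => (g x)%:E)).
  - by move=> n; apply/measurable_EFinP; exact: measurable_step_function.
  - by apply/measurable_EFinP; exact: measurable_funM.
  - case: F_cvg => A [mA A0 FA]; exists A; split=> // z nz; apply: FA => Fz; apply: nz => _.
    apply: cvg_EFin; first by apply: nearW.
    by have := f_cvg Fz; rewrite -(cvg_shiftS (fun n => f n z)).
  - have b0 : 0 < kappa * lam ^+ 2 / 4 by rewrite divr_gt0// mulr_gt0// exprn_gt0.
    exact: (integrableZl measurableT M (integrable_expR_sqr b0)).
  - by apply: aeW => z n _; rewrite lee_fin f_le.
have iG' : mu.-integrable setT (EFin \o G).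
  rewrite (_ : _ \o _ = fun z => (const^-1%:E * (const * G z)%:E)%E).
    exact: integrableZl.
  by apply/funext => z /=; rewrite -EFinM mulKf.
rewrite -/const -(@RintegralZl _ _ _ mu setT G const)//.
rewrite -(cvg_shiftS (fun N => laplace_sum Phi (h N) (fun x => `|x - c| < d) (F N) N)).
have H : (laplace_sum Phi (h n.+1) (fun x => `|x - c| < d) (F n.+1) n.+1)%:E @[n --> \oo]
    --> (\int[mu]_z (const * G z))%:E.
  rewrite /Rintegral fineK ?integrable_fin_num//.
  apply: cvg_trans cG; apply: near_eq_cvg; apply: nearW => n /=.
  by rewrite integral_f.
exact: (fine_cvg H).
Qed.

End laplace.

(** * Negligible levels and reflections of sums *)

Section laplace_tail.
Context (R : realType).
Implicit Types (Phi F : R -> R) (A B : pred R) (h : R).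

Lemma laplace_sum_split Phi h A B F N :
  laplace_sum Phi h A F N =
  laplace_sum Phi h (fun x => A x && B x) F N + laplace_sum Phi h (fun x => A x && ~~ B x) F N.
Proof. by rewrite /laplace_sum -mulrDr -bigID. Qed.

Lemma eq_laplace_sum Phi h A B F N : A =1 B ->
  laplace_sum Phi h A F N = laplace_sum Phi h B F N.
Proof. by move=> AB; rewrite /laplace_sum; congr (_ * _); apply: eq_bigl => j; exact: AB. Qed.

Lemma level_mean_rev N j : (0 < N)%N -> (j <= N)%N ->
  level_mean R N (N - j) = - level_mean R N j.
Proof.
move=> N0 jN; have n0 : N%:R != 0 :> R by rewrite pnatr_eq0 -lt0n.
by rewrite /level_mean natrB//; field.
Qed.

(** Exchanging plus and minus spins. *)
Lemma laplace_sum_reflect Phi h A F N : (0 < N)%N -> (forall x, Phi (- x) = Phi x) ->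
  (forall x, F (- x) = F x) ->
  laplace_sum Phi h A F N = laplace_sum Phi h (fun x => A (- x)) F N.
Proof.
move=> N0 PhiN FN; rewrite /laplace_sum; congr (_ * _).
rewrite (reindex_inj rev_ord_inj)/=.
have jE (j : 'I_N.+1) : level_mean R N (N.+1 - j.+1) = - level_mean R N j.
  by rewrite subSS level_mean_rev// -ltnS.
apply: eq_big => j; first by rewrite jE.
move=> _; rewrite /level_weight jE FN PhiN subSS bin_sub//.
by rewrite -ltnS.
Qed.

Lemma level_mean_itv N j : (0 < N)%N -> (j <= N)%N -> -1 <= level_mean R N j <= 1.
Proof.
move=> N0 jN; have n0 : 0 < N%:R :> R by rewrite ltr0n.
have jN' : j%:R <= N%:R :> R by rewrite ler_nat.
apply/andP; split.
  by rewrite /level_mean lerDr divr_ge0// mulr_ge0.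
rewrite /level_mean lerBlDr ler_pdivrMr//; lra.
Qed.

(** Away from the maximizers every weight is exponentially small, and there are
only N + 1 levels. *)
Lemma laplace_sum_tail Phi (h : nat -> R) A (F : nat -> R -> R) K e : 0 < e ->
  (forall N, (0 < N)%N -> 1 <= Num.sqrt N%:R * h N) ->
  (forall x, -1 <= x <= 1 -> A x -> Phi x - entropyI x <= - e) ->
  (forall N x, `|F N x| <= K) ->
  laplace_sum Phi (h N) A (F N) N @[N --> \oo] --> 0.
Proof.
move=> e0 hN PhiA FK.
have K0 : 0 <= K := le_trans (normr_ge0 _) (FK 0%N 0).
have bound N : (0 < N)%N -> `|laplace_sum Phi (h N) A (F N) N| <= 8 * K / e ^+ 2 * N%:R^-1.
  move=> N0; have n0 : 0 < N%:R :> R by rewrite ltr0n.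
  have s0 : 0 < Num.sqrt N%:R * h N by exact: lt_le_trans (hN _ N0).
  rewrite /laplace_sum normrM normfV (gtr0_norm s0) ler_pdivrMl//.
  have B0 : 0 <= 8 * K / e ^+ 2 * N%:R^-1 by rewrite !mulr_ge0 ?invr_ge0// ?sqr_ge0// ltW.
  rewrite (@le_trans _ _ (8 * K / e ^+ 2 * N%:R^-1))//; last by rewrite ler_peMl// hN.
  apply: (le_trans (ler_norm_sum _ _ _)).
  apply: (@le_trans _ _ (\sum_(j < N.+1) expR (- (N%:R * e)) * K)).
    rewrite big_mkcond/=; apply: ler_sum => j _.
    have jN : (j <= N)%N by rewrite -ltnS.
    case: ifPn => [Aj|_]; last by rewrite mulr_ge0// expR_ge0.
    rewrite normrM ler_pM//.
    have w0 : 0 <= level_weight Phi N j.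
      by rewrite /level_weight mulr_ge0 ?expR_ge0// divr_ge0// exprn_ge0.
    rewrite ger0_norm// (le_trans (level_weight_le Phi N0 jN))// ler_expR -[leRHS]mulrN ler_pM2l//.
    by apply: PhiA => //; exact: level_mean_itv.
  rewrite sumr_const card_ord -[leLHS]mulr_natl.
  set y := N%:R * e.
  have y0 : 0 < y by rewrite mulr_gt0.
  (* Quadratic decay suffices against N + 1 levels; it comes from [expR (y / 2) >= y / 2]. *)
  have ey : expR (- y) <= 4 / y ^+ 2.
    rewrite expRN -[X in _ <= X]invrK lef_pV2 ?posrE ?expR_gt0 ?invr_gt0 ?divr_gt0 ?exprn_gt0//.
    have -> : (4 / y ^+ 2)^-1 = (y / 2) ^+ 2 by field; rewrite gt_eqF.
    have -> : expR y = expR (y / 2) ^+ 2 by rewrite -expRM_natl; congr expR; field.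
    rewrite lerXn2r ?nnegrE ?expR_ge0 ?divr_ge0 ?(ltW y0)//.
    by rewrite (le_trans _ (expR_ge1Dx _))// lerDr.
  have N2 : N.+1%:R <= 2 * N%:R :> R.
    have : 1 <= N%:R :> R by rewrite ler1n.
    by rewrite -natr1; lra.
  have -> : 8 * K / e ^+ 2 * N%:R^-1 = (2 * N%:R) * (4 / y ^+ 2 * K).
    by rewrite /y; field; rewrite !gt_eqF.
  by rewrite ler_pM ?mulr_ge0 ?expR_ge0// ler_wpM2r.
apply/norm_cvg0P.
have c0 : 8 * K / e ^+ 2 * N%:R^-1 @[N --> \oo] --> 0.
  rewrite -[X in _ --> X](mulr0 (8 * K / e ^+ 2)); apply: cvgMr.
  apply/gtr0_cvgV0; last exact: cvgr_idn.
  by near=> N; rewrite ltr0n; near: N; exists 1%N.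
apply: (squeeze_cvgr _ (cvg_cst 0) c0).
near=> N; rewrite normr_ge0/= bound//; near: N; by exists 1%N.
Unshelve. all: by end_near. Qed.

End laplace_tail.

(** * Monotone ratios and the critical magnetization *)

Section monotone_ratios.
Context (R : realType).
Implicit Types (f g df dg : R -> R) (b x s : R).

(** The monotone form of l'Hopital's rule: if df / dg increases, then f / g stays
below df / dg, by the mean value theorem applied to dg x f - df x g. *)
Lemma ratio_lt_ratio_derive f g df dg b : f 0 = 0 -> g 0 = 0 ->
  (forall x, 0 <= x < b -> is_derive x 1 f (df x)) ->
  (forall x, 0 <= x < b -> is_derive x 1 g (dg x)) ->
  (forall s x, 0 < s -> s < x -> x < b -> df s * dg x < df x * dg s) ->
  forall x, 0 < x < b -> f x * dg x < df x * g x.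
Proof.
move=> f0 g0 fdf gdg incr x /andP[x0 xb].
have [t /andP[t0 tx]|c /andP[c0 cx]] := @MVT_is_derive R (fun t => dg x * f t - df x * g t)
    (fun t => dg x * df t - df x * dg t) 0 x x0.
  have t0b : 0 <= t < b by rewrite t0 (le_lt_trans tx).
  have d1 := is_deriveZ (dg x) (fdf _ t0b); have d2 := is_deriveZ (df x) (gdg _ t0b).
  exact: (is_deriveB d1 d2).
rewrite f0 g0 !mulr0 subrr !subr0 => kx.
have := incr c x c0 cx xb => cxlt.
have : (dg x * df c - df x * dg c) * x < 0 by rewrite pmulr_llt0//; lra.
by rewrite -kx; lra.
Qed.

Lemma ratio_increasing f g df dg b :
  (forall x, 0 < x < b -> is_derive x 1 f (df x)) ->
  (forall x, 0 < x < b -> is_derive x 1 g (dg x)) ->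
  (forall x, 0 < x < b -> 0 < g x) ->
  (forall x, 0 < x < b -> f x * dg x < df x * g x) ->
  forall s x, 0 < s -> s < x -> x < b -> f s * g x < f x * g s.
Proof.
move=> fdf gdg g0 lt s x s0 sx xb.
have [t /andP[t0 tx]|c /andP[c0 cx]] := @MVT_is_derive R (fun t => f t * (g t)^-1)
    (fun t => (df t * g t - f t * dg t) / g t ^+ 2) s x sx.
  have t0b : 0 < t < b by rewrite (lt_le_trans s0 t0) (le_lt_trans tx).
  have gt0 : g t != 0 by rewrite gt_eqF// g0.
  have d := is_deriveM (fdf _ t0b) (is_deriveV gt0 (gdg _ t0b)).
  by apply: (is_derive_eq d); rewrite /GRing.scale/=; field.
have c0b : 0 < c < b by rewrite (lt_trans s0 c0) (lt_trans cx).
have gx : 0 < g x by apply: g0; rewrite (lt_trans s0 sx) xb.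
have gs : 0 < g s by apply: g0; rewrite s0 (lt_trans sx xb).
move=> kx; rewrite -subr_gt0.
have -> : f x * g s - f s * g x = (f x / g x - f s / g s) * (g x * g s).
  by field; rewrite !gt_eqF.
rewrite mulr_gt0 ?mulr_gt0// kx mulr_gt0 ?subr_gt0// divr_gt0 ?subr_gt0 ?lt//.
by rewrite exprn_gt0// g0.
Qed.

Lemma is_derive_id_div_oneBsqr (x : R) : -1 < x < 1 ->
  is_derive x 1 (fun t => t / (1 - t ^+ 2)) ((1 + x ^+ 2) / (1 - x ^+ 2) ^+ 2).
Proof.
move=> x1; have n0 : 1 - x ^+ 2 != 0 by rewrite gt_eqF//; move: x1 => /andP[]; nra.
have d1 := is_deriveB (is_derive_cst (1 : R) x 1) (is_deriveX 2 (is_derive_id x 1)).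
have d := is_deriveM (is_derive_id x 1) (is_deriveV (n0 : (cst 1 - id ^+ 2) x != 0) d1).
by apply: (is_derive_eq d); rewrite /GRing.scale/= !fctE /cst/=; field.
Qed.

(** One application of the rule compares x / (1 - x^2) with [artanh]; the next
lemmas repeat it one derivative lower. *)
Lemma id_div_artanh_increasing (s x : R) : 0 < s -> s < x -> x < 1 ->
  s / (1 - s ^+ 2) * artanh x < x / (1 - x ^+ 2) * artanh s.
Proof.
have dr (u : R) : 0 < u < 1 -> -1 < u < 1 by lra.
have dr0 (u : R) : 0 <= u < 1 -> -1 < u < 1 by lra.
apply: (@ratio_increasing (fun t => t / (1 - t ^+ 2)) (@artanh R)
  (fun x => (1 + x ^+ 2) / (1 - x ^+ 2) ^+ 2) (fun x => (1 - x ^+ 2)^-1) 1).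
- by move=> t /dr; exact: is_derive_id_div_oneBsqr.
- by move=> t /dr; exact: is_derive_artanh.
- by move=> t; exact: artanh_gt0.
apply: ratio_lt_ratio_derive.
- by rewrite mul0r.
- exact: artanh0.
- by move=> t /dr0; exact: is_derive_id_div_oneBsqr.
- by move=> t /dr0; exact: is_derive_artanh.
move=> t u t0 tu u1.
have a0 : 0 < 1 - t ^+ 2 by nra.
have b0 : 0 < 1 - u ^+ 2 by nra.
have ab : t ^+ 2 < u ^+ 2 by nra.
rewrite -subr_gt0.
have -> : (1 + u ^+ 2) / (1 - u ^+ 2) ^+ 2 / (1 - t ^+ 2) -
   (1 + t ^+ 2) / (1 - t ^+ 2) ^+ 2 / (1 - u ^+ 2) =
   2 * (u ^+ 2 - t ^+ 2) / ((1 - u ^+ 2) ^+ 2 * (1 - t ^+ 2) ^+ 2).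
  by field; rewrite !gt_eqF.
by rewrite divr_gt0 ?mulr_gt0 ?exprn_gt0// subr_gt0.
Qed.

Lemma is_derive_id_artanh (x : R) : -1 < x < 1 ->
  is_derive x 1 (fun t => t * artanh t) (artanh x + x / (1 - x ^+ 2)).
Proof.
move=> x1; have d := is_deriveM (is_derive_id x 1) (is_derive_artanh x1).
by apply: (is_derive_eq d); rewrite /GRing.scale/= mulr1 addrC.
Qed.

(** Positivity of the derivative of x artanh x / entropyI x. It also yields the
strict negativity of the second derivative at the critical magnetization. *)
Lemma artanh_sqr_lt (x : R) : 0 < x < 1 ->
  x * artanh x * artanh x < (artanh x + x / (1 - x ^+ 2)) * entropyI x.
Proof.
apply: (@ratio_lt_ratio_derive (fun t => t * artanh t) (@entropyI R)
  (fun x => artanh x + x / (1 - x ^+ 2)) (@artanh R) 1).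
- by rewrite mul0r.
- exact: entropyI0.
- by move=> t t1; apply: is_derive_id_artanh; lra.
- by move=> t t1; apply: is_derive_entropyI; lra.
move=> s t s0 st t1; have := id_div_artanh_increasing s0 st t1; lra.
Qed.

(** The ratio is the logarithmic slope of [entropyI]. It increases from 2 to
infinity, so it takes the value [p] at most once. *)
Lemma id_artanh_div_entropyI_increasing (s x : R) : 0 < s -> s < x -> x < 1 ->
  s * artanh s * entropyI x < x * artanh x * entropyI s.
Proof.
apply: (@ratio_increasing (fun t => t * artanh t) (@entropyI R)
  (fun x => artanh x + x / (1 - x ^+ 2)) (@artanh R) 1).
- by move=> t t1; apply: is_derive_id_artanh; lra.
- by move=> t t1; apply: is_derive_entropyI; lra.
- by move=> t; exact: entropyI_gt0.
- exact: artanh_sqr_lt.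
Qed.

Lemma entropyI_le1 (x : R) : 0 <= x <= 1 -> entropyI x <= 1.
Proof.
move=> /andP[x0 x1]; rewrite /entropyI.
have l1 : ln (1 + x) <= x by apply: le_ln1Dx; lra.
have l2 : ln (1 - x) <= 0 by apply: ln_le0; lra.
have : (1 + x) * ln (1 + x) <= 2 * 1.
  by rewrite ler_pM ?ln_ge0//; lra.
have : (1 - x) * ln (1 - x) <= 0 by rewrite mulr_ge0_le0// subr_ge0.
lra.
Qed.

(** The equation says that [entropyI t / t ^+ p] is stationary at [m]: this is how
a maximizer of the free energy that ties with 0 looks. Its solution is found
between 1/2, where the derivative bound gives the sign, and a point close
to 1. *)
Lemma exists_critical_ratio p : (3 <= p)%N ->
  exists2 m : R, 0 < m < 1 & m * artanh m = p%:R * entropyI m.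
Proof.
move=> p3; have p3' : 3 <= p%:R :> R by rewrite ler_nat.
pose psi (t : R) := t * artanh t - p%:R * entropyI t.
have dpsi (t : R) : -1 < t < 1 -> is_derive t 1 psi
    (artanh t + t / (1 - t ^+ 2) - p%:R * artanh t).
  move=> t1; exact: (is_deriveB (is_derive_id_artanh t1)
    (is_deriveZ p%:R (is_derive_entropyI t1))).
have psi0 : psi 0 = 0 by rewrite /psi mul0r entropyI0 mulr0 subrr.
have psi_half : psi 2^-1 < 0.
  have h0 : (0 : R) < 2^-1 by lra.
  have [t t01|c /andP[c0 c1]] := @MVT_is_derive R psi
      (fun t => artanh t + t / (1 - t ^+ 2) - p%:R * artanh t) _ _ h0.
    by apply: dpsi; lra.
  rewrite psi0 !subr0 => ->; rewrite pmulr_llt0//.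
  have c01 : 0 < c < 1 by lra.
  have /andP[ac _] := artanh_bounds c01.
  have a3 : 3 * artanh c <= p%:R * artanh c by rewrite ler_pM2r// artanh_gt0.
  have : c / (1 - c ^+ 2) <= 2 * c by rewrite ler_pdivrMr; nra.
  lra.
(* At tanh (2 p) the left side is at least p, while [entropyI] is at most 1. *)
pose u : R := 2 * p%:R; pose t1 := tanh u.
have /andP[t1l t1r] : -1 < t1 < 1 := tanh_lt1 u.
have e3 : 3 * expR (- u) <= expR u.
  have : 1 <= expR u * expR (- u) by rewrite -expRD subrr expR0.
  have : 3 * expR (- u) <= 1.
    have : 1 + u <= expR u by exact: expR_ge1Dx.
    rewrite expRN ler_pdivrMr ?expR_gt0//; rewrite /u; lra.
  have : 3 <= expR u by rewrite (le_trans _ (expR_ge1Dx _))// /u; lra.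
  have := expR_gt0 (- u); nra.
have th : 2^-1 <= t1.
  rewrite /t1 /tanh ler_pdivlMr ?addr_gt0 ?expR_gt0//.
  have := expR_gt0 (- u); lra.
have psi_t1 : 0 <= psi t1.
  rewrite /psi artanh_tanh subr_ge0.
  have I1 : entropyI t1 <= 1 by apply: entropyI_le1; lra.
  have : p%:R * entropyI t1 <= p%:R * 1 by rewrite ler_pM2l//; lra.
  have : 2^-1 * u <= t1 * u by rewrite ler_pM2r// /u; lra.
  by rewrite /u; lra.
have cpsi : {within `[2^-1, t1], continuous psi}.
  apply: derivable_within_continuous => x; rewrite in_itv/= => /andP[x0 x1].
  have x01 : -1 < x < 1 by lra.
  by have [] := dpsi x x01.
have [|m] := @IVT R psi _ _ 0 th cpsi.
  by rewrite /Num.min /Num.max (lt_le_trans psi_half psi_t1) (ltW psi_half).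
rewrite in_itv/= => /andP[m0 m1] /eqP; rewrite /psi subr_eq0 => /eqP mE.
by exists m => //; lra.
Qed.

End monotone_ratios.

(** * The threshold *)

Section free_energy.
Context (R : realType).
Implicit Types (p : nat) (m t b beta : R).

(** The supremum over [0, 1] always contains the value 0 taken at 0, so it vanishes
exactly when the free energy is nonpositive. *)
Lemma cw_threshold_eq p b : (0 < p)%N -> 0 <= b ->
  (forall t, 0 <= t <= 1 -> b * t ^+ p <= entropyI t) ->
  (forall b', b < b' -> exists2 t : R, 0 <= t <= 1 & entropyI t < b' * t ^+ p) ->
  cw_threshold R p = b.
Proof.
move=> p0 b0 le_b gt_b.
have I0 t : 0 <= t <= 1 -> 0 <= entropyI t.
  by move=> t01; rewrite (le_trans _ (le_b _ t01))// mulr_ge0// exprn_ge0//; case/andP: t01.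
have g00 b' : cw_free_energy b' p 0 = 0.
  by rewrite /cw_free_energy expr0n gtn_eqF// mulr0 entropyI0 subr0.
have bnd b' : 0 <= b' -> has_ubound (cw_free_energy b' p @` `[0, 1]).
  move=> b'0; exists b' => y [t /=]; rewrite in_itv/= => t01 <-.
  rewrite /cw_free_energy lerBlDr (le_trans (ler_piMr b'0 _)) ?lerDl ?I0//.
  by rewrite exprn_ile1//; case/andP: t01.
have in0 b' : (cw_free_energy b' p @` `[0, 1]) 0.
  by exists 0 => //=; rewrite in_itv/= lexx ler01.
have hs b' : 0 <= b' -> has_sup (cw_free_energy b' p @` `[0, 1]).
  by move=> b'0; split; [exists 0; exact: in0|exact: bnd].
have supE b' : 0 <= b' -> sup (cw_free_energy b' p @` `[0, 1]) = 0 -> b' <= b.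
  move=> b'0 s0; rewrite leNgt; apply/negP => /gt_b [t t01 It].
  have : cw_free_energy b' p t <= 0.
    rewrite -s0; apply: (sup_upper_bound (hs _ b'0)).
    by exists t => //=; rewrite in_itv/=.
  by rewrite /cw_free_energy leNgt subr_gt0 It.
have sup0 : sup (cw_free_energy b p @` `[0, 1]) = 0.
  apply/eqP; rewrite eq_le (sup_upper_bound (hs _ b0) (in0 b)) andbT.
  apply: sup_le_ub; first by exists 0; exact: in0.
  move=> y [t /=]; rewrite in_itv/= => t01 <-.
  by rewrite /cw_free_energy subr_le0 le_b.
have hsb : has_sup [set b' : R | 0 <= b' /\ sup (cw_free_energy b' p @` `[0, 1]) = 0].
  by split; [exists b|exists b => b' [b'0]; exact: supE].
apply/eqP; rewrite eq_le; apply/andP; split; last exact: (sup_upper_bound hsb).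
by apply: sup_le_ub; [exists b|move=> b' [b'0]; exact: supE].
Qed.

(** The constant 1/2 is the threshold for pairs: [artanh c] exceeds [c]. *)
Lemma sqr_lt_entropyI t : 0 < t <= 1 -> 2^-1 * t ^+ 2 < entropyI t.
Proof.
move=> /andP[t0 t1].
have [x x01|x|c] := @MVT R (fun s : R => entropyI s - 2^-1 * s ^+ 2)
    (fun s : R => artanh s - s) 0 t t0.
- have x1 : -1 < x < 1 by move: x01; rewrite in_itv/=; lra.
  have d := is_deriveB (is_derive_entropyI x1)
    (is_deriveZ 2^-1 (is_deriveX 2 (is_derive_id x 1))).
  by apply: (is_derive_eq d); rewrite /GRing.scale/=; field.
- move: x; apply: continuous_subspaceT => x; apply: cvgB; first exact: continuous_entropyI.
  by apply: cvgMr; exact: exprn_continuous.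
rewrite in_itv/= => /andP[c0 ct].
have c01 : 0 < c < 1 by lra.
have /andP[ac _] := artanh_bounds c01.
rewrite entropyI0 expr0n mulr0 subrr !subr0 -subr_gt0 => ->.
by rewrite mulr_gt0// subr_gt0.
Qed.

Lemma sqr_le_entropyI t : 0 <= t <= 1 -> 2^-1 * t ^+ 2 <= entropyI t.
Proof.
move=> /andP[t0 t1]; have [->|tn0] := eqVneq t 0.
  by rewrite entropyI0 expr0n mulr0.
by apply/ltW/sqr_lt_entropyI; rewrite lt0r tn0 t0.
Qed.

Lemma cw_threshold2 : cw_threshold R 2 = 2^-1.
Proof.
apply: cw_threshold_eq => //; first exact: sqr_le_entropyI.
move=> b b1.
have b0 : 0 < b by apply: lt_trans b1; rewrite invr_gt0.
(* Small enough that 1 / (1 - c^2) < 2 b for all c below t, which bounds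
   [artanh c] by [2 * b * c]. *)
pose t : R := (1 - (2 * b)^-1) / 2.
have tb : 0 < (2 * b)^-1 < 1 by rewrite invr_gt0 invf_lt1 ?mulr_gt0//; lra.
have t0 : 0 < t by rewrite /t; lra.
have t1 : t < 1 by rewrite /t; lra.
exists t; first by rewrite !ltW.
have [x /andP[x0 xs]|c /andP[c0 cs]] := @MVT_is_derive R
    (fun s : R => entropyI s - b * s ^+ 2) (fun s : R => artanh s - 2 * b * s) 0 t t0.
  have x1 : -1 < x < 1 by lra.
  have d := is_deriveB (is_derive_entropyI x1)
      (is_deriveZ b (is_deriveX 2 (is_derive_id x 1))).
  by apply: (is_derive_eq d); rewrite /GRing.scale/=; ring.
have c01 : 0 < c < 1 by lra.
have /andP[_ ac] := artanh_bounds c01.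
rewrite entropyI0 expr0n mulr0 subrr !subr0 -subr_lt0 => ->.
rewrite pmulr_llt0// subr_lt0 (lt_le_trans ac)//.
have c2 : 0 < 1 - c ^+ 2 by nra.
have -> : c + c ^+ 3 / (1 - c ^+ 2) = (1 - c ^+ 2)^-1 * c by field; rewrite gt_eqF.
rewrite ler_pM2r// -[leRHS]invrK lef_pV2 ?posrE ?invr_gt0 ?mulr_gt0//.
have : c ^+ 2 <= 2 * t by nra.
by rewrite /t; lra.
Qed.

(** The logarithm of [entropyI t / t ^+ p] has a derivative with the sign of
t artanh t / entropyI t - p. That ratio increases through [p] at [m], so [m] is
the strict minimizer. *)
Lemma entropyI_gt_critical p m t : (0 < p)%N -> 0 < m < 1 -> m * artanh m = p%:R * entropyI m ->
  0 < t <= 1 -> t != m -> entropyI m / m ^+ p * t ^+ p < entropyI t.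
Proof.
move=> p0 /andP[m0 m1] mE /andP[t0 t1] tm.
have Im : 0 < entropyI m by apply: entropyI_gt0; rewrite m0.
(* Endpoint 1, where [artanh] is infinite, is covered by continuity of [k]. *)
pose k (s : R) := ln (entropyI s) - p%:R * ln s.
pose dk (s : R) := (s * artanh s - p%:R * entropyI s) / (s * entropyI s).
have Igt0 (s : R) : 0 < s <= 1 -> 0 < entropyI s.
  move=> /andP[s0 s1]; apply: (@lt_le_trans _ _ (2^-1 * s ^+ 2)).
    by rewrite mulr_gt0// ?invr_gt0// exprn_gt0.
  by apply: sqr_le_entropyI; rewrite (ltW s0).
have kdk (s : R) : 0 < s < 1 -> is_derive s 1 k (dk s).
  move=> /andP[s0 s1]; have Is : 0 < entropyI s by apply: Igt0; rewrite s0 (ltW s1).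
  have s11 : -1 < s < 1 by lra.
  have d := is_deriveB (@is_derive1_comp R (@ln R) (@entropyI R) s _ _
      (is_derive1_ln Is) (is_derive_entropyI s11))
    (is_deriveZ p%:R (is_derive1_ln s0)).
  apply: (is_derive_eq d); rewrite /GRing.scale/= /dk; field.
  by rewrite !gt_eqF.
have kc (s : R) : 0 < s <= 1 -> {for s, continuous k}.
  move=> s01; have s0 : 0 < s by case/andP: s01.
  apply: cvgB; last by apply: cvgMr; exact: continuous_ln.
  apply: (cvg_comp (@entropyI R) (@ln R)); first exact: continuous_entropyI.
  exact/continuous_ln/Igt0.
have main : k m < k t.
  have [tltm|tgtm] := ltP t m.
    have [s s01|cf|c] := @MVT R k dk _ _ tltm.
    - by apply: kdk; move: s01; rewrite in_itv/=; lra.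
    - apply: continuous_in_subspaceT => s; rewrite inE/= in_itv/= => s01.
      by apply: kc; lra.
    rewrite in_itv/= => /andP[c0 cm] kE; rewrite -subr_lt0 kE pmulr_llt0 ?subr_gt0//.
    have c01 : 0 < c < 1 by lra.
    have cp : 0 < c by lra.
    have cI : 0 < c * entropyI c by apply: mulr_gt0 => //; exact: entropyI_gt0.
    rewrite /dk pmulr_llt0 ?invr_gt0//.
    rewrite subr_lt0 -(ltr_pM2r Im).
    have := id_artanh_div_entropyI_increasing (proj1 (andP c01)) cm m1.
    by rewrite mE; lra.
  have {}tgtm : m < t by rewrite lt_neqAle eq_sym tm tgtm.
  have [s s01|cf|c] := @MVT R k dk _ _ tgtm.
  - by apply: kdk; move: s01; rewrite in_itv/=; lra.
  - apply: continuous_in_subspaceT => s; rewrite inE/= in_itv/= => s01.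
    by apply: kc; lra.
  rewrite in_itv/= => /andP[c0 cm] kE; rewrite -subr_gt0 kE mulr_gt0 ?subr_gt0//.
  have c01 : 0 < c < 1 by lra.
  have cp : 0 < c by lra.
  have cI : 0 < c * entropyI c by apply: mulr_gt0 => //; exact: entropyI_gt0.
  rewrite /dk divr_gt0//.
  rewrite subr_gt0 -(ltr_pM2r Im).
  have := id_artanh_div_entropyI_increasing m0 c0 (proj2 (andP c01)).
  by rewrite mE; lra.
have It : 0 < entropyI t by apply: Igt0; rewrite t0.
have mp : 0 < m ^+ p by exact: exprn_gt0.
have tp : 0 < t ^+ p by exact: exprn_gt0.
have Imp : 0 < entropyI m / m ^+ p by exact: divr_gt0.
rewrite -ltr_ln ?posrE//; last exact: mulr_gt0.
rewrite (lnM Imp tp) (ln_div Im mp) !lnXn//.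
have lnp (u : R) : ln u *+ p = p%:R * ln u by rewrite mulr_natl.
rewrite !lnp -ltrBrDr -ltrBlDl; move: main; rewrite /k.
by set x := ln _; set y := p%:R * _; set z := ln _; set w := p%:R * _; lra.
Qed.

Lemma cw_threshold_critical p m : (0 < p)%N -> 0 < m < 1 -> m * artanh m = p%:R * entropyI m ->
  cw_threshold R p = entropyI m / m ^+ p.
Proof.
move=> p0 m01 mE; have /andP[m0 m1] := m01.
have Im : 0 < entropyI m by exact: entropyI_gt0.
have mp : m ^+ p != 0 by rewrite gt_eqF// exprn_gt0.
apply: cw_threshold_eq => //.
- by rewrite divr_ge0 ?exprn_ge0// ltW.
- move=> t /andP[t0 t1]; have [->|tm] := eqVneq t m; first by rewrite divfK.
  have [->|tn0] := eqVneq t 0; first by rewrite entropyI0 expr0n gtn_eqF// mulr0.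
  by apply/ltW/entropyI_gt_critical => //; rewrite t1 lt0r tn0 t0.
- move=> b bgt; exists m; first by rewrite !ltW.
  by rewrite -ltr_pdivrMr// exprn_gt0.
Qed.

End free_energy.

(** * Local expansions of the free energy *)

Section local_expansions.
Context (R : realType).
Implicit Types (f df P : R -> R) (p q : nat) (m t y kappa beta : R).

Lemma is_derive_expn n (x : R) :
  is_derive x 1 (fun t => t ^+ n) (n%:R * x ^+ n.-1).
Proof.
rewrite (_ : (fun t : R => t ^+ n) = id ^+ n); last by apply/funext => t; rewrite exprfctE.
apply: (is_derive_eq (is_deriveX n (is_derive_id x 1))).
by rewrite /GRing.scale/= mulr1.
Qed.

(** Integrating an asymptotic equivalent of the derivative, by the mean value
theorem. The factor [Q] is defined everywhere, including at 0, so that it can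
be composed with any sequence. *)
Lemma power_expansion f df P kappa q : (0 < q)%N -> f 0 = 0 ->
  (\forall y \near (0 : R), is_derive (y : R) 1 f (df y)) ->
  (\forall y \near (0 : R), df y = P y * (q%:R * y ^+ q.-1)) ->
  P y @[y --> 0] --> kappa ->
  exists2 Q : R -> R, Q y @[y --> 0] --> kappa & forall y, f y = Q y * y ^+ q.
Proof.
move=> q0 f0 fdf dfP Pk.
pose Q y := if y == 0 then kappa else f y / y ^+ q.
exists Q; last first.
  move=> y; rewrite /Q; case: eqVneq => [->|y0]; last by rewrite divfK// expf_neq0.
  by rewrite f0 expr0n gtn_eqF// mulr0.
have q0' : 0 < q%:R :> R by rewrite ltr0n.
apply/cvgrPdist_le => e e0.
have ball0 (A : R -> Prop) : (\forall y \near (0 : R), A y) ->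
    exists2 d : R, 0 < d & forall y, `|y| < d -> A y.
  by move=> /nbhs_ballP[d /= d0 dA]; exists d => // y yd; apply: dA; rewrite /ball/= sub0r normrN.
have [d d0 dP] : exists2 d : R, 0 < d & forall y, `|y| < d ->
    [/\ is_derive y 1 f (df y), df y = P y * (q%:R * y ^+ q.-1) & `|kappa - P y| <= e / q%:R].
  apply: ball0; near=> y; split.
  - by near: y.
  - by near: y.
  - by near: y; move/cvgrPdist_le: Pk; apply; rewrite divr_gt0.
near=> y.
have yd : `|y| < d by near: y; apply: (@pseudometric_normed_Zmodule.nbhs0_lt R R).
rewrite /Q; case: eqVneq => [_|y0]; first by rewrite subrr normr0 ltW.
pose k t := f t - kappa * t ^+ q.
pose dk t := (P t - kappa) * (q%:R * t ^+ q.-1).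
have kdk (t : R) : `|t| < d -> is_derive t 1 k (dk t).
  move=> /dP[fd dfE _].
  have D : is_derive t 1 k _ :=
    is_deriveB fd (is_deriveZ kappa (is_derive_expn q t)).
  by apply: (is_derive_eq D); rewrite /GRing.scale/= dfE /dk; ring.
have k0 : k 0 = 0 by rewrite /k f0 expr0n gtn_eqF// mulr0 subrr.
have [c cy kE] : exists2 c, `|c| <= `|y| & k y = dk c * y.
  have [ylt|ygt] := ltP y 0.
    have [t /andP[t1 t2]|c /andP[c1 c2]] := @MVT_is_derive R k dk y 0 ylt.
      apply: kdk; rewrite (le_lt_trans _ yd)//.
      by rewrite (ltr0_norm ylt) ler0_norm// lerN2.
    rewrite k0 !sub0r mulrN => /oppr_inj kE; exists c => //.
    by rewrite (ltr0_norm ylt) ltr0_norm// lerN2 ltW.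
  have {}ygt : 0 < y by rewrite lt0r y0.
  have [t /andP[t1 t2]|c /andP[c1 c2]] := @MVT_is_derive R k dk 0 y ygt.
    apply: kdk; rewrite (le_lt_trans _ yd)//.
    by rewrite (gtr0_norm ygt) ger0_norm.
  rewrite k0 !subr0 => kE; exists c => //.
  by rewrite (gtr0_norm ygt) gtr0_norm// ltW.
have [_ _ cP] := dP _ (le_lt_trans cy yd).
have -> : kappa - f y / y ^+ q = - (k y) / y ^+ q.
  by rewrite /k; field; rewrite expf_neq0.
rewrite normrM normrN normfV normrX ler_pdivrMr ?exprn_gt0 ?normr_gt0//.
rewrite kE /dk !normrM normrX (gtr0_norm q0').
have -> : `|P c - kappa| * (q%:R * `|c| ^+ q.-1) * `|y| =
   `|kappa - P c| * q%:R * (`|c| ^+ q.-1 * `|y|) by rewrite distrC; ring.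
apply: ler_pM; rewrite ?mulr_ge0 ?exprn_ge0 ?(ltW q0')//.
  by rewrite -ler_pdivlMr.
rewrite -[X in _ <= _ ^+ X](prednK q0) exprSr ler_wpM2r//.
by rewrite lerXn2r ?nnegrE.
Unshelve. all: by end_near. Qed.

Lemma artanh_linear : exists2 E : R -> R, E y @[y --> 0] --> (1 : R) &
  forall y, artanh y = E y * y.
Proof.
have h0 : -1 < (0 : R) < 1 by lra.
have /is_derive1_caratheodory[E [EE Ec E1]] := is_derive_artanh h0.
exists E => [|y].
  have <- : E 0 = 1 by rewrite E1 expr0n subr0 invr1.
  exact: Ec.
by have := EE y; rewrite artanh0 !subr0.
Qed.

Lemma near0_itv (d : R) : 0 < d -> \forall y \near (0 : R), - d < y < d.
Proof.
move=> d0; near=> y; rewrite -ltr_norml; near: y.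
exact: (@pseudometric_normed_Zmodule.nbhs0_lt R R).
Unshelve. all: by end_near. Qed.

Lemma artanh_cubic : exists2 E : R -> R, E y @[y --> 0] --> (3^-1 : R) &
  forall y, artanh y - y = E y * y ^+ 3.
Proof.
apply: (@power_expansion _ (fun y => (1 - y ^+ 2)^-1 - 1) (fun y => (3 * (1 - y ^+ 2))^-1)) => //.
- by rewrite artanh0 subrr.
- near=> y; have y1 : -1 < y < 1 by near: y; exact: near0_itv.
  exact: (is_deriveB (is_derive_artanh y1) (is_derive_id y 1)).
- near=> y; have y1 : -1 < y < 1 by near: y; exact: near0_itv.
  by field; apply: lt0r_neq0; nra.
- have -> : (3^-1 : R) = (3 * (1 - 0 ^+ 2))^-1 by rewrite expr0n subr0 mulr1.
  apply: cvgV; first by rewrite expr0n subr0 mulr1.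
  apply: cvgMr; apply: cvgB; [exact: cvg_cst|exact: exprn_continuous].
Unshelve. all: by end_near. Qed.

Lemma is_derive_free_energy beta p t : -1 < t < 1 ->
  is_derive t 1 (cw_free_energy beta p) (beta * p%:R * t ^+ p.-1 - artanh t).
Proof.
move=> t1.
have d := is_deriveB (is_deriveZ beta (is_derive_expn p t)) (is_derive_entropyI t1).
by apply: (is_derive_eq d); rewrite /GRing.scale/= mulrA.
Qed.

(** At the pair threshold the quadratic terms cancel: the derivative of the free
energy is y - artanh y, of order y^3 / 3. This is the source of the exponent
t^4 / 12 and of the scale N^(-1/4). *)
Lemma free_energy_expansion_quartic : exists2 Q : R -> R, Q y @[y --> 0] --> (12^-1 : R) &
  forall y, cw_free_energy 2^-1 2 y = - (Q y * y ^+ 4).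
Proof.
have [E E3 EE] := artanh_cubic.
have [||||Q Qk QE] := @power_expansion (fun y => - cw_free_energy 2^-1 2 y)
  (fun y => artanh y - y) (fun y => E y / 4) 12^-1 4 isT.
- by rewrite /cw_free_energy entropyI0 expr0n mulr0 subrr oppr0.
- near=> y; have y1 : -1 < y < 1 by near: y; exact: near0_itv.
  by apply: (is_derive_eq (is_deriveN (is_derive_free_energy 2^-1 2 y1))) => /=; field.
- by near=> y; rewrite EE/=; field.
- have -> : (12^-1 : R) = 3^-1 / 4 by field.
  exact: cvgMl.
by exists Q => // y; rewrite -QE opprK.
Unshelve. all: by end_near. Qed.

(** For p at least 3 the interaction does not contribute at second order, and the
magnetization near 0 fluctuates as for independent spins. *)
Lemma free_energy_expansion_zero beta p : (3 <= p)%N ->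
  exists2 Q : R -> R, Q y @[y --> 0] --> (2^-1 : R) &
  forall y, cw_free_energy beta p y = - (Q y * y ^+ 2).
Proof.
case: p => [|[|[|p]]]// _.
have [E E1 EE] := artanh_linear.
have [||||Q Qk QE] := @power_expansion (fun y => - cw_free_energy beta p.+3 y)
  (fun y => artanh y - beta * p.+3%:R * y ^+ p.+2)
  (fun y => (E y - beta * p.+3%:R * y ^+ p.+1) / 2) 2^-1 2 isT.
- by rewrite /cw_free_energy entropyI0 expr0n mulr0 subrr oppr0.
- near=> y; have y1 : -1 < y < 1 by near: y; exact: near0_itv.
  by apply: (is_derive_eq (is_deriveN (is_derive_free_energy beta p.+3 y1))) => /=; rewrite opprB.
- by near=> y; rewrite EE/= [y ^+ p.+2]exprSr; field.
- have e : (2^-1 : R) = (1 - beta * p.+3%:R * 0 ^+ p.+1) / 2.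
    by rewrite expr0n mulr0 subr0 div1r.
  rewrite [X in _ --> X]e.
  apply: cvgM; last exact: cvg_cst.
  apply: cvgB => //; apply: cvgM; [exact: cvg_cst|exact: exprn_continuous].
by exists Q => // y; rewrite -QE opprK.
Unshelve. all: by end_near. Qed.

Lemma is_derive_derive_free_energy beta p m : -1 < m < 1 ->
  is_derive m 1 (fun t => beta * p%:R * t ^+ p.-1 - artanh t)
    (beta * p%:R * (p.-1%:R * m ^+ p.-2) - (1 - m ^+ 2)^-1).
Proof.
move=> m1.
have d := is_deriveB (is_deriveZ (beta * p%:R) (is_derive_expn p.-1 m))
  (is_derive_artanh m1).
exact: d.
Qed.

Lemma derive1n2_free_energy beta p m : -1 < m < 1 ->
  derive1n 2 (cw_free_energy beta p) m =
  beta * p%:R * (p.-1%:R * m ^+ p.-2) - (1 - m ^+ 2)^-1.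
Proof.
move=> m1; rewrite derive1nS derive1n1 derive1E.
have d := is_derive_derive_free_energy beta p m1.
rewrite -(@derive_val _ _ _ _ _ _ _ d).
apply: near_eq_derive.
near=> t; rewrite derive1E.
have t1 : -1 < t < 1.
  near: t; move: m1 => /andP[m0 m1].
  by near=> t; apply/andP; split; near: t; [exact: lt_nbhsr|exact: lt_nbhsl].
exact: (@derive_val _ _ _ _ _ _ _ (is_derive_free_energy beta p t1)).
Unshelve. all: by end_near. Qed.

Lemma free_energy_expansion_critical beta p m : -1 < m < 1 ->
  cw_free_energy beta p m = 0 -> beta * p%:R * m ^+ p.-1 = artanh m ->
  exists2 Q : R -> R, Q y @[y --> 0] --> - derive1n 2 (cw_free_energy beta p) m / 2 &
  forall y, cw_free_energy beta p (m + y) = - (Q y * y ^+ 2).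
Proof.
move=> m1 Gm G'm; rewrite derive1n2_free_energy//.
have /is_derive1_caratheodory[E [EE Ec E1]] := is_derive_derive_free_energy beta p m1.
have cE : E (m + y) @[y --> 0] --> E m.
  have my : m + y @[y --> 0] --> m.
    by rewrite -[X in _ --> X]addr0; apply: cvgD; [exact: cvg_cst|exact: cvg_id].
  exact: (cvg_comp _ E my Ec).
have [||||Q Qk QE] := @power_expansion (fun y => - cw_free_energy beta p (m + y))
  (fun y => - (beta * p%:R * (m + y) ^+ p.-1 - artanh (m + y)))
  (fun y => - E (m + y) / 2) (- E m / 2) 2 isT.
- by rewrite addr0 Gm oppr0.
- near=> y.
  have y1 : -1 < m + y < 1.
    near: y; move: m1 => /andP[m0 m1].
    have d0 : 0 < Num.min (m + 1) (1 - m) by rewrite lt_min; apply/andP; split; lra.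
    near=> y; have : `|y| < Num.min (m + 1) (1 - m).
      by near: y; apply: (@pseudometric_normed_Zmodule.nbhs0_lt R R).
    by rewrite lt_min !ltr_norml => /andP[/andP[? ?] /andP[? ?]]; lra.
  have dm : is_derive y 1 (fun y => m + y) 1.
    by have := is_deriveD (is_derive_cst (m : R) y 1) (is_derive_id y 1); rewrite add0r.
  have := @is_derive1_comp R _ (fun y => m + y) y _ _ (is_derive_free_energy beta p y1) dm.
  by rewrite mulr1 => /is_deriveN.
- near=> y; have := EE (m + y); rewrite G'm subrr subr0 => ->.
  have -> : m + y - m = y by ring.
  by rewrite /=; field.
- by apply: cvgM; [exact: cvgN|exact: cvg_cst].
exists Q; first by rewrite -E1.
by move=> y; rewrite -QE opprK.
Unshelve. all: by end_near. Qed.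

End local_expansions.

(** * The estimate as a function of the magnetization *)

Section estimator.
Context (R : realType).
Implicit Types (p N : nat) (t : R).

Lemma mul_artanh_gt0 t : -1 < t < 1 -> t != 0 -> 0 < t * artanh t.
Proof.
move=> t1 t0; have [tn|tp] := ltP t 0.
  by rewrite -mulrNN -artanhN mulr_gt0 ?artanh_gt0 ?oppr_gt0//; lra.
have {}tp : 0 < t by rewrite lt0r t0.
by rewrite mulr_gt0// artanh_gt0//; lra.
Qed.

(** For nonzero [t], division by [t ^+ p.-1] turns the estimating equation into
[t = tanh (p b t ^+ p.-1)]; it has no nonnegative solution when [t ^+ p] is
negative or all spins agree. Every [b] is a solution at [t = 0]. *)
Definition mple_of_mean p t : \bar R :=
  if t == 0 then 0%E else
  if (`|t| < 1) && (0 < t ^+ p) then (artanh t / (p%:R * t ^+ p.-1))%:E else +oo%E.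

Lemma curie_weiss_mplE N p (x : N.-tuple bool) : (1 < p)%N -> (0 < N)%N ->
  curie_weiss_mpl R p x = mple_of_mean p (magnetization R x).
Proof.
move=> p1 N0; rewrite /curie_weiss_mpl /mpl_estimate; set t := magnetization R x.
have p0 : (0 < p)%N by exact: ltnW.
have pR : 0 < p%:R :> R by rewrite ltr0n.
have n0 : N%:R != 0 :> R by rewrite pnatr_eq0 -lt0n.
set S := [set b : R | _].
have SE b : S b <-> 0 <= b /\ t ^+ p = t ^+ p.-1 * tanh (p%:R * b * t ^+ p.-1).
  rewrite /S /= curie_weiss_hamiltonian//.
  under eq_bigr do rewrite curie_weiss_local_field -/t.
  rewrite sumr_const card_ord -[X in _ = X]mulr_natl.
  by split=> -[b0 bE]; split=> //; [exact: (mulfI n0)|rewrite bE].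
rewrite /mple_of_mean; have [t0|t0] := eqVneq t 0.
  apply/eqP; rewrite eq_le; apply/andP; split.
    apply: ereal_inf_lbound; exists 0 => //; apply/SE; split=> //.
    by rewrite t0; case: (p) p1 => [|[|q]]// _; rewrite !exprS !mul0r.
  by apply: le_ereal_inf_tmp => _ [b /SE[b0 _] <-]; rewrite lee_fin.
have tp : t ^+ p.-1 != 0 by rewrite expf_neq0.
have tpE : t ^+ p = t ^+ p.-1 * t by rewrite -exprSr prednK.
have SE' b : S b <-> 0 <= b /\ t = tanh (p%:R * b * t ^+ p.-1).
  by rewrite SE tpE; split=> -[b0 bE]; split=> //; [exact: (mulfI tp)|rewrite -bE].
case: ifPn => [/andP[t1 tp0]|tn].
  move: t1; rewrite ltr_norml => t1.
  rewrite (_ : S = [set artanh t / (p%:R * t ^+ p.-1)]); first by rewrite image_set1 ereal_inf1.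
  apply/seteqP; split=> [b /SE'[b0 bE]|b ->] /=.
    by have := artanh_tanh (p%:R * b * t ^+ p.-1); rewrite -bE => ->; field; rewrite tp gt_eqF.
  apply/SE'; split.
    have -> : artanh t / (p%:R * t ^+ p.-1) = t * artanh t / (p%:R * t ^+ p).
      by rewrite tpE; field; rewrite tp t0 gt_eqF.
    by apply: divr_ge0; [exact/ltW/mul_artanh_gt0|apply: mulr_ge0; exact: ltW].
  have -> : p%:R * (artanh t / (p%:R * t ^+ p.-1)) * t ^+ p.-1 = artanh t.
    by field; rewrite tp gt_eqF.
  by rewrite tanh_artanh.
rewrite (_ : S = set0); first by rewrite image_set0 ereal_inf0.
apply/seteqP; split=> // b /SE'[b0 bE].
have t1 : -1 < t < 1 by rewrite bE; exact: tanh_lt1.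
move: tn; rewrite negb_and ltr_norml t1/= -leNgt => tp0.
have aE := artanh_tanh (p%:R * b * t ^+ p.-1); rewrite -bE in aE.
have := mul_artanh_gt0 t1 t0; rewrite aE ltNge => /negP; apply.
have -> : t * (p%:R * b * t ^+ p.-1) = p%:R * b * t ^+ p by rewrite tpE; ring.
by rewrite mulr_ge0_le0// mulr_ge0// ltW.
Qed.

End estimator.

(** * Sums over all levels *)

Section laplace_totals.
Context (R : realType).
Notation mu := (@lebesgue_measure R).
Implicit Types (p N : nat) (t m beta lam K : R) (F : nat -> R -> R) (phi : R -> R).

Lemma ae_imply (P Q : R -> Prop) : (forall z, P z -> Q z) ->
  {ae mu, forall z, P z} -> {ae mu, forall z, Q z}.
Proof.
move=> PQ [A [mA A0 PA]]; exists A; split=> // z nQ; apply: PA => Pz.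
by apply: nQ; exact: PQ.
Qed.

(** Compactness; such a uniform gap makes all levels outside the windows
exponentially unlikely. *)
Lemma negative_away (G : R -> R) (A : set R) : continuous G -> closed A ->
  (forall x, -1 <= x <= 1 -> A x -> G x < 0) ->
  exists2 e, 0 < e & forall x, -1 <= x <= 1 -> A x -> G x <= - e.
Proof.
move=> cG cA GA.
have cB : compact (`[(-1), 1] `&` A).
  by apply: compact_closedI => //; exact: segment_compact.
have [/set0P Bn0|B0] := boolP ((`[(-1), 1] `&` A) != set0); last first.
  exists 1 => // x x1 Ax; exfalso; move/negP: B0; apply; apply/set0P; exists x; split=> //.
have [c] := compact_EVT_max Bn0 cB (continuous_subspaceT cG).
rewrite inE => -[/=]; rewrite in_itv/= => c1 Ac cmax.
exists (- G c); first by rewrite oppr_gt0 GA.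
move=> x x1 Ax; rewrite opprK; apply: cmax; rewrite inE; split=> //.
Qed.

Lemma closed_dist_ge (c d : R) : closed [set x : R | d <= `|x - c|].
Proof.
rewrite (_ : [set x | _] = (fun x : R => `|x - c|) @^-1` [set y | d <= y]) //.
apply: closed_comp; last exact: closed_ge.
move=> x _; apply: (@cvg_norm _ R^o); apply: cvgB; [exact: cvg_id|exact: cvg_cst].
Qed.

Lemma continuous_free_energy beta p : continuous (cw_free_energy beta p).
Proof.
move=> x; apply: cvgB; last exact: continuous_entropyI.
by apply: cvgM; [exact: cvg_cst|exact: exprn_continuous].
Qed.

(** Half of the leading coefficient is what the majorant of [laplace_window]
requires on the whole window. *)
Lemma near_ge_half (Q : R -> R) (kappa : R) : 0 < kappa -> Q y @[y --> 0] --> kappa ->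
  exists2 d : R, 0 < d & forall y, `|y| < d -> kappa / 2 <= Q y.
Proof.
move=> k0 Qk.
have k2 : 0 < kappa / 2 by rewrite divr_gt0.
have /nbhs_ballP[d /= d0 dQ] : \forall y \near (0 : R), `|kappa - Q y| < kappa / 2.
  by move/cvgrPdist_lt: Qk; apply.
exists d => // y yd; have := dQ y; rewrite /ball/= sub0r normrN => /(_ yd).
by rewrite ltr_norml => /andP[_]; lra.
Qed.

(** The critical equation for [m], read as the vanishing of the derivative of the
free energy. *)
Lemma critical_slope p m : (0 < p)%N -> 0 < m < 1 -> m * artanh m = p%:R * entropyI m ->
  entropyI m / m ^+ p * p%:R * m ^+ p.-1 = artanh m.
Proof.
move=> p0 /andP[m0 _] mE; apply: (mulfI (lt0r_neq0 m0)).
rewrite mE -[in m ^+ p](prednK p0) exprS.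
by field; rewrite expf_neq0 ?gt_eqF.
Qed.

Lemma cvg_sqrt_pinfty (u : nat -> R) : u N @[N --> \oo] --> +oo ->
  Num.sqrt (u N) @[N --> \oo] --> +oo.
Proof.
move/cvgryPge => uy; apply/cvgryPge => A; near=> N.
rewrite (le_trans (ler_norm A))// -sqrtr_sqr ler_wsqrtr//; near: N; exact: uy.
Unshelve. all: by end_near. Qed.

(** Only the window around 0 matters, as [entropyI t] exceeds [t ^+ 2 / 2]
elsewhere. *)
Lemma laplace_total_quartic (h : nat -> R) F phi K :
  (forall N, (0 < N)%N -> 0 < h N) -> h N @[N --> \oo] --> 0 ->
  (forall N, (0 < N)%N -> N%:R * h N ^+ 4 = 1) ->
  (forall N x, `|F N x| <= K) -> measurable_fun setT phi ->
  {ae mu, forall z, forall zs : nat -> R, zs N @[N --> \oo] --> z ->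
    F N (h N * zs N) @[N --> \oo] --> phi z} ->
  laplace_sum (fun t => 2^-1 * t ^+ 2) (h N) predT (F N) N @[N --> \oo] -->
  (stirling_constant R)^-1 * \int[mu]_z (expR (- (z ^+ 4 / 12)) * phi z).
Proof.
move=> h0 hc hq FK mphi Fphi.
have [Q Qk QE] := free_energy_expansion_quartic R.
have k0 : 0 < 12^-1 :> R by rewrite invr_gt0.
have [d1 d10 Qge] := near_ge_half k0 Qk.
have [d d0 [dd1 dlt]] : exists2 d, 0 < d & d <= d1 /\ d <= 2^-1.
  exists (Num.min d1 2^-1); first by rewrite lt_min d10/= invr_gt0 ltr0n.
  by rewrite !ge_min !lexx !orbT.
have cd : `|0 : R| + d < 1 by rewrite normr0; lra.
have W : laplace_sum (fun t => 2^-1 * t ^+ 2) (h N) (fun x => `|x - 0| < d) (F N) N @[N --> \oo] -->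
    1 / (stirling_constant R * Num.sqrt (1 - 0 ^+ 2)) *
    \int[mu]_z (expR (- (12^-1 * (1 * z) ^+ 4)) * phi z).
  apply: (@laplace_window R _ Q 0 12^-1 1 d K 4 h F phi) => //.
  - by move=> y; rewrite add0r -QE.
  - by move=> y yd; apply: Qge; exact: lt_le_trans yd dd1.
  - apply: ae_imply Fphi => z Fz zs zsz.
    by under eq_fun do rewrite add0r mul1r; exact: Fz.
have [e e0 eP] : exists2 e, 0 < e & forall x, -1 <= x <= 1 -> d <= `|x - 0| ->
    cw_free_energy 2^-1 2 x <= - e.
  apply: negative_away; [exact: continuous_free_energy|exact: closed_dist_ge|].
  move=> x x1 /=; rewrite subr0 => dx; rewrite /cw_free_energy subr_lt0.
  have xE : entropyI x = entropyI `|x|.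
    by have [xn|xp] := ltP x 0; rewrite ?(ltr0_norm xn) ?entropyIN// ger0_norm.
  rewrite xE -(real_normK (num_real x)) sqr_lt_entropyI//.
  by rewrite (lt_le_trans d0 dx)/= ler_norml.
have T : laplace_sum (fun t => 2^-1 * t ^+ 2) (h N) (fun x => ~~ (`|x - 0| < d)) (F N) N
    @[N --> \oo] --> 0.
  apply: (@laplace_sum_tail R _ h _ F K e) => //; last by move=> x x1; rewrite -leNgt; exact: eP.
  move=> N N0; have hN := h0 _ N0.
  have n0 : 0 < N%:R :> R by rewrite ltr0n.
  have h1 : h N <= 1.
    rewrite leNgt; apply/negP => h1.
    have : 1 < N%:R * h N ^+ 4.
      rewrite (@lt_le_trans _ _ (h N ^+ 4)) ?exprn_egt1//.
      by rewrite ler_peMl ?ler1n// exprn_ge0// ltW.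
    by rewrite hq// ltxx.
  rewrite -(@ler_pXn2r _ 2) ?nnegrE ?mulr_ge0 ?sqrtr_ge0 ?(ltW hN)//.
  rewrite expr1n exprMn sqr_sqrtr ?ler0n// -[leLHS](hq _ N0) ler_pM2l//.
  by rewrite ler_wiXn2l// ltW.
have WT : laplace_sum (fun t => 2^-1 * t ^+ 2) (h N) (fun x => `|x - 0| < d) (F N) N +
    laplace_sum (fun t => 2^-1 * t ^+ 2) (h N) (fun x => ~~ (`|x - 0| < d)) (F N) N
    @[N --> \oo] --> 1 / (stirling_constant R * Num.sqrt (1 - 0 ^+ 2)) *
    \int[mu]_z (expR (- (12^-1 * (1 * z) ^+ 4)) * phi z) + 0.
  by apply: cvgD; [exact: W|exact: T].
move: WT; rewrite addr0.
rewrite expr0n subr0 sqrtr1 mulr1 div1r.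
rewrite (_ : (\int[mu]_z _) = \int[mu]_z (expR (- (z ^+ 4 / 12)) * phi z)); last first.
  by apply: eq_Rintegral => z _; rewrite mul1r [_^-1 * _]mulrC.
apply: cvg_trans; apply: near_eq_cvg; near=> N.
by rewrite [RHS](laplace_sum_split _ _ _ (fun x => `|x - 0| < d)).
Unshelve. all: by end_near. Qed.

(** The free energy vanishes at 0, at [m] and, for even [p], at [- m]. The third
window is folded onto the second by reflection, which requires [F N] to be even
and explains the factor 2. For odd [p] the free energy is negative on the
negative half-line. *)
Lemma laplace_total_two_wells p beta m lam K F (phi0 phim : R -> R) : (3 <= p)%N ->
  0 < m < 1 -> m * artanh m = p%:R * entropyI m -> beta = entropyI m / m ^+ p ->
  derive1n 2 (cw_free_energy beta p) m < 0 -> 0 < lam ->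
  (forall N x, `|F N x| <= K) -> (~~ odd p -> forall N x, F N (- x) = F N x) ->
  measurable_fun setT phi0 -> measurable_fun setT phim ->
  {ae mu, forall z, forall zs : nat -> R, zs N @[N --> \oo] --> z ->
    F N ((Num.sqrt N%:R)^-1 * zs N) @[N --> \oo] --> phi0 z} ->
  {ae mu, forall z, forall zs : nat -> R, zs N @[N --> \oo] --> z ->
    F N (m + lam * (Num.sqrt N%:R)^-1 * zs N) @[N --> \oo] --> phim z} ->
  laplace_sum (fun t => beta * t ^+ p) (Num.sqrt N%:R)^-1 predT (F N) N @[N --> \oo] -->
  (stirling_constant R)^-1 * \int[mu]_z (expR (- (2^-1 * z ^+ 2)) * phi0 z) +
  (if odd p then 1 else 2) * (lam / (stirling_constant R * Num.sqrt (1 - m ^+ 2)) *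
    \int[mu]_z (expR (- (- derive1n 2 (cw_free_energy beta p) m / 2 * (lam * z) ^+ 2)) * phim z)).
Proof.
move=> p3 m01 mE betaE g2 lam0 FK Feven mphi0 mphim Fphi0 Fphim.
have /andP[m0 m1] := m01; have p0 : (0 < p)%N by exact: leq_trans p3.
set k := - derive1n 2 (cw_free_energy beta p) m / 2.
have k0 : 0 < k by rewrite divr_gt0// oppr_gt0.
have m11 : -1 < m < 1 by lra.
have mp : m ^+ p != 0 by rewrite expf_neq0// gt_eqF.
have Gm : cw_free_energy beta p m = 0.
  by rewrite /cw_free_energy betaE divfK// subrr.
have G'm : beta * p%:R * m ^+ p.-1 = artanh m.
  by rewrite betaE critical_slope.
pose h N : R := (Num.sqrt N%:R)^-1.
have h0 N : (0 < N)%N -> 0 < h N by move=> N0; rewrite invr_gt0 sqrtr_gt0 ltr0n.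
have hc : h N @[N --> \oo] --> 0.
  apply/gtr0_cvgV0; first by near=> N; rewrite sqrtr_gt0 ltr0n; near: N; exists 1%N.
  by apply: cvg_sqrt_pinfty; exact: cvgr_idn.
have hq N : (0 < N)%N -> N%:R * h N ^+ 2 = 1.
  by move=> N0; rewrite /h exprVn sqr_sqrtr// divff// pnatr_eq0 -lt0n.
have [Q0 Q0k Q0E] := free_energy_expansion_zero beta p3.
have [Qm Qmk QmE] := free_energy_expansion_critical m11 Gm G'm.
have half0 : 0 < 2^-1 :> R by rewrite invr_gt0.
have [d0 d00 Q0ge] := near_ge_half half0 Q0k.
have [dm dm0 Qmge] := near_ge_half k0 Qmk.
have [d d_gt0 [[dd0 ddm] [dm2 d1m]]] : exists2 d, 0 < d &
    (d <= d0 /\ d <= dm) /\ (d <= m / 2 /\ d <= (1 - m) / 2).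
  exists (Num.min (Num.min d0 dm) (Num.min (m / 2) ((1 - m) / 2))).
    by rewrite !lt_min d00 dm0 !divr_gt0// subr_gt0.
  by rewrite !ge_min !lexx !orbT.
pose Phi t := beta * t ^+ p.
have W0 : laplace_sum Phi (h N) (fun x => `|x - 0| < d) (F N) N @[N --> \oo] -->
    1 / (stirling_constant R * Num.sqrt (1 - 0 ^+ 2)) *
    \int[mu]_z (expR (- (2^-1 * (1 * z) ^+ 2)) * phi0 z).
  apply: (@laplace_window R _ Q0 0 2^-1 1 d K 2 h F phi0) => //.
  - by rewrite normr0; lra.
  - by move=> y; rewrite add0r -Q0E.
  - by move=> y yd; apply: Q0ge; exact: lt_le_trans yd dd0.
  - apply: ae_imply Fphi0 => z Fz zs zsz.
    by under eq_fun do rewrite add0r mul1r; exact: Fz.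
have Wm : laplace_sum Phi (h N) (fun x => `|x - m| < d) (F N) N @[N --> \oo] -->
    lam / (stirling_constant R * Num.sqrt (1 - m ^+ 2)) *
    \int[mu]_z (expR (- (k * (lam * z) ^+ 2)) * phim z).
  apply: (@laplace_window R _ Qm m k lam d K 2 h F phim) => //.
  - by rewrite gtr0_norm//; lra.
  - by move=> y yd; apply: Qmge; exact: lt_le_trans yd ddm.
pose A0 : pred R := fun x => `|x - 0| < d.
pose A1 : pred R := fun x => `|x - m| < d.
pose A2 : pred R := fun x => ~~ odd p && (`|- x - m| < d).
have Gneg t : 0 < t <= 1 -> t != m -> cw_free_energy beta p t < 0.
  by move=> t01 tm; rewrite /cw_free_energy subr_lt0 betaE entropyI_gt_critical.
have [e e0 eP] : exists2 e, 0 < e & forall x, -1 <= x <= 1 ->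
    ~~ A0 x && ~~ A1 x && ~~ A2 x -> cw_free_energy beta p x <= - e.
  have [e e0 eP] : exists2 e, 0 < e & forall x, -1 <= x <= 1 ->
    ([set x | d <= `|x - 0|] `&` [set x | d <= `|x - m|] `&`
     (if odd p then setT else [set x | d <= `|x - - m|])) x -> cw_free_energy beta p x <= - e.
    apply: negative_away; first exact: continuous_free_energy.
      apply: closedI; first by apply: closedI; exact: closed_dist_ge.
      by case: ifP => _; [exact: closedT|exact: closed_dist_ge].
    move=> x x1 [[/=]]; rewrite subr0 => dx dxm dxm'.
    have xn0 : x != 0 by rewrite -normr_gt0 (lt_le_trans d_gt0).
    have [xn|xp] := ltP x 0; last first.
      apply: Gneg; first by rewrite lt0r xn0 xp/=; case/andP: x1.
      by rewrite -subr_eq0 -normr_gt0 (lt_le_trans d_gt0).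
    have Nx : 0 < - x <= 1 by lra.
    have xE : cw_free_energy beta p x = beta * (- (- x)) ^+ p - entropyI (- x).
      by rewrite /cw_free_energy opprK entropyIN.
    rewrite xE; have := dxm'; case: ifPn => [podd _|peven /= dmx].
      rewrite subr_lt0 exprNn -signr_odd podd expr1 mulN1r mulrN.
      rewrite (@le_lt_trans _ _ 0)//; last first.
        by rewrite (lt_trans _ (sqr_lt_entropyI Nx))// mulr_gt0 ?exprn_gt0//; lra.
      rewrite oppr_le0 mulr_ge0 ?exprn_ge0//; last lra.
      by rewrite betaE divr_ge0 ?exprn_ge0 ?(ltW m0)// ltW// entropyI_gt0.
    rewrite exprNn -signr_odd (negbTE peven) expr0 mul1r.
    apply: (Gneg (- x)) => //; apply/eqP => xm; move: dmx.
    by rewrite -xm opprK subrr normr0 leNgt d_gt0.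
  exists e => // x x1 /andP[/andP[a0 a1] a2]; apply: eP => //.
  split; first by split; rewrite /= leNgt.
  move: a2; rewrite /A2; case: ifPn => //= _.
  by rewrite -leNgt -opprD normrN opprK.
have T : laplace_sum Phi (h N) (fun x => ~~ A0 x && ~~ A1 x && ~~ A2 x) (F N) N @[N --> \oo] --> 0.
  apply: (@laplace_sum_tail R _ h _ F K e) => // N N0.
  by rewrite /h divff// gt_eqF// sqrtr_gt0 ltr0n.
pose W2 N := if odd p then 0 else laplace_sum Phi (h N) (fun x => `|x - m| < d) (F N) N.
pose L0 := 1 / (stirling_constant R * Num.sqrt (1 - 0 ^+ 2)) *
    \int[mu]_z (expR (- (2^-1 * (1 * z) ^+ 2)) * phi0 z).
pose Lm := lam / (stirling_constant R * Num.sqrt (1 - m ^+ 2)) *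
    \int[mu]_z (expR (- (k * (lam * z) ^+ 2)) * phim z).
have cW2 : W2 N @[N --> \oo] --> (if odd p then 0 else Lm).
  by rewrite /W2; case: ifP => _; [exact: cvg_cst|exact: Wm].
have WT : laplace_sum Phi (h N) (fun x => `|x - 0| < d) (F N) N +
    (laplace_sum Phi (h N) (fun x => `|x - m| < d) (F N) N + W2 N) +
    laplace_sum Phi (h N) (fun x => ~~ A0 x && ~~ A1 x && ~~ A2 x) (F N) N
    @[N --> \oo] --> L0 + (Lm + (if odd p then 0 else Lm)) + 0.
  by apply: cvgD; [apply: cvgD; [exact: W0|apply: cvgD; [exact: Wm|exact: cW2]]|exact: T].
have L0E : L0 = (stirling_constant R)^-1 * \int[mu]_z (expR (- (2^-1 * z ^+ 2)) * phi0 z).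
  rewrite /L0 expr0n subr0 sqrtr1 mulr1 div1r; congr (_ * _).
  by apply: eq_Rintegral => z _; rewrite mul1r.
have LmE : Lm + (if odd p then 0 else Lm) = (if odd p then 1 else 2) * Lm.
  by case: ifP => _; ring.
move: WT; rewrite addr0 L0E LmE.
apply: cvg_trans; apply: near_eq_cvg; near=> N.
have N0 : (0 < N)%N by near: N; exists 1%N.
rewrite [RHS](laplace_sum_split _ _ _ A0) [X in _ = _ + X](laplace_sum_split _ _ _ A1).
rewrite [X in _ = _ + (_ + X)](laplace_sum_split _ _ _ A2) /= !addrA.
congr (_ + _ + _ + _).
- apply: eq_laplace_sum => x; rewrite /A0 /A1; case: (ltP `|x - m| d) => //=.
    rewrite subr0 andbT => xm; apply/esym; rewrite -leNgt.
    have : m <= `|x| + `|x - m|.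
      rewrite -[X in X <= _](ger0_norm (ltW m0)) -[X in `|X|](subKr x m) (le_trans (ler_normB _ _))//.
    lra.
  by rewrite andbF.
- rewrite /W2; case: ifPn => [podd|peven].
    rewrite /laplace_sum big_pred0 ?mulr0// => j.
    by rewrite /A2 podd andbF.
  have PhiN x : Phi (- x) = Phi x.
    by rewrite /Phi exprNn -signr_odd (negbTE peven) expr0 mul1r.
  rewrite (laplace_sum_reflect _ _ N0 PhiN (Feven peven N)).
  apply: eq_laplace_sum => x; rewrite /A0 /A1 /A2 peven/=.
  case: (ltP `|- x - m| d) => [xm|]; last by rewrite andbF.
  rewrite andbT; apply/esym; rewrite -!leNgt subr0.
  move: xm; rewrite ltr_norml => /andP[x1 x2].
  have xn : x < 0 by lra.
  by rewrite ltr0_norm// ltr0_norm ?subr_lt0; [lra|lra].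
Unshelve. all: by end_near. Qed.

End laplace_totals.

(** * Reflection of Lebesgue integrals *)

Section reflection.
Context (R : realType).
Local Notation mR := (measurableTypeR R).
Notation mu := (@lebesgue_measure R).

Definition reflect (z : mR) : mR := - z.

Let measurable_reflect : measurable_fun [set: mR] reflect.
Proof. exact: measurable_funN. Qed.

HB.instance Definition _ := isMeasurableFun.Build _ _ mR mR reflect measurable_reflect.

Lemma lebesgue_measure_reflect (A : set mR) : measurable A ->
  lebesgue_measure A = pushforward lebesgue_measure reflect A.
Proof.
apply: lebesgue_measure_unique => _ [[a b] _ <-] /=.
rewrite /pushforward.
have -> : (reflect @^-1` `]a, b]%classic = `[(- b), (- a)[%classic).
  by apply/seteqP; split=> z /=; rewrite /reflect !in_itv/=; lra.
rewrite !lebesgue_measure_itv/= !lte_fin ltrN2; case: ifP => // _.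
by rewrite -!EFinD; congr _%:E; ring.
Qed.

Lemma Rintegral_reflect (g : R -> R) : mu.-integrable setT (EFin \o g) ->
  \int[mu]_z g (- z) = \int[mu]_z g z.
Proof.
move=> ig; rewrite /Rintegral; congr fine.
have mg : measurable_fun [set: mR] (EFin \o g) by have /integrableP[] := ig.
have ig' : lebesgue_measure.-integrable [set: mR] ((EFin \o g) \o reflect).
  apply/integrableP; split; first exact: measurableT_comp.
  have /integrableP[_] := ig; apply: le_lt_trans.
  rewrite [leRHS](eq_measure_integral (pushforward lebesgue_measure reflect)); last first.
    by move=> A mA _; exact: lebesgue_measure_reflect.
  rewrite ge0_integral_pushforward//.
  by apply: measurableT_comp.
rewrite [RHS](eq_measure_integral (pushforward lebesgue_measure reflect)); last first.
  by move=> A mA _; exact: lebesgue_measure_reflect.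
by rewrite [RHS]integral_pushforward.
Qed.

End reflection.

(** * Test functions and Gaussian expectations *)

Section test_functions.
Context (R : realType).
Implicit Types (f : \bar R -> R).
Notation mu := (@lebesgue_measure R).

Lemma continuous_comp_EFin f : continuous f -> continuous (f \o EFin).
Proof.
move=> cf y; apply: (cvg_comp EFin f); last exact: cf.
by apply: cvg_EFin; [exact: nearW|exact: cvg_id].
Qed.

(** Continuity at the two infinite points bounds the function outside a segment,
and the extreme value theorem bounds it on that segment. *)
Lemma continuous_ereal_bounded f : continuous f -> exists K, forall y, `|f y| <= K.
Proof.
move=> cf.
have near1 (l : \bar R) : \forall y \near l, `|f y| <= `|f l| + 1.
  have /cvgrPdist_le/(_ _ ltr01) := cf l; apply: filterS => y fy.
  by rewrite -lerBlDl (le_trans (lerB_dist _ _))// distrC.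
have [a [_ ha]] := near1 +oo%E; have [b [_ hb]] := near1 -oo%E.
pose A := `|a| + `|b| + 1.
have A0 : - A <= A by rewrite ge0_cp// /A !addr_ge0.
have [c _ hc] : exists2 c, c \in `[(- A), A] & forall t, t \in `[(- A), A] -> `|f t%:E| <= `|f c%:E|.
  apply: EVT_max => //; apply: continuous_subspaceT => x.
  by apply: (@cvg_norm _ R^o); exact: continuous_comp_EFin.
have [n1 n2 n3] := And3 (normr_ge0 (f c%:E)) (normr_ge0 (f +oo%E)) (normr_ge0 (f -oo%E)).
exists (`|f c%:E| + (`|f +oo%E| + 1) + (`|f -oo%E| + 1)).
move=> [y| |]; last 2 first.
- by move: n1 n2 n3; lra.
- by move: n1 n2 n3; lra.
have [yA|yA] := boolP (y \in `[(- A), A]).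
  by have := hc _ yA; lra.
move: yA; rewrite in_itv/= negb_and -!ltNge => /orP[yA|yA].
  have : `|f y%:E| <= `|f -oo%E| + 1.
    apply: hb; rewrite lte_fin (lt_le_trans yA)//.
    by rewrite /A; have := ler_norm (- b); rewrite normrN; have := normr_ge0 a; lra.
  lra.
have : `|f y%:E| <= `|f +oo%E| + 1.
  apply: ha; rewrite lte_fin (le_lt_trans _ yA)//.
  by rewrite /A; have := ler_norm a; have := normr_ge0 b; lra.
lra.
Qed.

(** Measurable sets of extended reals are Borel sets of reals up to the two infinite
points, so the restriction to the reals decides. *)
Lemma continuous_ereal_measurable f : continuous f -> measurable_fun setT f.
Proof.
move=> cf _ Y mY; rewrite setTI.
exists ((f \o EFin) @^-1` Y).
  have := continuous_measurable_fun (continuous_comp_EFin cf).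
  by move=> /(_ measurableT Y mY); rewrite setTI.
exists ((f @^-1` Y) `&` [set -oo%E; +oo%E]).
  have [pY|pY] := pselect (Y (f +oo%E)); have [nY|nY] := pselect (Y (f -oo%E)).
  - rewrite (_ : _ `&` _ = [set -oo%E; +oo%E]); first exact: ps_inftys.
    by apply/seteqP; split=> [y [] //|y [->|->]]; split=> //; [left|right].
  - rewrite (_ : _ `&` _ = [set +oo%E]); first exact: ps_pinfty.
    by apply/seteqP; split=> [y [/= + [yE|//]]|y ->]; [rewrite yE|split=> //; right].
  - rewrite (_ : _ `&` _ = [set -oo%E]); first exact: ps_ninfty.
    by apply/seteqP; split=> [y [/= + [//|yE]]|y ->]; [rewrite yE|split=> //; left].
  - rewrite (_ : _ `&` _ = set0); first exact: ps_infty0.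
    by apply/seteqP; split=> // y [/= + [yE|yE]]; rewrite yE.
apply/seteqP; split=> [y [[r /= fr <-]//|[]//]|[r| |] fy].
- by left; exists r.
- by right; split=> //; right.
- by right; split=> //; left.
Qed.

Section bounded_integrals.
Variables (d : measure_display) (T : measurableType d) (f : T -> R) (K : R).
Hypotheses (mf : measurable_fun setT f) (fK : forall y, `|f y| <= K).

Lemma bounded_integrable (m : {measure set T -> \bar R}) :
  (m setT < +oo)%E -> m.-integrable setT (EFin \o f).
Proof.
move=> mT; apply: measurable_bounded_integrable => //.
exists K; split; first exact: num_real.
by move=> x Kx y _ /=; rewrite (le_trans (fK y))// ltW.
Qed.

Lemma integral_mscale_bounded (m : {measure set T -> \bar R}) (k : {nonneg R}) (r : R) :
  (m setT < +oo)%E -> (\int[m]_y (f y)%:E = r%:E)%E ->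
  (\int[mscale k m]_y (f y)%:E = (k%:num * r)%:E)%E.
Proof.
move=> mT mr; have im := bounded_integrable mT.
have mf' : measurable_fun setT (EFin \o f) by exact/measurable_EFinP.
have mp := measurable_funepos mf'; have mn := measurable_funeneg mf'.
rewrite EFinM -mr [LHS]integralE [X in _ = (_ * X)%E]integralE.
rewrite (ge0_integral_mscale m measurableT k mp)//.
rewrite (ge0_integral_mscale m measurableT k mn)//.
rewrite [RHS]muleBr//; apply: fin_num_adde_defr.
exact: integrable_pos_fin_num.
Qed.

Lemma integral_measure_add_bounded (m1 m2 : {measure set T -> \bar R}) (r1 r2 : R) :
  (m1 setT < +oo)%E -> (m2 setT < +oo)%E ->
  (\int[m1]_y (f y)%:E = r1%:E)%E -> (\int[m2]_y (f y)%:E = r2%:E)%E ->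
  (\int[measure_add m1 m2]_y (f y)%:E = (r1 + r2)%:E)%E.
Proof.
move=> m1T m2T m1r m2r.
rewrite integral_measure_add//; [|exact: bounded_integrable..].
by rewrite m1r m2r.
Qed.

Lemma measure_add_setT_lt (m1 m2 : {measure set T -> \bar R}) :
  (m1 setT < +oo)%E -> (m2 setT < +oo)%E -> (measure_add m1 m2 setT < +oo)%E.
Proof. by move=> m1T m2T; rewrite measure_addE lte_add_pinfty. Qed.

Lemma mscale_setT_lt (m : {measure set T -> \bar R}) (k : {nonneg R}) :
  (m setT < +oo)%E -> (mscale k m setT < +oo)%E.
Proof. by move=> mT; rewrite /mscale/= lte_mul_pinfty. Qed.

End bounded_integrals.

Lemma integrable_mul_bounded (e g : R -> R) K : mu.-integrable setT (EFin \o e) ->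
  measurable_fun setT g -> (forall z, `|g z| <= K) ->
  mu.-integrable setT (EFin \o (fun z => e z * g z)).
Proof.
move=> ie mg gK; have bg : [bounded g z | z in setT].
  exists K; split; first exact: num_real.
  by move=> x Kx z _ /=; rewrite (le_trans (gK z))// ltW.
have := integrableMl measurableT ie mg bg.
by congr (_.-integrable _ _); apply/funext => z /=; rewrite EFinM.
Qed.

(** The normal law is given by its values on sets; its Radon-Nikodym derivative is
identified with the density by comparing integrals over all measurable sets. *)
Lemma integral_normal_prob (s : R) (g : measurableTypeR R -> R) (K : R) :
  measurable_fun setT g -> (forall y, `|g y| <= K) ->
  (\int[normal_prob 0 s]_z (g z)%:E = (\int[mu]_z (normal_pdf 0 s z * g z))%:E)%E.
Proof.
move=> mg gK.
have mg' : measurable_fun setT (EFin \o g) by exact/measurable_EFinP.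
have dom := @normal_prob_dominates R 0 s.
have ig : (normal_prob 0 s).-integrable setT (EFin \o g).
  have P1 : (normal_prob (0:R) s setT < +oo)%E by rewrite probability_setT ltry.
  exact: (bounded_integrable mg gK P1).
rewrite -(Radon_Nikodym_change_of_variables dom measurableT ig).
have aeE : ae_eq mu setT (Radon_Nikodym (charge_of_finite_measure (normal_prob 0 s)) mu)
    (fun z => (normal_pdf 0 s z)%:E).
  apply: integral_ae_eq => //.
  - exact: Radon_Nikodym_integrable.
  - by apply/measurable_EFinP; exact: measurable_normal_pdf.
  - by move=> E _ mE; rewrite -Radon_Nikodym_integral.
have ipg : mu.-integrable setT (fun z => (normal_pdf 0 s z * g z)%:E).
  exact: (integrable_mul_bounded (integrable_normal_pdf 0 s) mg gK).
rewrite /Rintegral fineK ?integrable_fin_num//.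
apply: ae_eq_integral => //.
- exact: emeasurable_funM.
- by have /integrableP[] := ipg.
- case: aeE => A [mA A0 AE]; exists A; split=> // z nz; apply: AE => Hz; apply: nz => zT.
  by rewrite (Hz zT) muleC EFinM.
Qed.

Lemma gaussian_expectation (b : R) (g : measurableTypeR R -> R) (K : R) : 0 < b ->
  measurable_fun setT g -> (forall y, `|g y| <= K) ->
  (\int[normal_prob 0 (Num.sqrt (2 * b)^-1)]_z (g z)%:E =
   ((Num.sqrt (pi / b))^-1 * \int[mu]_z (expR (- (b * z ^+ 2)) * g z))%:E)%E.
Proof.
move=> b0 mg gK; rewrite (integral_normal_prob _ mg gK); congr _%:E.
have s0 : Num.sqrt (pi / b) != 0 by rewrite gt_eqF// sqrtr_gt0 divr_gt0// pi_gt0.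
have ie := integrable_mul_bounded (integrable_expR_sqr b0) mg gK.
rewrite -RintegralZl//; apply: eq_Rintegral => z _.
by rewrite (expR_sqr_normal_pdf _ b0) -mulrA mulKf.
Qed.

End test_functions.

(** * Gibbs expectations with two or three maximizers *)

Section expectations.
Context (R : realType).
Notation mu := (@lebesgue_measure R).
Implicit Types (p N : nat) (beta m lam K : R).

(** The normalization of Laplace sums cancels, so the scale [h] may be chosen
freely. *)
Lemma cw_expectation_laplace N p beta (h : R) (f : R -> R) :
  (0 < p)%N -> (0 < N)%N -> 0 < h ->
  \sum_(x : N.-tuple bool) ising_pmf (@curie_weiss_tensor R N p) p beta x *
     f (magnetization R x) =
  laplace_sum (fun t => beta * t ^+ p) h predT f N /
  laplace_sum (fun t => beta * t ^+ p) h predT (fun=> 1) N.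
Proof.
move=> p0 N0 h0; rewrite sum_curie_weiss_pmf// /laplace_sum.
under [in X in _ = _ / (_ * X)]eq_bigr do rewrite mulr1.
have s0 : (Num.sqrt N%:R * h)^-1 != 0.
  by rewrite invr_eq0 gt_eqF// mulr_gt0// sqrtr_gt0 ltr0n.
by rewrite -mulf_div divff// mul1r.
Qed.

(** The numerator and the denominator are both given by [laplace_total_two_wells].
The window at 0 carries mass proportional to the square root of 2 pi, the one at
[m] the same times c^(-1/2) with c = (m^2 - 1) g''(m): the factor 1 - m^2 is
the variance of a spin of mean m and g'' measures the width of the well. This ratio
determines the mixture weight. *)
Lemma two_well_expectation p beta m lam K (F : nat -> R -> R) (phi0 phim : R -> R) :
  let k := - derive1n 2 (cw_free_energy beta p) m / 2 in
  let b := k * lam ^+ 2 in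
  let a := cw_alpha beta p m in
  (3 <= p)%N -> 0 < m < 1 -> m * artanh m = p%:R * entropyI m ->
  beta = entropyI m / m ^+ p ->
  derive1n 2 (cw_free_energy beta p) m < 0 -> 0 < lam ->
  (forall N x, `|F N x| <= K) -> (~~ odd p -> forall N x, F N (- x) = F N x) ->
  measurable_fun setT phi0 -> measurable_fun setT phim ->
  {ae mu, forall z, forall zs : nat -> R, zs N @[N --> \oo] --> z ->
    F N ((Num.sqrt N%:R)^-1 * zs N) @[N --> \oo] --> phi0 z} ->
  {ae mu, forall z, forall zs : nat -> R, zs N @[N --> \oo] --> z ->
    F N (m + lam * (Num.sqrt N%:R)^-1 * zs N) @[N --> \oo] --> phim z} ->
  \sum_(x : N.-tuple bool) ising_pmf (@curie_weiss_tensor R N p) p beta x *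
     F N (magnetization R x) @[N --> \oo] -->
  a * ((Num.sqrt (pi / 2^-1))^-1 * \int[mu]_z (expR (- (2^-1 * z ^+ 2)) * phi0 z)) +
  (1 - a) * ((Num.sqrt (pi / b))^-1 * \int[mu]_z (expR (- (b * z ^+ 2)) * phim z)).
Proof.
move=> k b a p3 m01 mE betaE g2 lam0 FK Feven mphi0 mphim F0 Fm.
have /andP[m0 m1] := m01.
have k0 : 0 < k by rewrite divr_gt0// oppr_gt0.
have b0 : 0 < b by rewrite mulr_gt0// exprn_gt0.
have kb z : k * (lam * z) ^+ 2 = b * z ^+ 2 by rewrite /b; ring.
have num := laplace_total_two_wells p3 m01 mE betaE g2 lam0 FK Feven mphi0 mphim F0 Fm.
have den : laplace_sum (fun t => beta * t ^+ p) (Num.sqrt N%:R)^-1 predT (fun=> 1) N @[N --> \oo] -->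
  (stirling_constant R)^-1 * \int[mu]_z (expR (- (2^-1 * z ^+ 2)) * 1) +
  (if odd p then 1 else 2) * (lam / (stirling_constant R * Num.sqrt (1 - m ^+ 2)) *
    \int[mu]_z (expR (- (k * (lam * z) ^+ 2)) * 1)).
  apply: (@laplace_total_two_wells R p beta m lam 1 (fun _ _ => 1) (fun=> 1) (fun=> 1)) => //.
  - by move=> _ _; rewrite normr1.
  - by apply: aeW => z zs _; exact: cvg_cst.
  - by apply: aeW => z zs _; exact: cvg_cst.
set n : R := if odd p then 1 else 2 in num den.
have n0 : 0 < n by rewrite /n; case: ifP.
set I0 := \int[mu]_z (expR (- (2^-1 * z ^+ 2)) * phi0 z) in num *.
have ImE : \int[mu]_z (expR (- (k * (lam * z) ^+ 2)) * phim z) =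
   \int[mu]_z (expR (- (b * z ^+ 2)) * phim z).
  by apply: eq_Rintegral => z _; rewrite kb.
move: num; rewrite -/k ImE; set Im := \int[mu]_z _ => num.
pose s0 := Num.sqrt (pi / 2^-1) : R.
pose sm := Num.sqrt (pi / b).
have half0 : 0 < 2^-1 :> R by rewrite invr_gt0.
have s0E : \int[mu]_z (expR (- (2^-1 * z ^+ 2)) * 1) = s0.
  by rewrite /s0 -(Rintegral_expR_sqr half0); apply: eq_Rintegral => z _; rewrite mulr1.
have smE : \int[mu]_z (expR (- (k * (lam * z) ^+ 2)) * 1) = sm.
  by rewrite /sm -(Rintegral_expR_sqr b0); apply: eq_Rintegral => z _; rewrite mulr1 kb.
rewrite s0E smE in den.
have pi0 := pi_gt0 R.
have s00 : 0 < s0 by rewrite sqrtr_gt0 divr_gt0.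
have sm0 : 0 < sm by rewrite sqrtr_gt0 divr_gt0.
have m2 : 0 < 1 - m ^+ 2 by nra.
have q0 : 0 < Num.sqrt (1 - m ^+ 2) by rewrite sqrtr_gt0.
have C0 := stirling_constant_gt0 R.
set q := Num.sqrt (1 - m ^+ 2) in num den q0.
set C := stirling_constant R in num den C0.
set c := (m ^+ 2 - 1) * derive1n 2 (cw_free_energy beta p) m.
have cE : c = (1 - m ^+ 2) * (2 * k) by rewrite /c /k; field.
have c0 : 0 < c by rewrite cE mulr_gt0// mulr_gt0.
(* The relative mass of the well at m; the parameter lam cancels with the
   one in b. *)
have wE : lam / q * sm = c `^ (- 2^-1) * s0.
  rewrite powRN powR12_sqrt ?(ltW c0)//.
  have lam2 : lam = Num.sqrt (lam ^+ 2) by rewrite sqrtr_sqr gtr0_norm.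
  rewrite [in LHS]lam2 /sm /q /s0 -!sqrtrV ?(ltW c0) ?(ltW m2)//.
  rewrite -!sqrtrM ?sqr_ge0 ?mulr_ge0 ?invr_ge0 ?sqr_ge0 ?(ltW c0) ?(ltW m2)//.
  - congr Num.sqrt; rewrite cE /b; field.
    by rewrite !gt_eqF.
  - exact: ltW.
  - exact: ltW.
have aE : a = 1 / (1 + n * c `^ (- 2^-1)).
  by rewrite /a /cw_alpha -/c /n; case: ifP => _; rewrite ?mul1r.
have w0 : 0 < c `^ (- 2^-1) by rewrite powR_gt0.
move: wE aE w0; set w := c `^ (- 2^-1) => wE aE w0.
have ratio : laplace_sum (fun t => beta * t ^+ p) (Num.sqrt N%:R)^-1 predT (F N) N /
    laplace_sum (fun t => beta * t ^+ p) (Num.sqrt N%:R)^-1 predT (fun=> 1) N @[N --> \oo] -->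
    a * (s0^-1 * I0) + (1 - a) * (sm^-1 * Im).
  have -> : a * (s0^-1 * I0) + (1 - a) * (sm^-1 * Im) =
    (C^-1 * I0 + n * (lam / (C * q) * Im)) / (C^-1 * s0 + n * (lam / (C * q) * sm)).
    have E1 : lam / (C * q) * sm = w * s0 / C.
      by rewrite -wE; field; rewrite !gt_eqF.
    have E2 : lam / (C * q) * Im = w * s0 / C * (sm^-1 * Im).
      by rewrite -E1; field; rewrite !gt_eqF.
    rewrite E1 E2 aE; field.
    by rewrite !gt_eqF// ?addr_gt0 ?mulr_gt0.
  apply: cvgM; first exact: num.
  apply: cvgV den; rewrite gt_eqF// addr_gt0 ?mulr_gt0 ?invr_gt0 ?divr_gt0//.
  by rewrite mulr_gt0.
apply: cvg_trans ratio; apply: near_eq_cvg; near=> N.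
have N0 : (0 < N)%N by near: N; exists 1%N.
by rewrite -cw_expectation_laplace ?invr_gt0 ?sqrtr_gt0 ?ltr0n// (leq_trans _ p3).
Unshelve. all: by end_near. Qed.

End expectations.

(** * The estimate near the maximizers *)

Section estimator_limits.
Context (R : realType).
Implicit Types (p N : nat) (beta m lam t z : R) (zs : nat -> R).

Lemma mple_of_mean_fin p t : -1 < t < 1 -> t != 0 -> 0 < t ^+ p ->
  mple_of_mean p t = (artanh t / (p%:R * t ^+ p.-1))%:E.
Proof. by move=> t1 t0 tp; rewrite /mple_of_mean (negbTE t0) ltr_norml t1 tp. Qed.

Lemma mple_of_mean_odd p t : odd p -> t < 0 -> mple_of_mean p t = +oo%E.
Proof.
move=> podd t0; rewrite /mple_of_mean lt_eqF//.
have tp : t ^+ p <= 0.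
  by rewrite -[t]opprK exprNn -signr_odd podd expr1 mulN1r oppr_le0 exprn_ge0// oppr_ge0 ltW.
by rewrite [0 < t ^+ p]ltNge tp andbF.
Qed.

(** Hence, for even [p], the observables are even and the two outer wells behave
alike. *)
Lemma mple_of_mean_even p t : ~~ odd p -> (1 < p)%N -> mple_of_mean p (- t) = mple_of_mean p t.
Proof.
move=> peven p1; rewrite /mple_of_mean oppr_eq0 normrN.
have -> : (- t) ^+ p = t ^+ p by rewrite exprNn -signr_odd (negbTE peven) expr0 mul1r.
have -> : (- t) ^+ p.-1 = - t ^+ p.-1.
  have podd : odd p.-1 by move: p1 peven; case: (p) => //= q _; rewrite negbK.
  by rewrite exprNn -signr_odd podd expr1 mulN1r.
by rewrite artanhN mulrN invrN mulrNN.
Qed.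

Let sq N : R := Num.sqrt N%:R.

Let sq_gt0 N : (0 < N)%N -> 0 < sq N.
Proof. by move=> N0; rewrite /sq sqrtr_gt0 ltr0n. Qed.

Let cvg_sq : sq N @[N --> \oo] --> +oo.
Proof. by apply: cvg_sqrt_pinfty; exact: cvgr_idn. Qed.

Let cvg_sqV : (sq N)^-1 @[N --> \oo] --> 0.
Proof.
apply/gtr0_cvgV0; last exact: cvg_sq.
by near=> N; apply: sq_gt0; near: N; exists 1%N.
Unshelve. all: by end_near. Qed.

Lemma cvg_scaled_mean zs z : zs N @[N --> \oo] --> z ->
  (Num.sqrt N%:R)^-1 * zs N @[N --> \oo] --> 0.
Proof. by move=> zsz; rewrite -(mul0r z); apply: cvgM => //; exact: cvg_sqV. Qed.

Lemma natr_powR_half p N : (2 <= p)%N -> (0 < N)%N ->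
  N%:R `^ (1 - p%:R / 2) = (Num.sqrt N%:R ^+ (p - 2))^-1 :> R.
Proof.
move=> p2 N0; rewrite -powR12_sqrt// -powR_mulrn ?powR_ge0// -powRrM -powRN natrB//.
by congr (_ `^ _); field.
Qed.

Section near_zero.
Variables (p : nat) (z : R) (zs : nat -> R).
Hypotheses (p3 : (3 <= p)%N) (z0 : z != 0) (zsz : zs N @[N --> \oo] --> z).
Let x N := (Num.sqrt N%:R)^-1 * zs N.

Let near_small : \forall N \near \oo, -1 < x N < 1.
Proof.
have /cvgr0_norm_lt/(_ _ ltr01) := cvg_scaled_mean zsz.
by apply: filterS => N; rewrite -ltr_norml.
Qed.

Let near_sign : \forall N \near \oo, 0 < zs N * z.
Proof.
have zz : zs N * z @[N --> \oo] --> z * z by apply: cvgM => //; exact: cvg_cst.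
move/cvgrPdist_lt: zz => /(_ (z * z)); rewrite -expr2 exprn_even_gt0//= => /(_ z0).
by apply: filterS => N; rewrite ltr_norml => /andP[]; lra.
Qed.

Lemma near_mple_odd : odd p -> z < 0 ->
  \forall N \near \oo, mple_of_mean p (x N) = +oo%E.
Proof.
move=> podd zn; near=> N; apply: mple_of_mean_odd => //.
have N0 : (0 < N)%N by near: N; exists 1%N.
have zsn : zs N < 0.
  have : 0 < zs N * z by near: N; exact: near_sign.
  by rewrite nmulr_lgt0.
by rewrite /x pmulr_rlt0// invr_gt0 sq_gt0.
Unshelve. all: by end_near. Qed.

(** For odd [p] the estimate is finite only at positive magnetization, hence the
hypothesis on the sign of the limit [z]. *)
Lemma near_mple_fin : (odd p -> 0 < z) ->
  \forall N \near \oo, x N != 0 /\ 0 < x N ^+ (p - 2) /\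
    mple_of_mean p (x N) = (artanh (x N) / (p%:R * x N ^+ p.-1))%:E.
Proof.
move=> zp; near=> N.
have N0 : (0 < N)%N by near: N; exists 1%N.
have zsn : 0 < zs N * z by near: N; exact: near_sign.
have x1 : -1 < x N < 1 by near: N; exact: near_small.
have s0 : 0 < (Num.sqrt N%:R)^-1 :> R by rewrite invr_gt0 sq_gt0.
have zs0 : zs N != 0 by apply/eqP => e; move: zsn; rewrite e mul0r ltxx.
have x0 : x N != 0 by rewrite /x mulf_neq0// gt_eqF.
have pow q : odd q = odd p -> 0 < x N ^+ q.
  move=> qp; have [podd|peven] := boolP (odd p).
    rewrite exprn_gt0// /x mulr_gt0//.
    by move: zsn; rewrite pmulr_lgt0// zp.
  by rewrite exprn_even_gt0 ?x0 ?orbT// qp.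
split=> //; split; first by apply: pow; rewrite oddB// ?addbF// ltnW.
by apply: mple_of_mean_fin => //; exact: pow.
Unshelve. all: by end_near. Qed.

(** Near 0 one has artanh x = x + o(x), so the estimate is equivalent to
1 / (p x^(p - 2)), of order N^(p / 2 - 1). *)
Lemma cvg_mple_zero_inv_pow : (odd p -> 0 < z) ->
  ((Num.sqrt N%:R ^+ (p - 2))^-1 * (artanh (x N) / (p%:R * x N ^+ p.-1)))
     @[N --> \oo] --> 1 / (p%:R * z ^+ (p - 2)).
Proof.
move=> zp; have [E E1 EE] := artanh_linear R.
have p0 : p%:R != 0 :> R by rewrite pnatr_eq0 -lt0n (leq_trans _ p3).
have cE : E (x N) @[N --> \oo] --> (1 : R).
  exact: (cvg_comp _ E (cvg_scaled_mean zsz) E1).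
have : E (x N) / (p%:R * zs N ^+ (p - 2)) @[N --> \oo] --> 1 / (p%:R * z ^+ (p - 2)).
  apply: cvgM => //; apply: cvgV; first by rewrite mulf_neq0// expf_neq0.
  apply: cvgMr; apply: (cvg_comp zs (fun y : R => y ^+ (p - 2)) zsz).
  exact: exprn_continuous.
apply: cvg_trans; apply: near_eq_cvg; near=> N.
have N0 : (0 < N)%N by near: N; exists 1%N.
have [x0 _] : x N != 0 /\ 0 < x N ^+ (p - 2) /\
    mple_of_mean p (x N) = (artanh (x N) / (p%:R * x N ^+ p.-1))%:E.
  by near: N; exact: near_mple_fin.
have s0 : Num.sqrt N%:R != 0 :> R by rewrite gt_eqF// sq_gt0.
have zs0 : zs N != 0 by apply: contra x0 => /eqP e; rewrite /x e mulr0.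
rewrite EE.
have pE : p.-1 = (p - 2).+1 by case: (p) p3 => [|[|q]]// _; rewrite subn2.
rewrite pE exprS.
have -> : x N ^+ (p - 2) = (Num.sqrt N%:R ^+ (p - 2))^-1 * zs N ^+ (p - 2).
  by rewrite /x exprMn exprVn.
by field; rewrite x0 p0 !expf_neq0.
Unshelve. all: by end_near. Qed.

(** The same equivalent tends to infinity, so on this window the estimate leaves
every neighbourhood of [beta]. *)
Lemma cvg_mple_zero_pinfty beta : (odd p -> 0 < z) ->
  Num.sqrt N%:R * (artanh (x N) / (p%:R * x N ^+ p.-1) - beta) @[N --> \oo] --> +oo.
Proof.
move=> zp; have [E E1 EE] := artanh_linear R.
have p0 : 0 < p%:R :> R by rewrite ltr0n (leq_trans _ p3).
have cE : E (x N) @[N --> \oo] --> (1 : R).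
  exact: (cvg_comp _ E (cvg_scaled_mean zsz) E1).
have cP : (beta + 1) * (p%:R * x N ^+ (p - 2)) @[N --> \oo] --> 0.
  have -> : (0 : R) = (beta + 1) * (p%:R * 0 ^+ (p - 2)).
    by rewrite expr0n subn_eq0 leqNgt p3 !mulr0.
  apply: cvgMr; apply: cvgMr.
  apply: (cvg_comp x (fun y : R => y ^+ (p - 2)) (cvg_scaled_mean zsz)).
  exact: exprn_continuous.
have h1 : (2^-1 : R) < 1 by lra.
have h0 : (0 : R) < 2^-1 by lra.
apply/cvgryPge => A; near=> N.
have N0 : (0 < N)%N by near: N; exists 1%N.
have [x0 [xp _]] : x N != 0 /\ 0 < x N ^+ (p - 2) /\
    mple_of_mean p (x N) = (artanh (x N) / (p%:R * x N ^+ p.-1))%:E.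
  by near: N; exact: near_mple_fin.
have E2 : 2^-1 <= E (x N).
  by near: N; exact: (cvgr_ge _ cE _ h1).
have P2 : (beta + 1) * (p%:R * x N ^+ (p - 2)) <= 2^-1.
  by near: N; exact: (cvgr_le _ cP _ h0).
have r1 : beta + 1 <= artanh (x N) / (p%:R * x N ^+ p.-1).
  have pE : p.-1 = (p - 2).+1 by case: (p) p3 => [|[|q]]// _; rewrite subn2.
  have -> : artanh (x N) / (p%:R * x N ^+ p.-1) = E (x N) / (p%:R * x N ^+ (p - 2)).
    rewrite EE pE exprS; field.
    by rewrite x0 !gt_eqF.
  by rewrite ler_pdivlMr ?mulr_gt0// (le_trans P2 E2).
have s1 : A <= Num.sqrt N%:R.
  near: N; move/cvgryPge: cvg_sq; exact.
have s0 := sq_gt0 N0.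
rewrite (le_trans s1)// ler_peMr ?(ltW s0)//; lra.
Unshelve. all: by end_near. Qed.

End near_zero.

Section near_critical.
Variables (p : nat) (beta m lam z : R) (zs : nat -> R).
Hypotheses (p3 : (3 <= p)%N) (m01 : 0 < m < 1).
Hypothesis betaE : beta * p%:R * m ^+ p.-1 = artanh m.
Hypothesis zsz : zs N @[N --> \oo] --> z.
Let x N := m + lam * (Num.sqrt N%:R)^-1 * zs N.
Let B t : R := artanh t / (p%:R * t ^+ p.-1).

Let cvg_x : x N @[N --> \oo] --> m.
Proof.
rewrite -[X in _ --> X]addr0 -[X in _ --> _ + X](mulr0 lam).
apply: cvgD; first exact: cvg_cst.
have : lam * ((Num.sqrt N%:R)^-1 * zs N) @[N --> \oo] --> lam * 0.
  by apply: cvgMr; exact: cvg_scaled_mean zsz.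
by under eq_fun do rewrite mulrA.
Qed.

Lemma near_mple_critical :
  \forall N \near \oo, mple_of_mean p (x N) = (B (x N))%:E.
Proof.
have /andP[m0 m1] := m01; near=> N.
have x0 : 0 < x N by near: N; exact: (cvgr_gt _ cvg_x _ m0).
have x1 : x N < 1 by near: N; exact: (cvgr_lt _ cvg_x _ m1).
apply: mple_of_mean_fin; last exact: exprn_gt0.
  by rewrite x1 andbT; lra.
by rewrite gt_eqF.
Unshelve. all: by end_near. Qed.

(** The delta method. At a critical point the curve of parameters
artanh t / (p t^(p - 1)) for which [t] is stationary has slope proportional
to the second derivative of the free energy. *)
Lemma is_derive_mple : is_derive m 1 B
  (- derive1n 2 (cw_free_energy beta p) m / (p%:R * m ^+ p.-1)).
Proof.
have /andP[m0 m1] := m01; have m11 : -1 < m < 1 by lra.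
have p0 : p%:R != 0 :> R by rewrite pnatr_eq0 -lt0n (leq_trans _ p3).
have mp q : m ^+ q != 0 by rewrite expf_neq0// gt_eqF.
have d1 := is_deriveZ p%:R (is_derive_expn p.-1 m).
have n0 : (p%:R \*: (fun t : R => t ^+ p.-1)) m != 0 by rewrite /GRing.scale/= mulf_neq0.
have d := is_deriveM (is_derive_artanh m11) (is_deriveV n0 d1).
apply: (is_derive_eq d); rewrite derive1n2_free_energy// /= /GRing.scale/= -betaE.
have pE : p.-1 = (p.-2).+1 by case: (p) p3 => [|[|q]].
rewrite [m ^+ p.-1](_ : _ = m ^+ p.-2 * m); last by rewrite {1}pE exprSr.
have m2 : 1 - m ^+ 2 != 0 by rewrite gt_eqF//; nra.
by field; rewrite m2 p0 mp gt_eqF.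
Qed.

Lemma mple_critical : B m = beta.
Proof.
have /andP[m0 m1] := m01; rewrite /B -betaE; field.
by rewrite expf_neq0 ?gt_eqF//= ltr0n (leq_trans _ p3).
Qed.

Lemma cvg_mple_critical : lam * (- derive1n 2 (cw_free_energy beta p) m / (p%:R * m ^+ p.-1)) = 1 ->
  Num.sqrt N%:R * (B (x N) - beta) @[N --> \oo] --> z.
Proof.
move=> lamE; have /is_derive1_caratheodory[E [EE Ec E1]] := is_derive_mple.
have cE : E (x N) @[N --> \oo] --> E m by exact: (cvg_comp x E cvg_x Ec).
have : E (x N) * lam * zs N @[N --> \oo] --> E m * lam * z.
  by apply: cvgM => //; apply: cvgM => //; exact: cvg_cst.
rewrite E1 [_ * lam]mulrC lamE mul1r.
apply: cvg_trans; apply: near_eq_cvg; near=> N.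
have N0 : (0 < N)%N by near: N; exists 1%N.
have s0 : Num.sqrt N%:R != 0 :> R by rewrite gt_eqF// sq_gt0.
rewrite -{1}mple_critical EE /x; field.
by [].
Unshelve. all: by end_near. Qed.

Lemma cvg_mple_critical0 :
  (Num.sqrt N%:R ^+ (p - 2))^-1 * B (x N) @[N --> \oo] --> 0.
Proof.
have /is_derive1_caratheodory[E [EE Ec E1]] := is_derive_mple.
have cB : B (x N) @[N --> \oo] --> B m.
  have cE : E (x N) @[N --> \oo] --> E m by exact: (cvg_comp x E cvg_x Ec).
  have : B m + E (x N) * (x N - m) @[N --> \oo] --> B m + E m * (m - m).
    apply: cvgD; first exact: cvg_cst.
    by apply: cvgM => //; apply: cvgB; [exact: cvg_x|exact: cvg_cst].
  rewrite subrr mulr0 addr0; apply: cvg_trans; apply: near_eq_cvg; near=> N.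
  by rewrite -EE addrC subrK.
have cs : ((Num.sqrt N%:R)^-1) ^+ (p - 2) @[N --> \oo] --> (0 : R) ^+ (p - 2).
  apply: (cvg_comp _ (fun y : R => y ^+ (p - 2)) cvg_sqV); exact: exprn_continuous.
have := cvgM cs cB; rewrite expr0n subn_eq0 leqNgt p3/= mul0r => H.
by under eq_fun do rewrite -exprVn; exact: H.
Unshelve. all: by end_near. Qed.

End near_critical.

(** With pair interactions the estimate is artanh x / (2 x) = 1/2 + x^2 / 6 + o(x^2),
and x is of order N^(-1/4): the limit is a square, which produces the support
on the half-line and the two points plus and minus the square root of 6 t. *)
Lemma cvg_mple_quartic (h : nat -> R) z zs : zs N @[N --> \oo] --> z -> z != 0 ->
  (forall N, (0 < N)%N -> 0 < h N) -> h N @[N --> \oo] --> 0 ->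
  (forall N, (0 < N)%N -> N%:R * h N ^+ 4 = 1) ->
  exists2 u : nat -> R, u N @[N --> \oo] --> z ^+ 2 / 6 &
   \forall N \near \oo,
    ((Num.sqrt N%:R)%:E * (mple_of_mean 2 (h N * zs N) - (2^-1)%:E))%E = (u N)%:E.
Proof.
move=> zsz z0 h0 hc hq; have [E E3 EE] := artanh_cubic R.
have cx : h N * zs N @[N --> \oo] --> 0 by rewrite -(mul0r z); exact: cvgM.
exists (fun N => E (h N * zs N) / 2 * zs N ^+ 2).
  have -> : z ^+ 2 / 6 = 3^-1 / 2 * z ^+ 2 by field.
  apply: cvgM; first by apply: cvgMl; exact: (cvg_comp _ E cx E3).
  by apply: (cvg_comp zs (fun y : R => y ^+ 2) zsz); exact: exprn_continuous.
near=> N.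
have N0 : (0 < N)%N by near: N; exists 1%N.
have x1 : -1 < h N * zs N < 1.
  by rewrite -ltr_norml; near: N; move/cvgr0_norm_lt: cx; apply.
have zs0 : zs N != 0.
  by near: N; exact: (cvgr_neq0 _ zsz z0).
have hN := h0 _ N0.
have x0 : h N * zs N != 0 by rewrite mulf_neq0// gt_eqF.
rewrite mple_of_mean_fin//; last by rewrite exprn_even_gt0.
rewrite -EFinB -EFinM; congr _%:E; rewrite /= expr1.
have sE : Num.sqrt N%:R = (h N ^+ 2)^-1 :> R.
  have h2 : 0 < h N ^+ 2 by rewrite exprn_gt0.
  have -> : N%:R = (h N ^+ 2)^-1 ^+ 2 :> R.
    rewrite -[LHS]mulr1 -[X in _ * X](@divff _ (h N ^+ 4)); last by rewrite gt_eqF// exprn_gt0.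
    by rewrite mulrA hq// mul1r -exprVn -exprVn -exprM.
  by rewrite sqrtr_sqr gtr0_norm// invr_gt0.
have -> : artanh (h N * zs N) = h N * zs N + E (h N * zs N) * (h N * zs N) ^+ 3.
  by rewrite -EE; ring.
by rewrite sE; field; rewrite zs0 gt_eqF.
Unshelve. all: by end_near. Qed.

End estimator_limits.

(** * The positive maximizer at the threshold *)

Section critical_point.
Context (R : realType).
Implicit Types (p N : nat) (beta m t : R).

(** Multiplied by [m], the second derivative is
(p - 1) artanh m - m / (1 - m^2). By the equation for [m] its sign is minus that
of the derivative of x artanh x / entropyI x, settled in [artanh_sqr_lt]. *)
Lemma critical_curvature_lt0 p m : (3 <= p)%N -> 0 < m < 1 ->
  m * artanh m = p%:R * entropyI m ->
  derive1n 2 (cw_free_energy (entropyI m / m ^+ p) p) m < 0.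
Proof.
move=> p3 m01 mE; have /andP[m0 m1] := m01.
have p0 : (0 < p)%N by exact: leq_trans p3.
have slope := critical_slope p0 m01 mE.
have Im := entropyI_gt0 m01.
have m2 : 0 < 1 - m ^+ 2 by nra.
rewrite derive1n2_free_energy; last lra.
rewrite -(pmulr_rlt0 _ m0) mulrBr.
have -> : m * (entropyI m / m ^+ p * p%:R * (p.-1%:R * m ^+ p.-2)) = p.-1%:R * artanh m.
  rewrite -slope; have -> : m ^+ p.-1 = m * m ^+ p.-2.
    by case: (p) p3 => [|[|q]]// _; rewrite exprS.
  by ring.
have := artanh_sqr_lt m01; rewrite mE -mulrA [entropyI m * _]mulrC mulrA ltr_pM2r//.
have -> : p%:R = p.-1%:R + 1 :> R by rewrite natr1 prednK.
by lra.
Qed.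

(** The value at [m] is 0, and [entropyI_gt_critical] gives strict inequality at
all other positive points; negative points reduce to positive ones since
[entropyI] is even. *)
Lemma critical_maximizer p m : (3 <= p)%N -> 0 < m < 1 ->
  m * artanh m = p%:R * entropyI m ->
  is_global_maximizer (entropyI m / m ^+ p) p m /\
  forall t, 0 < t -> is_global_maximizer (entropyI m / m ^+ p) p t -> t = m.
Proof.
move=> p3 m01 mE; have /andP[m0 m1] := m01.
have p0 : (0 < p)%N by exact: leq_trans p3.
have Im := entropyI_gt0 m01.
set beta := entropyI m / m ^+ p.
have beta0 : 0 < beta by rewrite divr_gt0// exprn_gt0.
have gm : cw_free_energy beta p m = 0.
  by rewrite /cw_free_energy /beta divfK ?subrr// expf_neq0// gt_eqF.
have le0 t : 0 <= t <= 1 -> beta * t ^+ p <= entropyI t.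
  move=> /andP[t0 t1]; have [->|tn0] := eqVneq t 0.
    by rewrite expr0n gtn_eqF// mulr0 entropyI0.
  have [->|tm] := eqVneq t m; first by rewrite /beta divfK// expf_neq0// gt_eqF.
  by apply/ltW/entropyI_gt_critical => //; rewrite lt0r tn0 t0.
split.
  split; first lra.
  move=> t /andP[t0 t1]; rewrite gm /cw_free_energy subr_le0.
  have [tn|tp] := leP 0 t; first by apply: le0; rewrite tn.
  have Nt : 0 <= - t <= 1 by lra.
  rewrite -entropyIN (le_trans _ (le0 _ Nt))// ler_wpM2l// ?(ltW beta0)//.
  rewrite (le_trans (ler_norm _))// normrX ltr0_norm//.
move=> t t0 [/andP[_ t1] tmax]; apply/eqP/negPn/negP => tm.
have t01 : 0 < t <= 1 by rewrite t0.
have := entropyI_gt_critical p0 m01 mE t01 tm; rewrite -/beta => lt.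
have m11 : -1 <= m <= 1 by lra.
by have := tmax m m11; rewrite gm /cw_free_energy; lra.
Qed.

End critical_point.

(** * Limit laws for interactions of order at least three *)

Section limit_laws.
Context (R : realType).
Notation mu := (@lebesgue_measure R).
Implicit Types (f : \bar R -> R).

(** Expectation under the centred normal law of variance [(2 * b)^-1]. *)
Definition gaussian_mean (b : R) (g : R -> R) : R :=
  (Num.sqrt (pi / b))^-1 * \int[mu]_z (expR (- (b * z ^+ 2)) * g z).

Lemma gaussian_mean_cst (b r : R) : 0 < b -> gaussian_mean b (fun=> r) = r.
Proof.
move=> b0; rewrite /gaussian_mean RintegralZr//; last exact: integrable_expR_sqr.
by rewrite Rintegral_expR_sqr// mulKf// gt_eqF// sqrtr_gt0 divr_gt0// pi_gt0.
Qed.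

Lemma integral_distribution_bounded (P : probability (measurableTypeR R) R)
    (X : {RV P >-> \bar R}) f K (r : R) :
  continuous f -> (forall y, `|f y| <= K) ->
  (\int[P]_z (f (X z))%:E = r%:E)%E -> (\int[distribution P X]_y (f y)%:E = r%:E)%E.
Proof.
move=> cf fK <-.
have mf := continuous_ereal_measurable cf.
rewrite integral_distribution//.
- exact/measurable_EFinP.
- have mfX : measurable_fun setT (f \o X) by exact: measurableT_comp.
  have PT : (P setT < +oo)%E by rewrite probability_setT ltry.
  exact: (bounded_integrable mfX (fun z => fK (X z)) PT).
Qed.

(** Reduces weak convergence to limits of finite sums, each integral against the
limit measure being computed separately. *)
Lemma cw_cvg_in_distribution p (beta : R) (X : forall N, N.-tuple bool -> \bar R)
    (Y : nat -> R -> \bar R) (nu : {measure set (\bar R) -> \bar R}) :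
  (forall N x, (0 < N)%N -> X N x = Y N (magnetization R x)) ->
  (forall f K, continuous f -> (forall y, `|f y| <= K) -> exists2 l : R,
    \sum_(x : N.-tuple bool) ising_pmf (@curie_weiss_tensor R N p) p beta x *
      f (Y N (magnetization R x)) @[N --> \oo] --> l &
    (\int[nu]_y (f y)%:E = l%:E)%E) ->
  @cvg_in_distribution R _ (fun N => N.-tuple bool) (fun N => curie_weiss_prob N p beta) X nu.
Proof.
move=> XY lim f cf; have [K fK] := continuous_ereal_bounded cf.
have [l sl ->] := lim f K cf fK.
have : (\sum_(x : N.-tuple bool) ising_pmf (@curie_weiss_tensor R N p) p beta x *
      f (Y N (magnetization R x)))%:E @[N --> \oo] --> l%:E.
  by apply: cvg_EFin; [exact: nearW|exact: sl].
apply: cvg_trans; apply: near_eq_cvg; near=> N.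
have N0 : (0 < N)%N by near: N; exists 1%N.
rewrite integral_ising_prob; congr _%:E; apply: eq_bigr => x _.
by rewrite XY.
Unshelve. all: by end_near. Qed.

Lemma ae_neq0 (P : R -> Prop) : (forall z, z != 0 -> P z) -> {ae mu, forall z, P z}.
Proof.
move=> PP; exists [set 0]; split => //; first exact: lebesgue_measure_set1.
by move=> z /= nP; apply: contrapT => /eqP z0; apply: nP; exact: PP.
Qed.

Lemma integral_mixture f K (m1 m2 : {measure set (\bar R) -> \bar R}) (k1 k2 : {nonneg R}) r1 r2 :
  measurable_fun setT f -> (forall y, `|f y| <= K) ->
  (m1 setT < +oo)%E -> (m2 setT < +oo)%E ->
  (\int[m1]_y (f y)%:E = r1%:E)%E -> (\int[m2]_y (f y)%:E = r2%:E)%E ->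
  (\int[measure_add (mscale k1 m1) (mscale k2 m2)]_y (f y)%:E =
    (k1%:num * r1 + k2%:num * r2)%:E)%E.
Proof.
move=> mf fK m1T m2T i1 i2.
exact: (integral_measure_add_bounded mf fK (mscale_setT_lt k1 m1T) (mscale_setT_lt k2 m2T)
  (integral_mscale_bounded mf fK k1 m1T i1) (integral_mscale_bounded mf fK k2 m2T i2)).
Qed.

Lemma integral_mixture3 f K (m1 m2 m3 : {measure set (\bar R) -> \bar R})
    (k1 k2 k3 : {nonneg R}) r1 r2 r3 :
  measurable_fun setT f -> (forall y, `|f y| <= K) ->
  (m1 setT < +oo)%E -> (m2 setT < +oo)%E -> (m3 setT < +oo)%E ->
  (\int[m1]_y (f y)%:E = r1%:E)%E -> (\int[m2]_y (f y)%:E = r2%:E)%E ->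
  (\int[m3]_y (f y)%:E = r3%:E)%E ->
  (\int[measure_add (measure_add (mscale k1 m1) (mscale k2 m2)) (mscale k3 m3)]_y
    (f y)%:E = (k1%:num * r1 + k2%:num * r2 + k3%:num * r3)%:E)%E.
Proof.
move=> mf fK m1T m2T m3T i1 i2 i3.
exact: (integral_measure_add_bounded mf fK
  (measure_add_setT_lt (mscale_setT_lt k1 m1T) (mscale_setT_lt k2 m2T))
  (mscale_setT_lt k3 m3T) (integral_mixture k1 k2 mf fK m1T m2T i1 i2)
  (integral_mscale_bounded mf fK k3 m3T i3)).
Qed.

Section wells.
Variables (p : nat) (m : R).
Hypotheses (p3 : (3 <= p)%N) (m01 : 0 < m < 1) (mE : m * artanh m = p%:R * entropyI m).
Let beta := entropyI m / m ^+ p.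
Let g2 := derive1n 2 (cw_free_energy beta p) m.
Let a := cw_alpha beta p m.
(** The inverse of the slope of the estimate at [m]: in the rescaled coordinate
the fluctuation of the estimate is the coordinate itself, and the Gaussian of
the well at [m] is already the limit law. *)
Let lam := (- g2 / (p%:R * m ^+ p.-1))^-1.
Let b := - g2 / 2 * lam ^+ 2.

Let m0 : 0 < m. Proof. by case/andP: m01. Qed.
Let p0 : (0 < p)%N. Proof. exact: leq_trans p3. Qed.
Let p1 : (1 < p)%N. Proof. exact: leq_trans p3. Qed.
Let pR : 0 < p%:R :> R. Proof. by rewrite ltr0n. Qed.
Let g2_lt0 : g2 < 0. Proof. exact: critical_curvature_lt0. Qed.
Let slope : beta * p%:R * m ^+ p.-1 = artanh m. Proof. exact: critical_slope. Qed.
Let mp : 0 < m ^+ p.-1. Proof. exact: exprn_gt0. Qed.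
Let lam0 : 0 < lam.
Proof. by rewrite invr_gt0 divr_gt0 ?oppr_gt0// mulr_gt0. Qed.
Let b0 : 0 < b.
Proof. by rewrite mulr_gt0 ?exprn_gt0// divr_gt0// oppr_gt0. Qed.
Let lamE : lam * (- g2 / (p%:R * m ^+ p.-1)) = 1.
Proof. by rewrite mulVf// gt_eqF// divr_gt0 ?oppr_gt0// mulr_gt0. Qed.

Let varE : - (g2 / (p%:R ^+ 2 * m ^+ (2 * p - 2))) = (2 * b)^-1.
Proof.
have -> : m ^+ (2 * p - 2) = (m ^+ p.-1) ^+ 2.
  by rewrite -exprM; congr (_ ^+ _); rewrite -subn1 mulnBl mul1n mulnC.
rewrite /b /lam; field.
by rewrite (gt_eqF mp) (gt_eqF pR) (lt_eqF g2_lt0).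
Qed.

Let well_expectation (F : nat -> R -> R) K (phi0 phim : R -> R) :
  (forall N x, `|F N x| <= K) -> (~~ odd p -> forall N x, F N (- x) = F N x) ->
  measurable_fun setT phi0 -> measurable_fun setT phim ->
  (forall z, z != 0 -> forall zs : nat -> R, zs N @[N --> \oo] --> z ->
    F N ((Num.sqrt N%:R)^-1 * zs N) @[N --> \oo] --> phi0 z) ->
  (forall z (zs : nat -> R), zs N @[N --> \oo] --> z ->
    F N (m + lam * (Num.sqrt N%:R)^-1 * zs N) @[N --> \oo] --> phim z) ->
  \sum_(x : N.-tuple bool) ising_pmf (@curie_weiss_tensor R N p) p beta x *
     F N (magnetization R x) @[N --> \oo] -->
  a * gaussian_mean 2^-1 phi0 + (1 - a) * gaussian_mean b phim.
Proof.
move=> FK Fe mphi0 mphim F0 Fm.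
apply: (two_well_expectation p3 m01 mE erefl g2_lt0 lam0 FK Fe mphi0 mphim).
- exact: ae_neq0.
- by apply: aeW.
Qed.

Let cvg_test_function f (l : \bar R) (u : nat -> \bar R) : continuous f ->
  u N @[N --> \oo] --> l -> f (u N) @[N --> \oo] --> f l.
Proof. by move=> cf ul; exact: (cvg_comp u f ul (cf l)). Qed.

Let half_gt0 : 0 < 2^-1 :> R. Proof. by rewrite invr_gt0. Qed.

Let integral_normal01 (g : measurableTypeR R -> R) K : measurable_fun setT g ->
  (forall z, `|g z| <= K) ->
  (\int[normal_prob 0 1]_z (g z)%:E = (gaussian_mean 2^-1 g)%:E)%E.
Proof.
move=> mg gK; have e : Num.sqrt (2 * 2^-1)^-1 = 1 :> R by rewrite divff// invr1 sqrtr1.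
by have := gaussian_expectation half_gt0 mg gK; rewrite e.
Qed.

(** Around [m] the delta method gives the normal law; around 0 the estimate
diverges. For even [p] and [z < 0] it is large and finite, for odd [p] it is
infinite already for finite [N]. *)
Lemma cvg_mple_scaled :
  @cvg_in_distribution R _ (fun N => N.-tuple bool) (fun N => curie_weiss_prob N p beta)
    (fun N x => ((Num.sqrt N%:R)%:E * (curie_weiss_mpl R p x - beta%:E))%E)
    (measure_add
      (mscale (1 - (cw_alpha01 beta p m)%:num)%:nng
        (normal_bar 0 (- (g2 / (p%:R ^+ 2 * m ^+ (2 * p - 2))))))
      (mscale (cw_alpha01 beta p m)%:num%:nng \d_(+oo%E : \bar R))).
Proof.
apply: (cw_cvg_in_distribution (Y := fun N t =>
    ((Num.sqrt N%:R)%:E * (mple_of_mean p t - beta%:E))%E)).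
  by move=> N x N0; rewrite curie_weiss_mplE.
move=> f K cf fK; have mf := continuous_ereal_measurable cf.
have mfE : measurable_fun setT (f \o EFin).
  exact: continuous_measurable_fun (continuous_comp_EFin cf).
have lE : (1 - a) * gaussian_mean b (f \o EFin) + a * f +oo%E =
    a * gaussian_mean 2^-1 (fun=> f +oo%E) + (1 - a) * gaussian_mean b (f \o EFin).
  by rewrite gaussian_mean_cst// addrC.
exists ((1 - a) * gaussian_mean b (f \o EFin) + a * f +oo%E).
  rewrite lE.
  apply: (@well_expectation (fun N t => f ((Num.sqrt N%:R)%:E * (mple_of_mean p t - beta%:E))%E)
    K (fun=> f +oo%E) (f \o EFin)) => //.
  - by move=> peven N x; rewrite mple_of_mean_even.
  - move=> z z0 zs zsz; apply: cvg_test_function => //.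
    have [/andP[podd zn]|nz] := boolP (odd p && (z < 0)).
      apply: cvg_near_cst.
      near=> N; have N0 : (0 < N)%N by near: N; exists 1%N.
      have -> : mple_of_mean p ((Num.sqrt N%:R)^-1 * zs N) = +oo%E.
        by near: N; exact: (near_mple_odd z0 zsz podd zn).
      by rewrite addye// gt0_muley// lte_fin sqrtr_gt0 ltr0n.
    have zp : odd p -> 0 < z.
      by move=> podd; move: nz; rewrite podd/= -leNgt lt0r z0.
    have /cvgeryP := cvg_mple_zero_pinfty p3 z0 zsz beta zp.
    apply: cvg_trans; apply: near_eq_cvg; near=> N.
    have [_ [_ ->]] : (Num.sqrt N%:R)^-1 * zs N != 0 /\ 0 < ((Num.sqrt N%:R)^-1 * zs N) ^+ (p - 2) /\
      mple_of_mean p ((Num.sqrt N%:R)^-1 * zs N) =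
        (artanh ((Num.sqrt N%:R)^-1 * zs N) / (p%:R * ((Num.sqrt N%:R)^-1 * zs N) ^+ p.-1))%:E.
      by near: N; exact: (near_mple_fin p3 z0 zsz zp).
    by rewrite -EFinB -EFinM.
  - move=> z zs zsz; apply: (cvg_test_function (l := z%:E)) => //.
    have : (Num.sqrt N%:R * (artanh (m + lam * (Num.sqrt N%:R)^-1 * zs N) /
        (p%:R * (m + lam * (Num.sqrt N%:R)^-1 * zs N) ^+ p.-1) - beta))%:E @[N --> \oo] --> z%:E.
      by apply: cvg_EFin; [exact: nearW|exact: (cvg_mple_critical p3 m01 slope zsz lamE)].
    apply: cvg_trans; apply: near_eq_cvg; near=> N.
    have -> : mple_of_mean p (m + lam * (Num.sqrt N%:R)^-1 * zs N) =
      (artanh (m + lam * (Num.sqrt N%:R)^-1 * zs N) /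
        (p%:R * (m + lam * (Num.sqrt N%:R)^-1 * zs N) ^+ p.-1))%:E.
      by near: N; exact: (near_mple_critical p lam m01 zsz).
    by rewrite -EFinB -EFinM.
have nbar : (\int[normal_bar 0 (- (g2 / (p%:R ^+ 2 * m ^+ (2 * p - 2))))]_y (f y)%:E =
    (gaussian_mean b (f \o EFin))%:E)%E.
  apply: (integral_distribution_bounded cf fK).
  rewrite varE; exact: (gaussian_expectation b0 mfE (fun z => fK z%:E)).
have dirac_lt (l : \bar R) : (\d_l [set: \bar R] < +oo :> \bar R)%E by rewrite diracT ltry.
have nbar_lt : (normal_bar 0 (- (g2 / (p%:R ^+ 2 * m ^+ (2 * p - 2)))) [set: \bar R] < +oo)%E.
  by rewrite probability_setT ltry.
have dint : (\int[\d_(+oo%E : \bar R)]_y (f y)%:E = (f +oo%E)%:E)%E.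
  by rewrite integral_dirac ?diracT ?mul1e//; exact/measurable_EFinP.
by rewrite (integral_mixture _ _ mf fK nbar_lt (dirac_lt +oo%E) nbar dint).
Unshelve. all: by end_near. Qed.

Let Y N t : \bar R := ((N%:R `^ (1 - p%:R / 2))%:E * mple_of_mean p t)%E.

Let Y_critical f (z : R) (zs : nat -> R) : continuous f -> zs N @[N --> \oo] --> z ->
  f (Y N (m + lam * (Num.sqrt N%:R)^-1 * zs N)) @[N --> \oo] --> f 0%E.
Proof.
move=> cf zsz; apply: cvg_test_function => //.
have : ((Num.sqrt N%:R ^+ (p - 2))^-1 * (artanh (m + lam * (Num.sqrt N%:R)^-1 * zs N) /
    (p%:R * (m + lam * (Num.sqrt N%:R)^-1 * zs N) ^+ p.-1)))%:E @[N --> \oo] --> (0 : R)%:E.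
  by apply: cvg_EFin; [exact: nearW|exact: (cvg_mple_critical0 lam p3 m01 slope zsz)].
apply: cvg_trans; apply: near_eq_cvg; near=> N.
have N0 : (0 < N)%N by near: N; exists 1%N.
rewrite /Y natr_powR_half//.
have -> : mple_of_mean p (m + lam * (Num.sqrt N%:R)^-1 * zs N) =
    (artanh (m + lam * (Num.sqrt N%:R)^-1 * zs N) /
    (p%:R * (m + lam * (Num.sqrt N%:R)^-1 * zs N) ^+ p.-1))%:E.
  by near: N; exact: (near_mple_critical p lam m01 zsz).
by rewrite -EFinM.
Unshelve. all: by end_near. Qed.

Let Y_zero f (z : R) (zs : nat -> R) : continuous f -> z != 0 -> zs N @[N --> \oo] --> z ->
  (odd p -> 0 < z) ->
  f (Y N ((Num.sqrt N%:R)^-1 * zs N)) @[N --> \oo] --> f (1 / (p%:R * z ^+ (p - 2)))%:E.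
Proof.
move=> cf z0 zsz zp; apply: cvg_test_function => //.
have : ((Num.sqrt N%:R ^+ (p - 2))^-1 * (artanh ((Num.sqrt N%:R)^-1 * zs N) /
    (p%:R * ((Num.sqrt N%:R)^-1 * zs N) ^+ p.-1)))%:E @[N --> \oo] -->
    (1 / (p%:R * z ^+ (p - 2)))%:E.
  by apply: cvg_EFin; [exact: nearW|exact: (cvg_mple_zero_inv_pow p3 z0 zsz zp)].
apply: cvg_trans; apply: near_eq_cvg; near=> N.
have N0 : (0 < N)%N by near: N; exists 1%N.
rewrite /Y natr_powR_half//.
have [_ [_ ->]] : (Num.sqrt N%:R)^-1 * zs N != 0 /\ 0 < ((Num.sqrt N%:R)^-1 * zs N) ^+ (p - 2) /\
    mple_of_mean p ((Num.sqrt N%:R)^-1 * zs N) =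
      (artanh ((Num.sqrt N%:R)^-1 * zs N) / (p%:R * ((Num.sqrt N%:R)^-1 * zs N) ^+ p.-1))%:E.
  by near: N; exact: (near_mple_fin p3 z0 zsz zp).
by rewrite -EFinM.
Unshelve. all: by end_near. Qed.

Let dirac_lt (l : \bar R) : (\d_l [set: \bar R] < +oo :> \bar R)%E.
Proof. by rewrite diracT ltry. Qed.

Let integral_dirac_EFin f (l : \bar R) : measurable_fun setT f ->
  (\int[\d_l]_y (f y)%:E = (f l)%:E)%E.
Proof. by move=> mf; rewrite integral_dirac ?diracT ?mul1e//; exact/measurable_EFinP. Qed.

(** The scaling N^(1 - p / 2) makes the estimate converge on the window at 0 and
sends it to 0 at [m], where it stays bounded. *)
Lemma cvg_mple_pow_even : ~~ odd p ->
  @cvg_in_distribution R _ (fun N => N.-tuple bool) (fun N => curie_weiss_prob N p beta)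
    (fun N x => ((N%:R `^ (1 - p%:R / 2))%:E * curie_weiss_mpl R p x)%E)
    (measure_add
      (mscale (cw_alpha01 beta p m)%:num%:nng (inv_pow_normal R p))
      (mscale (1 - (cw_alpha01 beta p m)%:num)%:nng \d_(0%E : \bar R))).
Proof.
move=> peven; apply: (cw_cvg_in_distribution (Y := Y)).
  by move=> N x N0; rewrite curie_weiss_mplE.
move=> f K cf fK; have mf := continuous_ereal_measurable cf.
have mg : measurable_fun setT (f \o @inv_pow R p) by exact: measurableT_comp.
exists (a * gaussian_mean 2^-1 (f \o @inv_pow R p) + (1 - a) * f 0%E).
  rewrite -[X in _ + _ * X](gaussian_mean_cst (f 0%E) b0).
  apply: (@well_expectation (fun N t => f (Y N t)) K (f \o @inv_pow R p) (fun=> f 0%E)) => //.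
  - by move=> _ N x; rewrite /Y mple_of_mean_even.
  - move=> z z0 zs zsz; apply: (Y_zero cf z0 zsz) => podd.
    by move: peven; rewrite podd.
  - by move=> z zs zsz; exact: (Y_critical cf zsz).
have ninv : (\int[inv_pow_normal R p]_y (f y)%:E = (gaussian_mean 2^-1 (f \o @inv_pow R p))%:E)%E.
  apply: (integral_distribution_bounded cf fK).
  exact: (integral_normal01 mg (fun z => fK (inv_pow p z))).
have ninv_lt : (inv_pow_normal R p [set: \bar R] < +oo)%E by rewrite probability_setT ltry.
by rewrite (integral_mixture _ _ mf fK ninv_lt (dirac_lt 0%E) ninv (integral_dirac_EFin 0%E mf)).
Qed.

(** A symmetric law splits evenly between the half-lines. The value at the null
point 0 is the average of both sides, so that [phi z + phi (- z)] is constant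
plus [g z] without exception. *)
Lemma gaussian_mean_half_line (g : R -> R) K (r : R) : measurable_fun setT g ->
  (forall z, `|g z| <= K) -> `|r| <= K -> (forall z, g (- z) = g z) ->
  let phi z := if z < 0 then r else if z == 0 then (r + g 0) / 2 else g z in
  measurable_fun setT phi /\
  gaussian_mean 2^-1 phi = gaussian_mean 2^-1 g / 2 + r / 2.
Proof.
move=> mg gK rK gN phi.
have mphi : measurable_fun setT phi.
  apply: measurable_fun_ifT => //.
    by apply: measurable_fun_ltr => //.
  apply: measurable_fun_ifT => //.
  exact: measurable_fun_eqr.
have phiK z : `|phi z| <= K.
  rewrite /phi; case: ifP => _ //; case: ifP => _ //.
  rewrite normrM [X in _ * X]ger0_norm ?invr_ge0// ler_pdivrMr// mulrDr mulr1.
  by rewrite (le_trans (ler_normD _ _))// lerD.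
split=> //; rewrite /gaussian_mean.
pose e z : R := expR (- (2^-1 * z ^+ 2)).
have ie (k : R -> R) (C : R) : measurable_fun setT k -> (forall z, `|k z| <= C) ->
    mu.-integrable setT (EFin \o (fun z => e z * k z)).
  exact: (integrable_mul_bounded (integrable_expR_sqr half_gt0)).
have iphi := ie phi K mphi phiK; have ig := ie g K mg gK.
have ir : mu.-integrable setT (EFin \o (fun z => e z * r)).
  by apply: (ie (fun=> r) K).
have reflE : \int[mu]_z (e z * phi (- z)) = \int[mu]_z (e z * phi z).
  rewrite -(Rintegral_reflect iphi); apply: eq_Rintegral => z _.
  by rewrite /e sqrrN.
have iphiN : mu.-integrable setT (EFin \o (fun z => e z * phi (- z))).
  apply: (ie (fun z => phi (- z)) K) => //.
  by apply: measurableT_comp => //; exact: measurable_funN.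
have dbl : 2 * \int[mu]_z (e z * phi z) = \int[mu]_z (e z * g z) + \int[mu]_z (e z * r).
  rewrite mulr_natl mulr2n -[X in X + _]reflE -!RintegralD//.
  apply: eq_Rintegral => z _; rewrite /phi oppr_lt0 oppr_eq0 gN.
  by have [zn|zp|->] := ltgtP z 0; field.
have rE : \int[mu]_z (e z * r) = Num.sqrt (pi / 2^-1) * r.
  by rewrite RintegralZr ?Rintegral_expR_sqr//; exact: integrable_expR_sqr.
have s0 : Num.sqrt (pi / 2^-1) != 0 :> R.
  by rewrite gt_eqF// sqrtr_gt0 divr_gt0// pi_gt0.
have -> : \int[mu]_z (e z * phi z) = (\int[mu]_z (e z * g z) + Num.sqrt (pi / 2^-1) * r) / 2.
  by rewrite -rE -dbl mulrAC divff ?mul1r// mulrC.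
by move: s0; set s := Num.sqrt _ => s0; rewrite -/e; field.
Qed.

(** As for even [p], except that on the window at 0 the negative half of the
Gaussian gives an infinite estimate. *)
Lemma cvg_mple_pow_odd : odd p ->
  @cvg_in_distribution R _ (fun N => N.-tuple bool) (fun N => curie_weiss_prob N p beta)
    (fun N x => ((N%:R `^ (1 - p%:R / 2))%:E * curie_weiss_mpl R p x)%E)
    (measure_add
      (measure_add
        (mscale ((cw_alpha01 beta p m)%:num / 2)%:nng (inv_abs_pow_normal R p))
        (mscale ((cw_alpha01 beta p m)%:num / 2)%:nng \d_(+oo%E : \bar R)))
      (mscale (1 - (cw_alpha01 beta p m)%:num)%:nng \d_(0%E : \bar R))).
Proof.
move=> podd; apply: (cw_cvg_in_distribution (Y := Y)).
  by move=> N x N0; rewrite curie_weiss_mplE.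
move=> f K cf fK; have mf := continuous_ereal_measurable cf.
pose g := f \o @inv_abs_pow R p.
have mg : measurable_fun setT g by exact: measurableT_comp.
have gN z : g (- z) = g z by rewrite /g/= /inv_abs_pow normrN.
pose phi z := if z < 0 then f +oo%E else if z == 0 then (f +oo%E + g 0) / 2 else g z.
have [mphi phiE] := gaussian_mean_half_line mg (fun z => fK _) (fK +oo%E) gN.
exists ((a / 2 * gaussian_mean 2^-1 g + a / 2 * f +oo%E) + (1 - a) * f 0%E).
  have -> : (a / 2 * gaussian_mean 2^-1 g + a / 2 * f +oo%E) + (1 - a) * f 0%E =
      a * gaussian_mean 2^-1 phi + (1 - a) * gaussian_mean b (fun=> f 0%E).
    by rewrite gaussian_mean_cst// phiE; ring.
  apply: (@well_expectation (fun N t => f (Y N t)) K phi (fun=> f 0%E)) => //.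
  - by rewrite podd.
  - move=> z z0 zs zsz; rewrite /phi; have [zn|zp] := ltP z 0.
      apply: cvg_test_function => //; apply: cvg_near_cst.
      near=> N; have N0 : (0 < N)%N by near: N; exists 1%N.
      have xE : mple_of_mean p ((Num.sqrt N%:R)^-1 * zs N) = +oo%E.
        by near: N; exact: (near_mple_odd z0 zsz podd zn).
      by rewrite /Y xE gt0_muley// lte_fin powR_gt0// ltr0n.
    have {}zp : 0 < z by rewrite lt0r z0.
    rewrite (negbTE z0) /g/= /inv_abs_pow gtr0_norm//.
    exact: (Y_zero cf z0 zsz).
  - by move=> z zs zsz; exact: (Y_critical cf zsz).
have ninv : (\int[inv_abs_pow_normal R p]_y (f y)%:E = (gaussian_mean 2^-1 g)%:E)%E.
  apply: (integral_distribution_bounded cf fK).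
  exact: (integral_normal01 mg (fun z => fK (inv_abs_pow p z))).
have ninv_lt : (inv_abs_pow_normal R p [set: \bar R] < +oo)%E by rewrite probability_setT ltry.
by rewrite (integral_mixture3 _ _ _ mf fK ninv_lt (dirac_lt +oo%E) (dirac_lt 0%E)
  ninv (integral_dirac_EFin +oo%E mf) (integral_dirac_EFin 0%E mf)).
Unshelve. all: by end_near. Qed.

End wells.
End limit_laws.

(** * The quartic limit law for pair interactions *)

Section quartic_law.
Context (R : realType).
Notation mu := (@lebesgue_measure R).
Implicit Types (t z : R).

(** Dominated by a Gaussian, since z^4 is at least 2 z^2 - 1. *)
Lemma integrable_quartic_density : mu.-integrable setT (EFin \o @quartic_density R).
Proof.
have b0 : 0 < 6^-1 :> R by rewrite invr_gt0 ltr0n.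
apply: (@le_integrable _ _ _ mu setT measurableT _
  (fun z => ((expR 12^-1)%:E * (expR (- (6^-1 * z ^+ 2)))%:E)%E)).
- apply/measurable_EFinP; rewrite /quartic_density.
  apply: measurableT_comp => //; apply: measurableT_comp => //.
  by apply: measurable_funM => //; exact: measurable_funX.
- move=> z _; rewrite -EFinM /= lee_fin -expRD !ger0_norm ?expR_ge0// ler_expR.
  have := sqr_ge0 (z ^+ 2 - 1).
  by rewrite (_ : (z ^+ 2 - 1) ^+ 2 = z ^+ 4 - 2 * z ^+ 2 + 1); [lra|ring].
- apply: integrableZl => //; exact: integrable_expR_sqr.
Qed.

Lemma Rintegral_quartic_gt0 : 0 < \int[mu]_z quartic_density z.
Proof.
have iq := integrable_quartic_density.
pose D : set (measurableTypeR R) := [set` `[0, 1]].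
have mD : measurable D by exact: measurable_itv.
have muD : mu D = 1%E by rewrite lebesgue_measure_itv/= lte_fin ltr01 sube0.
apply: (@lt_le_trans _ _ (\int[mu]_(z in D) expR (- 12^-1))).
  by rewrite Rintegral_cst// mulr_gt0 ?expR_gt0// [X in fine X]muD.
apply: (@le_trans _ _ (\int[mu]_(z in D) quartic_density z)).
  apply: le_Rintegral => //.
  - apply: measurable_bounded_integrable => //; first by rewrite [X in (X < _)%E]muD ltry.
    exact: bounded_cst.
  - by apply: (integrableS measurableT) iq.
  - move=> z; rewrite /D/= in_itv/= => /andP[z0 z1].
    by rewrite ler_expR lerN2 ler_piMl// exprn_ile1.
rewrite Rintegral_mkcond; apply: le_Rintegral => //.
- have iD : mu.-integrable D (EFin \o @quartic_density R).
    by apply: (integrableS measurableT) iq.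
  have := (integrable_mkcond _ mD).1 iD.
  by congr (_.-integrable _ _); apply/funext => z; rewrite /= /patch; case: ifP.
- by move=> z _; rewrite /patch; case: ifP => _ //; exact: expR_ge0.
Qed.

Lemma quartic_cdfB (s t : R) : s <= t -> quartic_cdf t - quartic_cdf s =
  (\int[mu]_z (quartic_density z * (if s < z <= t then 1 else 0))) /
  \int[mu]_z quartic_density z.
Proof.
move=> st; rewrite /quartic_cdf -mulrBl; congr (_ / _).
have iq := integrable_quartic_density.
rewrite (@Rintegral_itvB _ _ -oo%O (BRight t)); first last.
- by rewrite bnd_simp.
- by [].
- by apply: (integrableS measurableT) iq.
rewrite Rintegral_mkcond; apply: eq_Rintegral => z _.
rewrite /patch; have [zin|zin] := boolP (z \in _).
  by move: zin; rewrite inE/= in_itv/= => ->; rewrite mulr1.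
case: ifP => [zst|_]; last by rewrite mulr0.
by move: zin; rewrite notin_setE/= in_itv/= zst.
Qed.

Lemma ising_probE N (J : seq 'I_N -> R) p (beta : R) (A : set (N.-tuple bool)) :
  ising_prob J p beta A =
  (\sum_(x : N.-tuple bool) ising_pmf J p beta x * (if x \in A then 1 else 0))%:E.
Proof.
rewrite /ising_prob -sumEFin; apply: eq_bigr => x _.
by rewrite diracE EFinM; case: (x \in A).
Qed.

Lemma cvg_step (u : nat -> R) l t : u N @[N --> \oo] --> l -> l != t ->
  (if u N <= t then 1 else 0 : R) @[N --> \oo] --> (if l <= t then 1 else 0 : R).
Proof.
move=> ul lt; have [le_lt|t_l] := leP l t; apply: cvg_near_cst.
  have {}lt : l < t by rewrite lt_neqAle lt.
  near=> N; suff -> : u N <= t by [].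
  by near: N; exact: (cvgr_le _ ul _ lt).
near=> N; suff /lt_geF -> : t < u N by [].
by near: N; exact: (cvgr_gt _ ul _ t_l).
Unshelve. all: by end_near. Qed.

(** [laplace_total_quartic] applied to the indicator of the event and to 1. The
limiting event is [z ^+ 2 / 6 <= t]; it differs from the half-open interval of
the statement at one point, and convergence of the indicators may fail only at
the boundary points and at 0. *)
Lemma cvg_mple_fluctuation_quartic t :
  curie_weiss_prob N 2 2^-1
    [set x | ((Num.sqrt N%:R)%:E * (curie_weiss_mpl R 2 x - (2^-1)%:E) <= t%:E)%E]
    @[N --> \oo] -->
  (if 0 <= t then quartic_cdf (Num.sqrt (6 * t)) - quartic_cdf (- Num.sqrt (6 * t))
   else 0)%:E.
Proof.
(* The scale for which N h^4 = 1. *)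
pose h N : R := (Num.sqrt (Num.sqrt N%:R))^-1.
have hN0 N : (0 < N)%N -> 0 < h N by move=> N0; rewrite invr_gt0 !sqrtr_gt0 ltr0n.
have hq N : (0 < N)%N -> N%:R * h N ^+ 4 = 1.
  move=> N0; rewrite /h exprVn (_ : 4 = 2 * 2)%N// exprM !sqr_sqrtr ?sqrtr_ge0//.
  by rewrite divff// pnatr_eq0 -lt0n.
have hc : h N @[N --> \oo] --> 0.
  have c : Num.sqrt (Num.sqrt (N%:R : R)) @[N --> \oo] --> +oo.
    by do 2 apply: cvg_sqrt_pinfty; exact: cvgr_idn.
  apply/gtr0_cvgV0 => //.
  by near=> N; rewrite !sqrtr_gt0 ltr0n; near: N; exists 1%N.
pose F N x : R :=
  if ((Num.sqrt N%:R)%:E * (mple_of_mean 2 x - (2^-1)%:E) <= t%:E)%E then 1 else 0.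
pose a := Num.sqrt (6 * t).
have a0 : 0 <= a by exact: sqrtr_ge0.
pose phi z : R := if - a < z <= a then 1 else 0.
have F1 N x : `|F N x| <= 1 by rewrite /F; case: ifP; rewrite ?normr1 ?normr0.
have mphi : measurable_fun setT phi.
  by apply: measurable_fun_ifT => //; apply: measurable_and;
    [exact: measurable_fun_ltr|exact: measurable_fun_ler].
have phiE z : z != - a -> z != 0 -> (z ^+ 2 / 6 <= t) = (- a < z <= a).
  move=> za z0; rewrite ler_pdivrMr ?ltr0n// [t * 6]mulrC lt_neqAle eq_sym za/= -ler_norml.
  rewrite -sqrtr_sqr; have [t0|t0] := leP 0 t; first by rewrite ler_sqrt// mulr_ge0.
  have z2 : 0 < z ^+ 2 by rewrite exprn_even_gt0.
  rewrite /a [Num.sqrt (6 * t)]ler0_sqrtr; last lra.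
  rewrite [RHS]leNgt sqrtr_gt0 z2/=; apply/negbTE; rewrite -ltNge; lra.
have Fphi : {ae mu, forall z, forall zs : nat -> R, zs N @[N --> \oo] --> z ->
    F N (h N * zs N) @[N --> \oo] --> phi z}.
  exists [set 0; a; - a]; split.
  - by apply: measurableU => //; exact: measurableU.
  - by apply: countable_lebesgue_measure0; apply: finite_set_countable.
  move=> z /= nP; apply: contrapT => zA; apply: nP => zs zsz.
  have z0 : z != 0 by apply/eqP => z0; apply: zA; left; left.
  have za : z != a by apply/eqP => z0'; apply: zA; left; right.
  have zNa : z != - a by apply/eqP => z0'; apply: zA; right.
  have zt : z ^+ 2 / 6 != t.
    apply/eqP => zt; have aE : a = `|z| by rewrite /a -zt mulrC divfK// sqrtr_sqr.
    have [zp|zn] := leP 0 z; first by move: za; rewrite aE ger0_norm ?eqxx.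
    by move: zNa; rewrite aE ltr0_norm// opprK eqxx.
  rewrite /phi -(phiE _ zNa z0).
  have [u ul uE] := cvg_mple_quartic zsz z0 hN0 hc hq.
  apply: cvg_trans (cvg_step ul zt); apply: near_eq_cvg.
  by apply: filterS uE => N uEN; rewrite /F uEN lee_fin.
have num := laplace_total_quartic hN0 hc hq F1 mphi Fphi.
have den : laplace_sum (fun t => 2^-1 * t ^+ 2) (h N) predT (fun=> 1) N @[N --> \oo] -->
    (stirling_constant R)^-1 * \int[mu]_z (expR (- (z ^+ 4 / 12)) * 1).
  apply: (laplace_total_quartic (F := fun _ _ => 1) (phi := fun=> 1) (K := 1) hN0 hc hq) => //.
    by move=> _ _; rewrite normr1.
  by apply: aeW => z zs _; exact: cvg_cst.
have q0 := Rintegral_quartic_gt0.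
have denE : \int[mu]_z (expR (- (z ^+ 4 / 12)) * 1) = \int[mu]_z quartic_density z.
  by apply: eq_Rintegral => z _; rewrite mulr1.
have s0 := stirling_constant_gt0 R.
have -> : (if 0 <= t then quartic_cdf a - quartic_cdf (- a) else 0) =
    quartic_cdf a - quartic_cdf (- a).
  case: ifPn => //; rewrite -ltNge => t0.
  have -> : a = 0 by rewrite /a ler0_sqrtr// pmulr_rle0 ?ltr0n// ltW.
  by rewrite oppr0 subrr.
rewrite quartic_cdfB ?ge0_cp//; set L := _ / _.
have LE : (stirling_constant R)^-1 * (\int[mu]_z (expR (- (z ^+ 4 / 12)) * phi z)) /
    ((stirling_constant R)^-1 * \int[mu]_z (expR (- (z ^+ 4 / 12)) * 1)) = L.
  by rewrite denE -mulf_div divff ?mul1r// gt_eqF// invr_gt0.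
have : (laplace_sum (fun t => 2^-1 * t ^+ 2) (h N) predT (F N) N /
   laplace_sum (fun t => 2^-1 * t ^+ 2) (h N) predT (fun=> 1) N)%:E @[N --> \oo] --> L%:E.
  apply: cvg_EFin; first exact: nearW.
  rewrite -LE; apply: cvgM => //; apply: cvgV => //.
  by rewrite denE gt_eqF// mulr_gt0// invr_gt0.
apply: cvg_trans; apply: near_eq_cvg; near=> N.
have N0 : (0 < N)%N by near: N; exists 1%N.
rewrite -cw_expectation_laplace ?hN0//; apply: etrans (esym (ising_probE _ _ _ _)).
congr _%:E; apply: eq_bigr => x _; congr (_ * _).
rewrite /F -curie_weiss_mplE//.
case: ifP => le; [rewrite mem_set//|rewrite memNset//=].
by rewrite le.
Unshelve. all: by end_near. Qed.

End quartic_law.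

Unset Implicit Arguments.

Theorem theorem2p16 (R : realType) (p : nat) (beta : R)
    (hp : (2 <= p)%N) (hbeta : beta = cw_threshold R p) :
  (p = 2%N ->
     beta = 2^-1 /\
     forall t : R,
       curie_weiss_prob N p beta
         [set x | ((Num.sqrt N%:R)%:E *
                   (curie_weiss_mpl R p x - (2^-1)%:E) <= t%:E)%E]
         @[N --> \oo] -->
       (if 0 <= t
        then quartic_cdf (Num.sqrt (6 * t)) - quartic_cdf (- Num.sqrt (6 * t))
        else 0)%:E) /\
  ((3 <= p)%N ->
     exists m : R,
       [/\ 0 < m < 1, is_global_maximizer beta p m &
           forall t, 0 < t -> is_global_maximizer beta p t -> t = m] /\
       let g'' := derive1n 2 (cw_free_energy beta p) in
       let a := cw_alpha01 beta p m in
       [/\ cvg_in_distribution (fun N => curie_weiss_prob N p beta)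
             (fun N x => ((Num.sqrt N%:R)%:E *
                          (curie_weiss_mpl R p x - beta%:E))%E)
             (measure_add
                (mscale (1 - a%:num)%:nng
                   (normal_bar 0 (- (g'' m / (p%:R ^+ 2 * m ^+ (2 * p - 2))))))
                (mscale a%:num%:nng \d_(+oo%E : \bar R))),
           (4 <= p)%N -> ~~ odd p ->
           cvg_in_distribution (fun N => curie_weiss_prob N p beta)
             (fun N x => ((N%:R `^ (1 - p%:R / 2))%:E *
                          curie_weiss_mpl R p x)%E)
             (measure_add
                (mscale a%:num%:nng (inv_pow_normal R p))
                (mscale (1 - a%:num)%:nng \d_(0%E : \bar R))) &
           odd p ->
           cvg_in_distribution (fun N => curie_weiss_prob N p beta)
             (fun N x => ((N%:R `^ (1 - p%:R / 2))%:E *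
                          curie_weiss_mpl R p x)%E)
             (measure_add
                (measure_add
                   (mscale (a%:num / 2)%:nng (inv_abs_pow_normal R p))
                   (mscale (a%:num / 2)%:nng \d_(+oo%E : \bar R)))
                (mscale (1 - a%:num)%:nng \d_(0%E : \bar R)))]).
Proof.
split=> [p2|p3].
  have {hbeta} -> : beta = 2^-1 by rewrite hbeta p2 cw_threshold2.
  rewrite {}p2; split=> // t.
  exact: cvg_mple_fluctuation_quartic.
have [m m01 mE] := exists_critical_ratio R p3.
have p0 : (0 < p)%N by exact: leq_trans p3.
have {hbeta} -> : beta = entropyI m / m ^+ p.
  by rewrite hbeta (cw_threshold_critical p0 m01 mE).
have [mmax muniq] := critical_maximizer p3 m01 mE.
exists m; split; first by split.
split.
- exact: cvg_mple_scaled.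
- by move=> _ peven; exact: cvg_mple_pow_even.
- by move=> podd; exact: cvg_mple_pow_odd.
Qed.
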